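(* Let $a:\mathbb{Z}_{\ge 1}\to\mathbb{Z}$ be the multiplicative function determined on prime powers by $$a(p^f)=\sigma_1(p^f)\ \text{ for } p>2 \text{ prime},\qquad a(2^f)=2^f,$$ where $\sigma_1$ is the sum-of-divisors function. Equivalently, with $q=e^{-\pi y}$ ($y>0$) and $\theta_4(y)=\sum_{n\in\mathbb{Z}}(-1)^nq^{n^2}$, the $a(n)$ are given by $\dot\theta_4/\theta_4=2\pi\sum_{n\ge1}a(n)q^n$, the dot denoting $d/dy$. Then for every complex $s$ (the left-hand side being understood via its analytic continuation), $$\frac{s}{4\pi}\left(2^{\frac{s-1}{2}}-2^{\frac{1-s}{2}}\right)\pi^{-\frac{s}{2}}\Gamma\!\left(\frac{s}{2}\right)\zeta(s)=\sum_{n=1}^{\infty}a(n)\,n^{-\frac{1+s}{4}}\sum_{m=0}^{\infty}(2m+1)^{\frac{s+1}{2}}K_{\frac{s+1}{2}}\!\left(\pi\sqrt{n}(2m+1)\right).$$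
   Context: $\zeta$ is the Riemann zeta function, $\Gamma$ the Gamma function, and $K_\nu$ the modified Bessel function of the second kind, $2K_\nu(x)=\int_0^\infty u^{\nu-1}e^{-\frac{x}{2}(u+1/u)}\,du$ for $x>0$. *)

(* Defs.v *)
From Stdlib Require Import Reals ZArith Znumtheory List.
From Coquelicot Require Import Coquelicot.

Local Open Scope R_scope.

Definition sigma1 (n : nat) : nat :=
  list_sum (filter (fun d => Nat.eqb (Nat.modulo n d) 0) (seq 1 n)).

(** Arithmetic functions on the positive integers are functions on [nat] whose
    value at [0] is left unconstrained and never used. *)
Definition multiplicative (a : nat -> Z) : Prop :=
  a 1%nat = 1%Z /\
  forall m n : nat, (1 <= m)%nat -> (1 <= n)%nat -> Nat.gcd m n = 1%nat ->
    a (m * n)%nat = (a m * a n)%Z.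

Definition is_theta4_coef (a : nat -> Z) : Prop :=
  multiplicative a /\
  (forall p f : nat, prime (Z.of_nat p) -> (2 < p)%nat -> (1 <= f)%nat ->
     a (p ^ f)%nat = Z.of_nat (sigma1 (p ^ f))) /\
  (forall f : nat, (1 <= f)%nat -> a (2 ^ f)%nat = Z.of_nat (2 ^ f)).

Definition nome (y : R) : R := exp (- PI * y).

Definition theta4_term (y : R) (n : Z) : R :=
  powerRZ (-1) n * powerRZ (nome y) (n * n).

(** The bilateral series, split into the indices [n >= 0] and [n <= -1]. *)
Definition theta4 (y : R) : R :=
  Series (fun k => theta4_term y (Z.of_nat k)) +
  Series (fun k => theta4_term y (- Z.of_nat (S k))).

Definition theta4_log_derivative_expansion (a : nat -> Z) : Prop :=
  forall y : R, 0 < y ->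
    theta4 y <> 0 /\ ex_derive theta4 y /\
    exists l : R,
      is_series (fun k => IZR (a (S k)) * nome y ^ (S k)) l /\
      Derive theta4 y / theta4 y = 2 * PI * l.

(** [x ^ s = exp (s * ln x)] for real [x > 0] and complex [s]. *)
Definition Rcpow (x : R) (s : C) : C :=
  (exp (Re s * ln x) * cos (Im s * ln x),
   exp (Re s * ln x) * sin (Im s * ln x)).

Definition CInt_0_infty (f : R -> C) : C :=
  @RInt_gen C_R_CompleteNormedModule f (at_right 0) (Rbar_locally p_infty).

(** Euler's integral; meaningful for [0 < Re s] only. *)
Definition CGamma (s : C) : C :=
  CInt_0_infty (fun t => (Rcpow t (s - 1) * exp (- t))%C).

(** The Dirichlet series; meaningful for [1 < Re s] only. *)
Definition Czeta (s : C) : C :=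
  (Series (fun k => Re (Rcpow (INR (S k)) (- s))),
   Series (fun k => Im (Rcpow (INR (S k)) (- s)))).

(** Meaningful for [0 < x] only. *)
Definition besselK (nu : C) (x : R) : C :=
  (CInt_0_infty (fun u => Rcpow u (nu - 1) * exp (- (x / 2) * (u + / u)))
   / 2)%C.

Definition entire (F : C -> C) : Prop :=
  forall s : C, @ex_derive C_AbsRing C_NormedModule F s.

(** [F] is the analytic continuation to the whole plane of [f] restricted to
    the half-plane [c < Re s]; [F] is unique by the identity theorem. *)
Definition entire_continuation (c : R) (f F : C -> C) : Prop :=
  entire F /\ forall s : C, c < Re s -> F s = f s.

Definition zeta_side (s : C) : C :=
  (s / (4 * PI)%R
   * (Rcpow 2 ((s - 1) / 2) - Rcpow 2 ((1 - s) / 2))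
   * Rcpow PI (- (s / 2)) * CGamma (s / 2) * Czeta s)%C.

(* Main.v *)
Require Import Defs.
From Stdlib Require Import Reals ZArith Znumtheory List Permutation FinFun Lia Lra Psatz.
From Coquelicot Require Import Coquelicot.

Local Open Scope R_scope.

(** The product [theta4 = prod_k (1 - q^k) / (1 + q^k)] shows that
    [theta4' / theta4 = 2 pi A(y)], where [A(y) = sum_n a(n) q^n] and [a(n)] is the sum of the
    divisors [d] of [n] with [n / d] odd. By the modular transformation,
    [B(y) = sum_m exp (- pi (2m+1)^2 / (4y))] equals [sqrt y theta4(y) / 2], so that
    [A(y) B(y) = sqrt y theta4'(y) / (4 pi)]. Let [F(s)] be the integral over [y > 0] of
    [(2y)^((s-1)/2) A(y) B(y)]. Since [A B] decays exponentially both at 0 and at infinity,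
    [F] is entire. Expanding [A] and [B] and integrating termwise gives the double Bessel series.
    For [Re s > 1], integration by parts turns [F(s)] into the Mellin transform of
    [1 - theta4], which is [pi^(-s/2) Gamma(s/2)] times the alternating zeta series. *)

(** * Series *)

(** Multiplying by B is the decisive step: A is a quotient with [theta4] in the denominator and
    grows as y tends to 0, while B cancels that denominator and brings the decay at 0. Both facts
    about [theta4] come from finite identities followed by dominated convergence of series. The
    product rests on Shanks' finite form of Gauss' identity. The modular relation rests on Pólya's
    argument: averaging (2 cos t)^(2N) over h + 1 midpoints singles out every 2(h+1)-st binomial
    coefficient, and with N proportional to (h+1)^2 both sides converge to Gaussian series, dual to
    each other. The two descriptions of a(n) are never compared directly; each is shown to be
    equivalent to agreement with the divisor sum [asum]. The power of 2y, instead of y, is what the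
    substitution into the Bessel integral produces; it also yields the symmetric bracket 2^((s-1)/2)
    - 2^((1-s)/2). Majorants always have the separated form c(n) g(y), so that a single theorem on
    termwise integration serves the zeta series, the inner Bessel sums and the outer sum. *)

Lemma ex_series_Rbound (u c : nat -> R) :
  (forall k, Rabs (u k) <= c k) -> ex_series c -> ex_series u.
Proof. exact (@ex_series_le R_AbsRing R_CompleteNormedModule u c). Qed.

Lemma Series_Rbound (u c : nat -> R) :
  (forall k, Rabs (u k) <= c k) -> ex_series c -> Rabs (Series u) <= Series c.
Proof.
  intros H Hc.
  apply Rle_trans with (Series (fun k => Rabs (u k))).
  - apply Series_Rabs, ex_series_Rbound with c; auto.
    intros k; rewrite Rabs_Rabsolu; auto.
  - apply Series_le; auto. intros k; split; auto using Rabs_pos.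
Qed.

Lemma is_lim_seq_sum_n (u : nat -> nat -> R) (v : nat -> R) (K : nat) :
  (forall k, is_lim_seq (fun N => u N k) (v k)) ->
  is_lim_seq (fun N => sum_n (u N) K) (sum_n v K).
Proof.
  intros H. induction K as [|K IH].
  - apply is_lim_seq_ext with (fun N => u N O).
    + intros n; now rewrite sum_O.
    + rewrite sum_O; auto.
  - rewrite sum_Sn.
    apply is_lim_seq_ext with (fun N => sum_n (u N) K + u N (S K)).
    + intros n; now rewrite sum_Sn.
    + apply (is_lim_seq_plus' _ _ _ _ IH (H (S K))).
Qed.

Lemma Series_tail (u : nat -> R) (K : nat) :
  ex_series u -> Series u = sum_n u K + Series (fun k => u (S K + k)%nat).
Proof.
  intros H. rewrite (Series_incr_n u (S K)) by (auto with arith).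
  now rewrite sum_n_Reals.
Qed.

Lemma is_lim_seq_Series_tail (c : nat -> R) :
  ex_series c -> is_lim_seq (fun K => Series (fun k => c (S K + k)%nat)) 0.
Proof.
  intros Hc.
  apply is_lim_seq_ext with (fun K => Series c - sum_n c K).
  - intros K; rewrite (Series_tail c K Hc); ring.
  - replace (Finite 0) with (Finite (Series c - Series c)) by (f_equal; ring).
    apply is_lim_seq_minus'.
    + apply is_lim_seq_const.
    + exact (Series_correct c Hc).
Qed.

Lemma ex_series_shift (c : nat -> R) (K : nat) :
  ex_series c -> ex_series (fun k => c (S K + k)%nat).
Proof. apply (ex_series_incr_n c (S K)). Qed.

(** Dominated convergence for series: beyond an index [K] where the tail of [c] is below [eps / 3],
    both tails are negligible, and the remaining finite sums converge termwise. *)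
Lemma tannery (u : nat -> nat -> R) (v c : nat -> R) :
  (forall N k, Rabs (u N k) <= c k) -> ex_series c ->
  (forall k, is_lim_seq (fun N => u N k) (v k)) ->
  is_lim_seq (fun N => Series (u N)) (Series v).
Proof.
  intros Hb Hc Hl.
  assert (Hv : forall k, Rabs (v k) <= c k).
  { intros k.
    apply (is_lim_seq_le (fun N => Rabs (u N k)) (fun _ => c k) (Rabs (v k)) (c k)).
    - intros n; apply Hb.
    - apply (is_lim_seq_abs (fun N => u N k) (v k)), Hl.
    - apply is_lim_seq_const. }
  apply is_lim_seq_spec. intros eps.
  assert (He : 0 < eps / 3) by (generalize (cond_pos eps); lra).
  destruct (proj2 (is_lim_seq_spec _ _) (is_lim_seq_Series_tail c Hc) (mkposreal _ He))
    as [K HK].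
  specialize (HK K (le_n K)); simpl in HK; rewrite Rminus_0_r in HK.
  destruct (proj2 (is_lim_seq_spec _ _) (is_lim_seq_sum_n u v K Hl) (mkposreal _ He))
    as [N HN].
  exists N. intros n Hn. specialize (HN n Hn); simpl in HN.
  assert (Hu : ex_series (u n)) by (apply ex_series_Rbound with c; auto).
  assert (Hv' : ex_series v) by (apply ex_series_Rbound with c; auto).
  rewrite (Series_tail (u n) K Hu), (Series_tail v K Hv').
  assert (Tu := Series_Rbound (fun k => u n (S K + k)%nat) (fun k => c (S K + k)%nat)
    (fun k => Hb n _) (ex_series_shift c K Hc)).
  assert (Tv := Series_Rbound (fun k => v (S K + k)%nat) (fun k => c (S K + k)%nat)
    (fun k => Hv _) (ex_series_shift c K Hc)).
  simpl in Tu, Tv |- *. revert HN HK Tu Tv.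
  unfold Rabs; repeat destruct Rcase_abs; lra.
Qed.

(* The values of [u] placed at the multiples of [S d]. *)
Definition spread (d : nat) (u : nat -> R) (n : nat) : R :=
  if Nat.eqb (n mod S d) 0 then u (n / S d)%nat else 0.

Lemma sum_n_spread (d : nat) (u : nat -> R) (n : nat) :
  sum_n (spread d u) n = sum_n u (n / S d).
Proof.
  assert (Hd := fun n => Nat.div_mod n (S d) (Nat.neq_succ_0 d)).
  assert (Hm := fun n => Nat.mod_upper_bound n (S d) (Nat.neq_succ_0 d)).
  induction n as [|n IH].
  - rewrite Nat.div_small by lia. rewrite !sum_O. unfold spread.
    now rewrite Nat.mod_small, Nat.div_small by lia.
  - rewrite sum_Sn, IH. unfold spread.
    pose proof (Hd n) as H1. pose proof (Hm n) as H2.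
    pose proof (Hd (S n)) as H3. pose proof (Hm (S n)) as H4.
    destruct (Nat.eqb_spec (S n mod S d) 0) as [E|E].
    + assert (Q : (S n / S d = S (n / S d))%nat) by nia.
      rewrite Q. now rewrite sum_Sn.
    + assert (Q : (S n / S d = n / S d)%nat) by nia.
      rewrite Q. apply Rplus_0_r.
Qed.

Lemma is_series_spread (d : nat) (u : nat -> R) (l : R) :
  is_series u l -> is_series (spread d u) l.
Proof.
  intros H. unfold is_series in *.
  apply filterlim_ext with (fun n => sum_n u (n / S d)).
  - intros n; symmetry; apply sum_n_spread.
  - apply filterlim_comp with (2 := H). intros P [N HN].
    exists (S d * N)%nat. intros n Hn. apply HN.
    apply Nat.div_le_lower_bound; lia.
Qed.

Lemma exp_mono (x y : R) : x <= y -> exp x <= exp y.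
Proof. intros [H| ->]; [left; now apply exp_increasing|right; reflexivity]. Qed.

(** * The product and the logarithmic derivative of [theta4] *)

(* [ring] and [field] do not see through the carrier of a canonical structure. *)
Ltac at_R := match goal with |- @eq _ ?a ?b => change (@eq R a b) end.
Ltac at_C := match goal with |- @eq _ ?a ?b => change (@eq C a b) end.

Fixpoint gauss_prod (x : R) (n : nat) : R :=
  match n with
  | O => 1
  | S m => gauss_prod x m * ((1 - x ^ n) / (1 + x ^ n))
  end.

Lemma pow_unit_interval (x : R) (n : nat) : 0 <= x < 1 -> 0 <= x ^ n <= 1.
Proof.
  intros H. split; [apply pow_le; lra|].
  rewrite <- (pow1 n). apply pow_incr; lra.
Qed.

Lemma pow_S_unit_interval (x : R) (n : nat) : 0 <= x < 1 -> 0 <= x ^ S n < 1.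
Proof.
  intros H. pose proof (pow_unit_interval x n H). simpl. nra.
Qed.

Lemma gauss_prod_pos (x : R) (n : nat) : 0 <= x < 1 -> 0 < gauss_prod x n.
Proof.
  intros H. induction n as [|n IH]; [simpl; lra|].
  pose proof (pow_S_unit_interval x n H).
  cbn [gauss_prod]. apply Rmult_lt_0_compat; auto.
  apply Rdiv_lt_0_compat; lra.
Qed.

Lemma gauss_prod_decr (x : R) (m n : nat) :
  0 <= x < 1 -> (m <= n)%nat -> gauss_prod x n <= gauss_prod x m.
Proof.
  intros H. induction 1 as [|n Hn IH]; [lra|].
  apply Rle_trans with (2 := IH).
  pose proof (pow_S_unit_interval x n H). pose proof (gauss_prod_pos x n H).
  cbn [gauss_prod]. rewrite <- (Rmult_1_r (gauss_prod x n)) at 2.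
  apply Rmult_le_compat_l; [lra|].
  apply Rle_div_l; lra.
Qed.

(** For s <= n the quotient is the product of (1 - x^k) / (1 + x^k) over s < k <= n. At s = 0 the
    last factor is 1, so that the term is the whole product [gauss_prod x n]; all other terms carry
    the small factor x^(s(n+1)). *)
Definition shanks_term (x : R) (n s : nat) : R :=
  (-1) ^ s * (gauss_prod x n / gauss_prod x s) * x ^ (s * S n) * (2 / (1 + x ^ s)).

(* The differences [shanks_term x (S n) s - shanks_term x n s] telescope. *)
Lemma sum_shanks_diff (x : R) (n M : nat) : 0 <= x < 1 ->
  sum_n (fun s => shanks_term x (S n) s - shanks_term x n s) M =
  - (2 * gauss_prod x n / (1 + x ^ S n)) *
  ((-1) ^ M * x ^ (S M * S n) / gauss_prod x M).
Proof.
  intros Hx. pose proof (pow_S_unit_interval x n Hx) as HN.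
  induction M as [|M IH].
  - rewrite sum_O. unfold shanks_term. rewrite !Nat.mul_0_l, Nat.mul_1_l.
    cbn [gauss_prod]. set (X := x ^ S n) in *.
    rewrite !pow_O. at_R. field. lra.
  - rewrite sum_Sn, IH. unfold shanks_term. cbn [plus AbelianMonoid.plus].
    pose proof (pow_S_unit_interval x M Hx) as HM.
    pose proof (gauss_prod_pos x M Hx).
    replace (x ^ (S M * S (S n))) with (x ^ (S M * S n) * x ^ S M)
      by (rewrite <- pow_add; f_equal; lia).
    replace (x ^ (S (S M) * S n)) with (x ^ (S M * S n) * x ^ S n)
      by (rewrite <- pow_add; f_equal; lia).
    cbn [gauss_prod].
    replace ((-1) ^ S M) with (- (-1) ^ M) by (simpl; ring).
    set (X := x ^ S n) in *. set (Z := x ^ S M) in *. set (W := x ^ (S M * S n)).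
    change plus with Rplus. at_R. field. repeat split; lra.
Qed.

(* D. Shanks' finite form of Gauss' identity
   [sum_j (-1)^j x^(j^2) = prod_k (1 - x^k) / (1 + x^k)]. *)
Lemma shanks_identity (x : R) (n : nat) : 0 <= x < 1 ->
  2 * sum_n (fun j => (-1) ^ j * x ^ (j * j)) n - 1 = sum_n (shanks_term x n) n.
Proof.
  intros Hx. induction n as [|n IH].
  - rewrite !sum_O. unfold shanks_term. simpl. field.
  - pose proof (pow_S_unit_interval x n Hx) as HN.
    pose proof (gauss_prod_pos x n Hx) as HP.
    pose proof (gauss_prod_pos x (S n) Hx) as HP'.
    rewrite !sum_Sn. change plus with Rplus.
    (* Passing to [S n] alters every old term and adds one new term; the telescoped change and the
       new term together give the next term of the theta series, twice (-1)^(n+1) x^((n+1)^2). *)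
    replace (sum_n (shanks_term x (S n)) n) with
      (sum_n (shanks_term x n) n +
       sum_n (fun s => shanks_term x (S n) s - shanks_term x n s) n).
    2:{ rewrite <- (sum_n_plus (G := R_AbelianMonoid)). apply sum_n_ext.
        intros k. change plus with Rplus. at_R. ring. }
    rewrite <- IH, sum_shanks_diff by assumption. unfold shanks_term.
    replace (x ^ (S n * S (S n))) with (x ^ (S n * S n) * x ^ S n)
      by (rewrite <- pow_add; f_equal; lia).
    replace ((-1) ^ S n) with (- (-1) ^ n) by (simpl; ring).
    set (X := x ^ S n) in *. set (W := x ^ (S n * S n)).
    at_R. field. repeat split; lra.
Qed.

Lemma Rabs_pow_m1 (n : nat) : Rabs ((-1) ^ n) = 1.
Proof. rewrite <- RPow_abs, Rabs_left by lra. replace (- -1) with 1 by ring. apply pow1. Qed.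

Lemma pow_le_exponent (x : R) (m n : nat) : 0 <= x < 1 -> (m <= n)%nat -> x ^ n <= x ^ m.
Proof.
  intros Hx H. replace n with (m + (n - m))%nat by lia. rewrite pow_add.
  pose proof (pow_unit_interval x m Hx). pose proof (pow_unit_interval x (n - m) Hx). nra.
Qed.

Lemma ex_series_pow (x : R) : 0 <= x < 1 -> ex_series (fun n => x ^ n).
Proof. intros H. apply ex_series_geom. rewrite Rabs_pos_eq; lra. Qed.

Lemma ex_series_theta (x : R) :
  0 <= x < 1 -> ex_series (fun j => (-1) ^ j * x ^ (j * j)).
Proof.
  intros H. apply ex_series_Rbound with (fun n => x ^ n); [|now apply ex_series_pow].
  intros k. rewrite Rabs_mult, Rabs_pow_m1, Rmult_1_l.
  rewrite Rabs_pos_eq by (apply pow_unit_interval; lra).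
  apply pow_le_exponent; auto. nia.
Qed.

Lemma nome_unit_interval (y : R) : 0 < y -> 0 < nome y < 1.
Proof.
  intros Hy. unfold nome. split; [apply exp_pos|]. rewrite <- exp_0.
  apply exp_increasing. pose proof PI_RGT_0. nra.
Qed.

Lemma theta4_Series (y : R) : 0 < y ->
  theta4 y = 2 * Series (fun j => (-1) ^ j * nome y ^ (j * j)) - 1.
Proof.
  intros Hy. assert (Hq : 0 <= nome y < 1) by (pose proof (nome_unit_interval y Hy); lra).
  unfold theta4. pose proof (ex_series_theta _ Hq) as He.
  rewrite (Series_ext (fun k => theta4_term y (Z.of_nat k))
             (fun j => (-1) ^ j * nome y ^ (j * j))).
  2:{ intros k. unfold theta4_term. now rewrite <- Nat2Z.inj_mul, <- !pow_powerRZ. }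
  rewrite (Series_ext (fun k => theta4_term y (- Z.of_nat (S k)))
             (fun j => (-1) ^ S j * nome y ^ (S j * S j))).
  2:{ intros k. unfold theta4_term. rewrite Z.mul_opp_opp, <- Nat2Z.inj_mul.
      rewrite <- pow_powerRZ. f_equal.
      rewrite powerRZ_neg', <- powerRZ_inv', <- pow_powerRZ. f_equal. lra. }
  rewrite (Series_incr_1 _ He). simpl. ring.
Qed.

(** The term s = 0 is the product itself. Each of the n others is at most 2 x^n in absolute value,
    because the partial products decrease and s(n+1) >= n. *)
Lemma shanks_tail (x : R) (n : nat) : 0 <= x < 1 ->
  Rabs (sum_n (shanks_term x n) n - gauss_prod x n) <= 2 * (INR n * x ^ n).
Proof.
  intros Hx.
  assert (Hm : forall m, (m <= n)%nat ->
    Rabs (sum_n (shanks_term x n) m - gauss_prod x n) <= 2 * (INR m * x ^ n)).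
  2: apply Hm, le_n.
  intros m Hm. pose proof (gauss_prod_pos x n Hx) as HPn.
  induction m as [|m IH].
  - rewrite sum_O. unfold shanks_term. simpl.
    rewrite Rabs_right; [|right]; lra.
  - rewrite sum_Sn, S_INR. change plus with Rplus.
    specialize (IH ltac:(lia)).
    assert (Ht : Rabs (shanks_term x n (S m)) <= 2 * x ^ n).
    { pose proof (pow_S_unit_interval x m Hx).
      pose proof (gauss_prod_pos x (S m) Hx) as HP.
      pose proof (gauss_prod_decr x (S m) n Hx Hm) as HD.
      unfold shanks_term.
      rewrite !Rabs_mult, Rabs_pow_m1, Rmult_1_l.
      rewrite (Rabs_pos_eq (_ / _)) by (apply Rlt_le, Rdiv_lt_0_compat; lra).
      rewrite (Rabs_pos_eq (x ^ _)) by (now apply pow_unit_interval).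
      rewrite (Rabs_pos_eq (2 / _)) by (apply Rlt_le, Rdiv_lt_0_compat; lra).
      assert (gauss_prod x n / gauss_prod x (S m) <= 1) by (apply Rle_div_l; lra).
      assert (2 / (1 + x ^ S m) <= 2) by (apply Rle_div_l; nra).
      assert (x ^ (S m * S n) <= x ^ n) by (apply pow_le_exponent; [auto|nia]).
      assert (0 <= gauss_prod x n / gauss_prod x (S m))
        by (apply Rlt_le, Rdiv_lt_0_compat; lra).
      assert (0 <= 2 / (1 + x ^ S m)) by (apply Rlt_le, Rdiv_lt_0_compat; lra).
      assert (0 <= x ^ (S m * S n)) by now apply pow_unit_interval.
      rewrite (Rmult_comm 2). apply Rmult_le_compat; auto; [nra|].
      rewrite <- (Rmult_1_l (x ^ n)). apply Rmult_le_compat; auto. }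
    revert IH Ht. unfold Rabs; repeat destruct Rcase_abs; simpl; nra.
Qed.

Lemma CV_disk_le_radius (c : nat -> R) (r : R) : CV_disk c r -> Rbar_le r (CV_radius c).
Proof. apply (proj1 (Lub_Rbar_correct (CV_disk c))). Qed.

(** This is the derivative of the geometric power series, and differentiation preserves the radius
    of convergence. *)
Lemma ex_series_linear_pow (x : R) :
  0 <= x < 1 -> ex_series (fun n => INR (S n) * x ^ n).
Proof.
  intros Hx.
  assert (H1 : Rbar_lt (Rabs x) (CV_radius (fun _ => 1))).
  { apply Rbar_lt_le_trans with ((x + 1) / 2).
    - simpl. rewrite Rabs_pos_eq; lra.
    - apply CV_disk_le_radius.
      unfold CV_disk. apply ex_series_ext with (fun n => ((x + 1) / 2) ^ n).
      + intros n. rewrite Rmult_1_l, Rabs_pos_eq; auto. apply pow_le; lra.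
      + apply ex_series_pow; lra. }
  rewrite <- CV_radius_derive in H1.
  apply ex_series_Rabs.
  apply ex_series_ext with (fun n => Rabs (PS_derive (fun _ => 1) n * x ^ n)).
  - intros n. unfold PS_derive. now rewrite Rmult_1_r.
  - now apply CV_disk_inside.
Qed.

Lemma CV_radius_gt_of_linear (c : nat -> R) (C x : R) : 0 <= x < 1 ->
  (forall n, Rabs (c n) <= C * INR (S n)) -> Rbar_lt x (CV_radius c).
Proof.
  intros Hx Hc. apply Rbar_lt_le_trans with ((x + 1) / 2).
  - simpl. lra.
  - apply CV_disk_le_radius.
    unfold CV_disk.
    apply ex_series_Rbound with (fun n => C * (INR (S n) * ((x + 1) / 2) ^ n)).
    + intros n. rewrite Rabs_Rabsolu, Rabs_mult, <- Rmult_assoc.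
      rewrite (Rabs_pos_eq (_ ^ _)) by (apply pow_le; lra).
      apply Rmult_le_compat_r; auto. apply pow_le; lra.
    + apply (ex_series_scal (V := R_NormedModule) C), ex_series_linear_pow. lra.
Qed.

Lemma is_lim_seq_linear_pow (x : R) :
  0 <= x < 1 -> is_lim_seq (fun n => INR n * x ^ n) 0.
Proof.
  intros Hx. pose proof (ex_series_lim_0 _ (ex_series_linear_pow x Hx)) as H.
  apply is_lim_seq_le_le with (fun _ => 0) (fun n => INR (S n) * x ^ n); auto.
  - intros n. pose proof (pos_INR n). rewrite S_INR.
    pose proof (pow_unit_interval x n Hx). nra.
  - apply is_lim_seq_const.
Qed.

Lemma is_lim_seq_gauss_prod (y : R) : 0 < y ->
  is_lim_seq (gauss_prod (nome y)) (theta4 y).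
Proof.
  intros Hy. pose proof (nome_unit_interval y Hy) as Hq.
  assert (Hx : 0 <= nome y < 1) by lra. set (x := nome y) in *.
  set (T := fun n => 2 * sum_n (fun j => (-1) ^ j * x ^ (j * j)) n - 1).
  assert (HT : is_lim_seq T (theta4 y)).
  { rewrite theta4_Series by assumption. fold x.
    apply is_lim_seq_minus'; [|apply is_lim_seq_const].
    apply (is_lim_seq_scal_l _ 2 (Series _)).
    exact (Series_correct _ (ex_series_theta x Hx)). }
  apply is_lim_seq_ext with (fun n => T n - (T n - gauss_prod x n)).
  { intros n. ring. }
  replace (theta4 y) with (theta4 y - 0) by ring.
  apply is_lim_seq_minus'; auto.
  apply is_lim_seq_abs_0.
  apply is_lim_seq_le_le with (fun _ => 0) (fun n => 2 * (INR n * x ^ n)).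
  - intros n; split; [apply Rabs_pos|]. unfold T.
    rewrite shanks_identity by assumption. now apply shanks_tail.
  - apply is_lim_seq_const.
  - replace (Finite 0) with (Rbar_mult 2 0) by (simpl; f_equal; ring).
    apply is_lim_seq_scal_l. now apply is_lim_seq_linear_pow.
Qed.

(** The expansion of 2 artanh x. The series and the logarithm both vanish at 0 and both have
    derivative 2 / (1 - t^2) on [0, x], so the mean value theorem identifies them. *)
Lemma is_series_ln_quotient (x : R) : 0 <= x < 1 ->
  is_series (fun n => (if Nat.odd n then 2 / INR n else 0) * x ^ n)
    (ln ((1 + x) / (1 - x))).
Proof.
  intros Hx. set (c := fun n : nat => if Nat.odd n then 2 / INR n else 0).
  assert (Hc : forall n, Rabs (c n) <= 2 * INR (S n)).
  { intros [|n]; unfold c; [simpl; rewrite Rabs_R0; lra|].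
    destruct (Nat.odd (S n)).
    - rewrite (S_INR (S n)). pose proof (pos_INR n). rewrite S_INR.
      rewrite Rabs_pos_eq by (apply Rlt_le, Rdiv_lt_0_compat; lra).
      apply Rle_trans with 2; [apply Rle_div_l|]; nra.
    - rewrite Rabs_R0. pose proof (pos_INR (S (S n))). lra. }
  assert (Hr : forall t, 0 <= t < 1 -> Rbar_lt (Rabs t) (CV_radius c)).
  { intros t Ht. rewrite Rabs_pos_eq by lra. now apply CV_radius_gt_of_linear with 2. }
  assert (HD : forall t, 0 <= t < 1 -> PSeries (PS_derive c) t = 2 / (1 - t ^ 2)).
  { intros t Ht. apply is_series_unique.
    (* The derived coefficients are 2 at even exponents and 0 elsewhere: a geometric series in t^2,
       spread with period 2, which is encoded as [spread 1]. *)
    apply is_series_ext with (spread 1 (fun i => 2 * (t ^ 2) ^ i)).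
    - intros n. unfold spread, PS_derive, c. rewrite Nat.odd_succ.
      destruct (Nat.even n) eqn:E.
      + apply Nat.even_spec in E. destruct E as [m ->].
        rewrite Nat.mul_comm, Nat.Div0.mod_mul, Nat.div_mul by lia. simpl Nat.eqb. cbv iota.
        rewrite <- pow_mult, (Nat.mul_comm 2 m). at_R. field. apply not_0_INR. lia.
      + destruct (Nat.eqb_spec (n mod 2) 0) as [E'|E']; [|at_R; ring].
        apply Nat.Div0.mod_divides in E'. destruct E' as [m ->].
        rewrite Nat.even_mul in E. discriminate.
    - apply is_series_spread, (is_series_scal (V := R_NormedModule) 2).
      apply is_series_geom. rewrite Rabs_pos_eq; simpl; nra. }
  assert (HL : ex_series (fun n => c n * x ^ n)).
  { apply ex_series_Rabs, CV_disk_inside, Hr, Hx. }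
  replace (ln _) with (PSeries c x); [exact (Series_correct _ HL)|].
  destruct (Req_dec x 0) as [->|Hx0].
  { rewrite PSeries_0. replace ((1 + 0) / (1 - 0)) with 1 by field. now rewrite ln_1. }
  set (f := fun t => PSeries c t - (ln (1 + t) - ln (1 - t))).
  assert (Hf : forall t, 0 <= t <= x -> is_derive f t 0).
  { intros t Ht. unfold f.
    replace 0 with (PSeries (PS_derive c) t - (1 / (1 + t) - (-1) / (1 - t))).
    2:{ rewrite HD by lra. field. split; [|split]; nra. }
    apply (is_derive_minus (V := R_NormedModule)); [apply is_derive_PSeries, Hr; lra|].
    auto_derive; [lra|]. field. lra. }
  destruct (MVT_gen f 0 x (fun _ => 0)) as [t [_ Ht]].
  - intros t Ht. rewrite Rmin_left, Rmax_right in Ht by lra. apply Hf; lra.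
  - intros t Ht. rewrite Rmin_left, Rmax_right in Ht by lra.
    apply continuity_pt_filterlim, (ex_derive_continuous (V := R_NormedModule)). exists 0. now apply Hf.
  - unfold f in Ht. rewrite PSeries_0 in Ht. unfold Rdiv.
    rewrite ln_mult, ln_Rinv by (try apply Rinv_0_lt_compat; lra).
    replace (ln (1 + 0) - ln (1 - 0)) with 0 in Ht
      by (rewrite Rplus_0_r, Rminus_0_r, ln_1; ring).
    change (c O) with 0 in Ht. lra.
Qed.

(** * The divisor sum as coefficient of the logarithm of the product *)

Definition odd_codivisor (n d : nat) : bool :=
  andb (Nat.eqb (n mod d) 0) (Nat.odd (n / d)).

(** The truncation matches the first [K] factors of the product: minus the logarithm of factor k
    contributes 2/m at x^(km) for odd m, that is 2k/n at exponent n = km. *)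
Definition asum_upto (K n : nat) : nat :=
  list_sum (filter (odd_codivisor n) (seq 1 K)).

Definition asum (n : nat) : nat := asum_upto n n.

Lemma asum_upto_S (K n : nat) : asum_upto (S K) n =
  (asum_upto K n + if odd_codivisor n (S K) then S K else 0)%nat.
Proof.
  unfold asum_upto. rewrite seq_S, filter_app, list_sum_app. simpl.
  destruct odd_codivisor; simpl; lia.
Qed.

Lemma asum_upto_stable (K n : nat) : (n <= K)%nat -> asum_upto K n = asum n.
Proof.
  induction 1 as [|K HK IH]; auto. rewrite asum_upto_S, IH.
  (* The parity test rejects [S K], since the quotient is 0; this also covers n = 0, which every
     [S K] divides. *)
  unfold odd_codivisor. rewrite Nat.div_small, Bool.andb_false_r by lia. lia.
Qed.

(** Crude, but uniform in [K], as the dominated passage from partial products to [theta4] requires.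
    An accepted divisor is at most n, because its quotient is not 0. *)
Lemma asum_upto_le (K n : nat) : (asum_upto K n <= n * n)%nat.
Proof.
  assert (H : forall m, (asum_upto m n <= m * n)%nat).
  { induction m as [|m IH]; [now unfold asum_upto|].
    rewrite asum_upto_S. destruct (odd_codivisor n (S m)) eqn:E; [|nia].
    assert (n / S m <> 0)%nat.
    { intros E'. unfold odd_codivisor in E. rewrite E', Bool.andb_false_r in E. discriminate. }
    assert (~ (n < S m)%nat) by (intros L; apply H, Nat.div_small, L). nia. }
  destruct (Nat.le_gt_cases n K) as [L|L].
  - rewrite asum_upto_stable by lia. apply H.
  - apply Nat.le_trans with (1 := H K). nia.
Qed.

Lemma asum_coef_bound (K n : nat) :
  Rabs (2 * INR (asum_upto K n) / INR n) <= 2 * INR n.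
Proof.
  destruct n as [|n].
  - replace (asum_upto K 0) with O by (pose proof (asum_upto_le K 0); lia).
    simpl. unfold Rdiv. rewrite Rmult_0_r, Rmult_0_l, Rabs_R0. lra.
  - assert (0 < INR (S n)) by (apply lt_0_INR; lia).
    pose proof (pos_INR (asum_upto K (S n))).
    rewrite Rabs_pos_eq by (apply Rdiv_le_0_compat; lra).
    apply Rle_div_l; [lra|].
    rewrite Rmult_assoc, <- mult_INR. apply Rmult_le_compat_l; [lra|].
    apply le_INR, asum_upto_le.
Qed.

Lemma is_series_ln_gauss_prod (x : R) (K : nat) : 0 <= x < 1 ->
  is_series (fun n => 2 * INR (asum_upto K n) / INR n * x ^ n) (- ln (gauss_prod x K)).
Proof.
  intros Hx. induction K as [|K IH].
  - simpl. rewrite ln_1, Ropp_0.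
    assert (H0 : Rabs 0 < 1) by (rewrite Rabs_R0; lra).
    pose proof (is_series_scal (V := R_NormedModule) 0 _ _ (is_series_geom 0 H0)) as H.
    rewrite (scal_zero_l (V := R_NormedModule)) in H.
    apply is_series_ext with (2 := H).
    intros n. unfold asum_upto; simpl. unfold Rdiv. change scal with Rmult. at_R. ring.
  - pose proof (pow_S_unit_interval x K Hx) as HS.
    pose proof (gauss_prod_pos x K Hx).
    pose proof (is_series_spread K _ _ (is_series_ln_quotient _ HS)) as H1.
    pose proof (is_series_plus _ _ _ _ IH H1) as H2.
    replace (- ln (gauss_prod x (S K))) with
      (plus (- ln (gauss_prod x K)) (ln ((1 + x ^ S K) / (1 - x ^ S K)))).
    2:{ cbn [gauss_prod]. change plus with Rplus. unfold Rdiv.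
        assert (0 < / (1 - x ^ S K)) by (apply Rinv_0_lt_compat; lra).
        assert (0 < / (1 + x ^ S K)) by (apply Rinv_0_lt_compat; lra).
        rewrite !ln_mult by nra. rewrite !ln_Rinv by lra. at_R. ring. }
    apply is_series_ext with (2 := H2). intros n. change plus with Rplus. at_R.
    rewrite asum_upto_S, plus_INR. unfold spread, odd_codivisor.
    destruct (Nat.eqb_spec (n mod S K) 0) as [E|E]; cbn [andb].
    2:{ change (INR 0) with 0. ring_simplify. unfold Rdiv. ring. }
    apply Nat.Div0.mod_divides in E. destruct E as [m ->].
    rewrite (Nat.mul_comm (S K) m), Nat.div_mul by lia.
    destruct (Nat.odd m) eqn:Em.
    2:{ change (INR 0) with 0. unfold Rdiv. ring. }
    assert (m <> 0)%nat by (intros ->; discriminate).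
    rewrite <- pow_mult, (Nat.mul_comm (S K) m), mult_INR.
    field. split; apply not_0_INR; lia.
Qed.

(** The coefficients of - ln theta4 as a power series in the nome. At index 0 the value is 0, since
    [asum 0] is the empty sum. *)
Definition asum_ps (n : nat) : R := 2 * INR (asum n) / INR n.

Lemma CV_radius_asum_ps (x : R) : 0 <= x < 1 -> Rbar_lt (Rabs x) (CV_radius asum_ps).
Proof.
  intros Hx. rewrite Rabs_pos_eq by lra. apply CV_radius_gt_of_linear with 2; auto.
  intros n. apply Rle_trans with (1 := asum_coef_bound n n). rewrite S_INR. lra.
Qed.

(** Each partial product is the exponential of a power series whose n-th coefficient is eventually
    constant in [K] and bounded by 2n uniformly in [K], so the limit may be taken termwise. The
    exponential form also shows that [theta4] is positive, hence that its logarithmic derivative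
    makes sense. *)
Lemma theta4_exp (y : R) : 0 < y -> theta4 y = exp (- PSeries asum_ps (nome y)).
Proof.
  intros Hy. pose proof (nome_unit_interval y Hy) as Hq.
  assert (Hx : 0 <= nome y < 1) by lra.
  apply Rbar_finite_eq. rewrite <- (is_lim_seq_unique _ _ (is_lim_seq_gauss_prod y Hy)).
  apply is_lim_seq_unique.
  apply is_lim_seq_ext with
    (fun K => exp (- Series (fun n => 2 * INR (asum_upto K n) / INR n * nome y ^ n))).
  { intros K. rewrite (is_series_unique _ _ (is_series_ln_gauss_prod _ K Hx)).
    rewrite Ropp_involutive. apply exp_ln, gauss_prod_pos, Hx. }
  apply (is_lim_seq_continuous exp); [apply derivable_continuous_pt, derivable_pt_exp|].
  apply (is_lim_seq_opp (fun K => Series _) (PSeries _ _)).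
  apply tannery with (fun n => 2 * (INR (S n) * nome y ^ n)).
  - intros K n. rewrite Rabs_mult, <- Rmult_assoc, (Rabs_pos_eq (_ ^ _)).
    + apply Rmult_le_compat_r; [now apply pow_unit_interval|].
      apply Rle_trans with (1 := asum_coef_bound K n). rewrite S_INR. lra.
    + now apply pow_unit_interval.
  - apply (ex_series_scal (V := R_NormedModule) 2), ex_series_linear_pow, Hx.
  - intros n. apply is_lim_seq_ext_loc with (fun _ => asum_ps n * nome y ^ n).
    + exists n. intros K HK. unfold asum_ps. now rewrite asum_upto_stable.
    + apply is_lim_seq_const.
Qed.

Lemma PS_derive_asum_ps (n : nat) : PS_derive asum_ps n = 2 * INR (asum (S n)).
Proof. unfold PS_derive, asum_ps. at_R. field. apply not_0_INR. lia. Qed.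

Lemma is_series_asum (y : R) : 0 < y ->
  is_series (fun k => INR (asum (S k)) * nome y ^ S k)
    (nome y / 2 * PSeries (PS_derive asum_ps) (nome y)).
Proof.
  intros Hy. pose proof (nome_unit_interval y Hy) as Hq.
  assert (He : ex_series (fun n => PS_derive asum_ps n * nome y ^ n)).
  { apply ex_series_Rabs, CV_disk_inside. rewrite CV_radius_derive.
    apply CV_radius_asum_ps. lra. }
  apply is_series_ext with (fun n => nome y / 2 * (PS_derive asum_ps n * nome y ^ n)).
  - intros n. rewrite PS_derive_asum_ps. simpl. at_R. field.
  - exact (is_series_scal (V := R_NormedModule) _ _ _ (Series_correct _ He)).
Qed.

Lemma is_derive_theta4 (y : R) : 0 < y ->
  is_derive theta4 y
    (2 * PI * Series (fun k => INR (asum (S k)) * nome y ^ S k) * theta4 y).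
Proof.
  intros Hy. pose proof (nome_unit_interval y Hy) as Hq.
  rewrite (is_series_unique _ _ (is_series_asum y Hy)), theta4_exp by assumption.
  apply is_derive_ext_loc with (fun t => exp (- PSeries asum_ps (nome t))).
  { exists (mkposreal y Hy). intros t Ht. symmetry. apply theta4_exp.
    cbv [ball UniformSpace.ball] in Ht. simpl in Ht. unfold AbsRing_ball, abs, minus, plus, opp in Ht.
    simpl in Ht. apply Rabs_def2 in Ht. lra. }
  assert (HL : is_derive (PSeries asum_ps) (nome y) (PSeries (PS_derive asum_ps) (nome y))).
  { apply is_derive_PSeries, CV_radius_asum_ps. lra. }
  assert (Hn : is_derive nome y (- PI * nome y)).
  { unfold nome. auto_derive; auto. ring. }
  pose proof (is_derive_comp _ _ _ _ _ HL Hn) as H1.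
  apply (is_derive_opp (V := R_NormedModule)) in H1.
  pose proof (is_derive_comp exp _ y _ _ (is_derive_exp _) H1) as H2.
  eapply eq_rect; [exact H2|]. change scal with Rmult. change opp with Ropp. cbv beta. at_R. field.
Qed.

Lemma power_series_zero_0 (d : nat -> R) :
  (forall x, 0 < x < 1 -> is_series (fun k => d k * x ^ k) 0) -> d O = 0.
Proof.
  intros H.
(* The terms at x = 1/2 tend to 0 and are eventually below 1; at x = 1/4 = 1/2 * 1/2 they are
   therefore dominated by a geometric series, which makes the radius of convergence positive. *)
assert (Hr : Rbar_lt (Rabs 0) (CV_radius d)).
    { rewrite Rabs_R0. apply Rbar_lt_le_trans with (/ 4); [simpl; lra|].
      apply CV_disk_le_radius. unfold CV_disk.
      destruct (ex_series_lim_0 _ (ex_intro _ 0 (H (/ 2) ltac:(lra))) _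
        (locally_ball 0 (mkposreal 1 Rlt_0_1))) as [N HN].
      apply (ex_series_incr_n _ N), ex_series_Rbound with (fun n => (/ 2) ^ n).
      - intros n. specialize (HN (N + n)%nat ltac:(lia)).
        cbv [ball UniformSpace.ball] in HN. simpl in HN.
        unfold AbsRing_ball, abs, minus, plus, opp in HN. simpl in HN.
        rewrite Ropp_0, Rplus_0_r in HN. rewrite Rabs_Rabsolu.
        replace (d (N + n)%nat * (/ 4) ^ (N + n)) with
          (d (N + n)%nat * (/ 2) ^ (N + n) * (/ 2) ^ (N + n))
          by (rewrite Rmult_assoc, <- Rpow_mult_distr; do 2 f_equal; lra).
        rewrite Rabs_mult, (Rabs_pos_eq (_ ^ _)) by (apply pow_le; lra).
        pose proof (pow_le_exponent (/ 2) n (N + n) ltac:(lra) ltac:(lia)).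
        assert (0 <= (/ 2) ^ (N + n)) by (apply pow_le; lra).
        pose proof (Rabs_pos (d (N + n)%nat * (/ 2) ^ (N + n))). nra.
      - apply ex_series_pow; lra. }
    pose proof (PSeries_continuity d 0 Hr) as Hc.
    apply continuity_pt_filterlim in Hc.
    (* The hypothesis says nothing at x = 0 itself, so the constant term is reached by continuity
       along 1/(n+2), where the sum is 0. *)
    assert (HL : is_lim_seq (fun n => PSeries d (/ (INR n + 2))) (PSeries d 0)).
    { apply (filterlim_comp _ _ _ (fun n => / (INR n + 2)) (PSeries d) _ (locally 0)); auto.
      apply (is_lim_seq_inv (fun n => INR n + 2) p_infty); [|discriminate].
      apply (is_lim_seq_plus _ _ p_infty 2); [apply is_lim_seq_INR|apply is_lim_seq_const|].
      reflexivity. }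
    rewrite PSeries_0 in HL. apply is_lim_seq_unique in HL.
    rewrite (Lim_seq_ext _ (fun _ => 0)), Lim_seq_const in HL.
    + now injection HL.
    + intros n. apply is_series_unique, H. pose proof (pos_INR n). split.
      * apply Rinv_0_lt_compat; lra.
      * rewrite <- Rinv_1. apply Rinv_lt_contravar; lra.
Qed.

(** Once the constant term is known to vanish, division by x gives a series of the same kind with
    shifted coefficients. *)
Lemma power_series_zero (d : nat -> R) :
  (forall x, 0 < x < 1 -> is_series (fun k => d k * x ^ k) 0) -> forall k, d k = 0.
Proof.
  intros H k. revert d H.
  induction k as [|k IH]; intros d H; [now apply power_series_zero_0|].
  apply (IH (fun k => d (S k))). intros x Hx.
  pose proof (power_series_zero_0 d H) as H0.
  apply is_series_ext with (fun n => / x * (d (S n) * x ^ S n)).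
  - intros n. simpl. at_R. field. lra.
  - replace 0 with (scal (/ x) 0) by (change scal with Rmult; at_R; ring).
    apply (is_series_scal (V := R_NormedModule)).
    apply (is_series_incr_1 (fun k => d k * x ^ k)).
    rewrite H0, Rmult_0_l. change plus with Rplus. rewrite Rplus_0_l. now apply H.
Qed.

Lemma nome_surjective (x : R) : 0 < x < 1 -> exists y, 0 < y /\ nome y = x.
Proof.
  intros Hx. pose proof PI_RGT_0.
  assert (ln x < 0) by (rewrite <- ln_1; apply ln_increasing; lra).
  exists (- ln x / PI). split; [apply Rdiv_lt_0_compat; lra|].
  unfold nome. replace (- PI * (- ln x / PI)) with (ln x) by (field; lra).
  apply exp_ln; lra.
Qed.

Lemma theta4_pos (y : R) : 0 < y -> 0 < theta4 y.
Proof. intros Hy. rewrite theta4_exp by assumption. apply exp_pos. Qed.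

(** The nome takes every value in (0, 1), so an expansion valid for all y > 0 has unique
    coefficients, and those of [theta4] are the divisor sums. *)
Lemma log_derivative_expansion_iff (a : nat -> Z) :
  theta4_log_derivative_expansion a <-> forall k, a (S k) = Z.of_nat (asum (S k)).
Proof.
  pose proof PI_RGT_0 as HPI. split.
  - intros H k.
    apply eq_IZR, Rminus_diag_uniq. rewrite <- INR_IZR_INZ. revert k.
    apply (power_series_zero (fun k => IZR (a (S k)) - INR (asum (S k)))).
    intros x Hx. destruct (nome_surjective x Hx) as [y [Hy <-]].
    destruct (H y Hy) as [H0 [_ [l [Hl HD]]]].
    rewrite (is_derive_unique _ _ _ (is_derive_theta4 y Hy)) in HD.
    set (l' := Series (fun k => INR (asum (S k)) * nome y ^ S k)) in *.
    assert (Hl' : is_series (fun k => INR (asum (S k)) * nome y ^ S k) l').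
    { apply Series_correct. eexists. now apply is_series_asum. }
    assert (E : l = l').
    { assert (2 * PI * l = 2 * PI * l') by (rewrite <- HD; field; exact H0). nra. }
    rewrite E in Hl.
    apply is_series_ext with (fun k => / nome y *
      (IZR (a (S k)) * nome y ^ S k - INR (asum (S k)) * nome y ^ S k)).
    + intros n. simpl. at_R. field. lra.
    + replace 0 with (scal (/ nome y) (l' - l'))
        by (change scal with Rmult; at_R; ring).
      apply (is_series_scal (V := R_NormedModule)).
      now apply (is_series_minus (V := R_NormedModule)).
  - intros Ha y Hy. pose proof (theta4_pos y Hy).
    repeat split; [lra|eexists; now apply is_derive_theta4|].
    exists (Series (fun k => INR (asum (S k)) * nome y ^ S k)). split.
    + apply is_series_ext with (fun k => INR (asum (S k)) * nome y ^ S k).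
      * intros n. now rewrite Ha, <- INR_IZR_INZ.
      * apply Series_correct. eexists. now apply is_series_asum.
    + rewrite (is_derive_unique _ _ _ (is_derive_theta4 y Hy)). field. lra.
Qed.
(** * The divisor sum *)

Section DivisorSums.
Local Open Scope nat_scope.

Lemma in_odd_codivisors (n d : nat) : 1 <= n ->
  (In d (filter (odd_codivisor n) (seq 1 n)) <->
   exists e, n = d * e /\ Nat.odd e = true).
Proof.
  intros Hn. rewrite filter_In, in_seq. unfold odd_codivisor.
  rewrite Bool.andb_true_iff, Nat.eqb_eq. split.
  - intros [_ [H1 H2]]. apply Nat.Lcm0.mod_divide in H1. destruct H1 as [e ->].
    exists e. split; [lia|]. rewrite Nat.div_mul in H2; auto. nia.
  - intros [e [-> He]]. assert (d <> 0 /\ e <> 0) as [Hd0 He0] by nia.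
    rewrite (Nat.mul_comm d e), Nat.Div0.mod_mul, Nat.div_mul by assumption.
    split; [nia|auto].
Qed.

Lemma NoDup_odd_codivisors (n : nat) : NoDup (filter (odd_codivisor n) (seq 1 n)).
Proof. apply NoDup_filter, seq_NoDup. Qed.

Lemma NoDup_list_prod (A B : Type) (l : list A) (l' : list B) :
  NoDup l -> NoDup l' -> NoDup (list_prod l l').
Proof.
  intros Hl Hl'. induction Hl as [|x l Hx Hl IH]; simpl; [constructor|].
  apply NoDup_app; auto.
  - apply Injective_map_NoDup; auto. intros y z E; now injection E.
  - intros [y z] H1 H2. apply in_map_iff in H1. destruct H1 as [t [[= <- <-] _]].
    apply in_prod_iff in H2. tauto.
Qed.

Lemma list_sum_list_prod (l l' : list nat) :
  list_sum (map (fun p => fst p * snd p) (list_prod l l')) = list_sum l * list_sum l'.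
Proof.
  induction l as [|x l IH]; simpl; auto.
  rewrite map_app, list_sum_app, IH, map_map. simpl.
  replace (list_sum (map (fun y => x * y) l')) with (x * list_sum l'); [lia|].
  clear. induction l'; simpl; lia.
Qed.

(** For coprime m and n, multiplication is a bijection from pairs of divisors onto the divisors of
    the product, and the codivisor of d e is odd exactly when both codivisors are. *)
Lemma asum_mul (m n : nat) : 1 <= m -> 1 <= n -> Nat.gcd m n = 1 ->
  asum (m * n) = asum m * asum n.
Proof.
  intros Hm Hn Hg. unfold asum at 2 3, asum_upto.
  rewrite <- list_sum_list_prod. apply Permutation_list_sum, NoDup_Permutation.
  - apply NoDup_odd_codivisors.
  - apply Injective_map_NoDup_in; [|apply NoDup_list_prod; apply NoDup_odd_codivisors].
    (* If d1 e1 = d2 e2, then d1 is coprime to e2, since they divide m and n respectively, and so d1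
       divides d2 by Gauss' lemma. By symmetry the two are equal. *)
    assert (D : forall d1 e1 d2 e2 r s r' s', m = d1 * r -> n = e2 * s -> m = d2 * r' ->
      n = e1 * s' -> d1 * e1 = d2 * e2 -> Nat.divide d1 d2).
    { intros d1 e1 d2 e2 r s r' s' E1 E2 E3 E4 E.
      apply Nat.gauss with e2.
      - exists e1. lia.
      - assert (Nat.divide (Nat.gcd d1 e2) 1); [|now apply Nat.divide_1_r].
        rewrite <- Hg. apply Nat.gcd_greatest.
        + apply Nat.divide_trans with d1; [apply Nat.gcd_divide_l|exists r; lia].
        + apply Nat.divide_trans with e2; [apply Nat.gcd_divide_r|exists s; lia]. }
    intros [d1 e1] [d2 e2] H1 H2 E. simpl in E.
    apply in_prod_iff in H1, H2. rewrite !in_odd_codivisors in H1, H2 by assumption.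
    destruct H1 as [[r1 [A1 _]] [s1 [B1 _]]], H2 as [[r2 [A2 _]] [s2 [B2 _]]].
    assert (d1 = d2).
    { apply Nat.divide_antisym; [apply (D d1 e1 d2 e2 r1 s2 r2 s1)|
        apply (D d2 e2 d1 e1 r2 s1 r1 s2)]; auto. }
    subst d2. f_equal. nia.
  - intros x. rewrite in_map_iff, in_odd_codivisors by nia. split.
    + intros [e [E He]].
      (* The preimage of a divisor x of m n is the pair of d = gcd(x, m) and x / d; Gauss' lemma
         shows that x / d divides n. *)
      assert (Hg0 : Nat.gcd x m <> 0) by (intros H; apply Nat.gcd_eq_0_r in H; lia).
      pose proof (Nat.gcd_div_gcd x m _ Hg0 eq_refl) as Hc.
      destruct (Nat.gcd_divide_l x m) as [x' Ex], (Nat.gcd_divide_r x m) as [m' Em].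
      set (d := Nat.gcd x m) in *.
      rewrite Ex, Em, !Nat.div_mul in Hc by assumption.
      assert (E' : x' * e = m' * n) by nia.
      destruct (Nat.gauss x' m' n) as [e' Ee']; [exists e; lia|assumption|].
      assert (Ee : e = m' * e') by nia.
      rewrite Ee, Nat.odd_mul in He. apply Bool.andb_true_iff in He.
      exists (d, x'). simpl. split; [lia|]. apply in_prod_iff.
      rewrite !in_odd_codivisors by assumption. split.
      * exists m'. split; [lia|tauto].
      * exists e'. split; [lia|tauto].
    + intros [[d d'] [E H]]. simpl in E. apply in_prod_iff in H.
      rewrite !in_odd_codivisors in H by assumption.
      destruct H as [[e [E1 H1]] [e' [E2 H2]]]. exists (e * e').
      split; [nia|]. rewrite Nat.odd_mul, H1, H2. reflexivity.
Qed.

(** A codivisor of an odd number is odd, so the parity test accepts every divisor. *)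
Lemma asum_of_odd (n : nat) : Nat.odd n = true -> asum n = sigma1 n.
Proof.
  intros Hn. unfold asum, asum_upto, sigma1. f_equal. apply filter_ext_in.
  intros d Hd. unfold odd_codivisor.
  destruct (Nat.eqb_spec (n mod d) 0) as [E|E]; auto. simpl.
  apply Nat.Lcm0.mod_divide in E. destruct E as [e ->].
  apply in_seq in Hd. rewrite Nat.div_mul by lia.
  rewrite Nat.odd_mul in Hn. now apply Bool.andb_true_iff in Hn.
Qed.

(** The only odd codivisor is 1. The induction halves both 2^f and the divisor, which must be even
    while its codivisor is odd. *)
Lemma asum_pow_2 (f : nat) : asum (2 ^ f) = 2 ^ f.
Proof.
  assert (Hf : forall f, 1 <= 2 ^ f) by (intros g; pose proof (Nat.pow_nonzero 2 g); lia).
  unfold asum, asum_upto. transitivity (list_sum (2 ^ f :: nil)); [|simpl; lia].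
  apply Permutation_list_sum, NoDup_Permutation.
  - apply NoDup_odd_codivisors.
  - repeat constructor. simpl; tauto.
  - intros d. rewrite in_odd_codivisors by auto. simpl. split.
    + intros [e [E He]]. left. revert d E. induction f as [|f IH]; intros d E.
      * symmetry in E. now apply Nat.eq_mul_1 in E.
      * assert (Hd : Nat.odd (2 ^ S f) = false) by (simpl Nat.pow; apply Nat.odd_even).
        rewrite E, Nat.odd_mul, He, Bool.andb_true_r in Hd.
        apply Nat.odd_spec in He. pose proof (Nat.div2_odd d) as E'.
        rewrite Hd in E'. simpl Nat.b2n in E'. rewrite Nat.add_0_r in E'.
        specialize (IH (Nat.div2 d)). rewrite Nat.pow_succ_r' in E |- *. rewrite E' in E. nia.
    + intros [<-|[]]. exists 1. split; [lia|reflexivity].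
Qed.

(** The prime is the least divisor that is at least 2, and its full power is split off. The strictly
    smaller coprime cofactor makes strong induction available for multiplicative functions. *)
Lemma exists_prime_power_factor (n : nat) : 2 <= n ->
  exists p f m, prime (Z.of_nat p) /\ 1 <= f /\ 1 <= m < n /\ n = p ^ f * m /\
    Nat.gcd (p ^ f) m = 1.
Proof.
  intros Hn.
  assert (Hp : exists p, 2 <= p /\ Nat.divide p n /\
    forall d, 2 <= d -> Nat.divide d n -> p <= d).
  { assert (H : forall k, (exists p, 2 <= p <= k /\ Nat.divide p n /\
        forall d, 2 <= d -> Nat.divide d n -> p <= d) \/
        (forall d, 2 <= d <= k -> ~ Nat.divide d n)).
    { induction k as [|k [[p IH]|IH]]; [right; lia|left; exists p; intuition lia|].
      destruct (Nat.le_gt_cases 2 (S k)) as [L|L]; [|right; lia].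
      destruct (Nat.eq_dec (n mod S k) 0) as [E|E]; rewrite Nat.Lcm0.mod_divide in E.
      - left. exists (S k). repeat split; auto. intros d H1 H2.
        destruct (Nat.le_gt_cases (S k) d); auto. exfalso. apply (IH d); auto; lia.
      - right. intros d Hd. destruct (Nat.eq_dec d (S k)) as [->|]; auto.
        apply IH; lia. }
    destruct (H n) as [[p H1]|H1]; [exists p; intuition|].
    exfalso. apply (H1 n); [lia|apply Nat.divide_refl]. }
  destruct Hp as [p [Hp2 [Hpn Hmin]]].
  assert (Hsplit : forall k, 1 <= k -> exists f m, k = p ^ f * m /\ ~ Nat.divide p m).
  { induction k as [k IH] using (well_founded_induction lt_wf). intros Hk.
    destruct (Nat.eq_dec (k mod p) 0) as [E|E]; rewrite Nat.Lcm0.mod_divide in E.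
    - destruct E as [k' E]. destruct (IH k') as [f [m [E1 E2]]]; try nia.
      exists (S f), m. split; auto. simpl. nia.
    - exists 0, k. split; [simpl; lia|auto]. }
  destruct (Hsplit n ltac:(lia)) as [f [m [E Hm]]].
  assert (Hf : 1 <= f).
  { destruct f; [|lia]. simpl in E. rewrite Nat.add_0_r in E. now subst m. }
  exists p, f, m. split; [|split; [auto|split; [|split; [auto|]]]].
  - apply prime_alt. split; [lia|]. intros d Hd H.
    assert (Hle : p <= Z.to_nat d).
    { apply Hmin; [lia|]. apply Nat.divide_trans with p; auto.
      destruct H as [c Hc]. exists (Z.to_nat c).
      apply Nat2Z.inj. rewrite Nat2Z.inj_mul, !Z2Nat.id; nia. }
    lia.
  - destruct f as [|f]; [lia|]. simpl in E.
    destruct m as [|m]; [rewrite Nat.mul_0_r in E; lia|].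
    assert (2 <= p * p ^ f) by (pose proof (Nat.pow_nonzero p f); nia).
    split; [lia|]. rewrite E. nia.
  - assert (Hpm : Nat.gcd p m = 1).
    { destruct (Nat.gcd_divide_l p m) as [c Hc], (Nat.gcd_divide_r p m) as [c' Hc'].
      destruct (Nat.le_gt_cases 2 (Nat.gcd p m)) as [L|L].
      - assert (p <= Nat.gcd p m).
        { apply Hmin; auto. apply Nat.divide_trans with m; [apply Nat.gcd_divide_r|].
          exists (p ^ f). auto. }
        exfalso. apply Hm. replace p with (Nat.gcd p m); [apply Nat.gcd_divide_r|].
        apply Nat.le_antisymm; auto.
        apply Nat.divide_pos_le; [lia|apply Nat.gcd_divide_l].
      - assert (Nat.gcd p m <> 0); [|lia]. intros E0. rewrite E0 in Hc. lia. }
    clear - Hpm. induction f as [|f IH]; [reflexivity|].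
    apply Nat.divide_1_r. rewrite <- IH. apply Nat.gcd_greatest; [|apply Nat.gcd_divide_r].
    apply Nat.gauss with p; [apply Nat.gcd_divide_l|].
    apply Nat.divide_1_r. rewrite <- Hpm. apply Nat.gcd_greatest; [apply Nat.gcd_divide_r|].
    apply Nat.divide_trans with (2 := Nat.gcd_divide_r (p ^ S f) m).
    apply Nat.gcd_divide_l.
Qed.

Lemma odd_prime_power (p f : nat) : prime (Z.of_nat p) -> 2 < p -> Nat.odd (p ^ f) = true.
Proof.
  intros Hp H2.
  assert (Ho : Nat.odd p = true).
  { destruct (Nat.odd p) eqn:E; auto. exfalso.
    pose proof (Nat.div2_odd p) as E'. rewrite E in E'. simpl in E'.
    destruct (prime_divisors _ Hp 2); [exists (Z.of_nat (Nat.div2 p))|..]; lia. }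
  induction f as [|f IH]; auto. simpl. now rewrite Nat.odd_mul, Ho, IH.
Qed.

(** Multiplicativity and the values at prime powers determine a function, by strong induction on the
    cofactor of a prime power; [asum] has the prescribed values. *)
Lemma is_theta4_coef_iff (a : nat -> Z) :
  is_theta4_coef a <-> forall k, a (S k) = Z.of_nat (asum (S k)).
Proof.
  split.
  - intros [[H1 Hmul] [Hodd H2]].
    assert (H : forall n, 1 <= n -> a n = Z.of_nat (asum n)); [|intros k; apply H; lia].
    induction n as [n IH] using (well_founded_induction lt_wf). intros Hn.
    destruct (Nat.eq_dec n 1) as [->|Hn1]; [now rewrite H1|].
    destruct (exists_prime_power_factor n) as [p [f [m [Hp [Hf [Hm [-> Hg]]]]]]]; [lia|].
    assert (1 <= p ^ f).
    { assert (p <> 0) by (intros ->; now apply not_prime_0 in Hp).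
      pose proof (Nat.pow_nonzero p f). lia. }
    rewrite Hmul, asum_mul, (IH m), Nat2Z.inj_mul by (auto; lia). f_equal.
    pose proof (prime_ge_2 _ Hp). destruct (Nat.eq_dec p 2) as [->|].
    + now rewrite H2, asum_pow_2.
    + rewrite Hodd by (auto; lia). f_equal. symmetry.
      apply asum_of_odd, odd_prime_power; auto. lia.
  - intros H.
    assert (Ha : forall n, 1 <= n -> a n = Z.of_nat (asum n)).
    { intros [|n]; [lia|auto]. }
    assert (Hpos : forall p f, p <> 0 -> 1 <= p ^ f).
    { intros p f Hp. pose proof (Nat.pow_nonzero p f Hp). lia. }
    repeat split.
    + now rewrite Ha.
    + intros m n Hm Hn Hg. rewrite !Ha, asum_mul, Nat2Z.inj_mul by (auto; nia). reflexivity.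
    + intros p f Hp Hp2 Hf. rewrite Ha by (apply Hpos; lia). f_equal.
      now apply asum_of_odd, odd_prime_power.
    + intros f Hf. rewrite Ha by now apply Hpos. now rewrite asum_pow_2.
Qed.

End DivisorSums.

(** * The modular transformation of [theta4] *)

(* [cbin N l] is the binomial coefficient C(2N, N + l), for [l >= 0]. *)
Fixpoint cbin (N l : nat) : R :=
  match N with
  | O => match l with O => 1 | _ => 0 end
  | S N' =>
    match l with
    | O => 2 * cbin N' 0 + 2 * cbin N' 1
    | S l' => cbin N' l' + 2 * cbin N' l + cbin N' (S l)
    end
  end.

Lemma cbin_ge_0 (N l : nat) : 0 <= cbin N l.
Proof.
  revert l; induction N as [|N IH]; intros [|l]; cbn [cbin]; try lra.
  - pose proof (IH 0%nat); pose proof (IH 1%nat); lra.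
  - pose proof (IH l); pose proof (IH (S l)); pose proof (IH (S (S l))); lra.
Qed.

Lemma cbin_0_pos (N : nat) : 0 < cbin N 0.
Proof.
  induction N as [|N IH]; cbn [cbin]; [lra|]. pose proof (cbin_ge_0 N 1). lra.
Qed.

Lemma cbin_eq_0 (N l : nat) : (N < l)%nat -> cbin N l = 0.
Proof.
  revert l; induction N as [|N IH]; intros [|l] H; cbn [cbin]; try lia; auto.
  rewrite !IH by lia. ring.
Qed.

(** The ratio of neighbouring binomial coefficients. It replaces factorials below: it yields the
    Wallis formula and, multiplied over l, the Gaussian bounds. *)
Lemma cbin_step (N l : nat) :
  (INR N + INR l + 1) * cbin N (S l) = (INR N - INR l) * cbin N l.
Proof.
  revert l; induction N as [|N IH]; intros [|l]; rewrite ?S_INR; cbn [cbin INR];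
    try (simpl; ring).
  - pose proof (IH 0%nat) as H0. pose proof (IH 1%nat) as H1. simpl in H0, H1.
    nra.
  - pose proof (IH l) as H0. pose proof (IH (S l)) as H1. pose proof (IH (S (S l))) as H2.
    rewrite !S_INR in *. nra.
Qed.

Lemma cos_add_sub (a b : R) : 2 * cos a * cos b = cos (a + b) + cos (a - b).
Proof. rewrite cos_plus, cos_minus. ring. Qed.

(** The factor 2 + 2 cos 2t is (2 cos t)^2, and multiplying a cosine sum by it applies Pascal's rule
    twice. The last line collects the boundary terms of the truncation at [L]; they vanish when N <
    L. *)
Lemma sum_cbin_cos_S (N L : nat) (t : R) :
  2 * sum_n (fun l => cbin (S N) l * cos (2 * INR l * t)) L - cbin (S N) 0 =
  (2 + 2 * cos (2 * t)) *
    (2 * sum_n (fun l => cbin N l * cos (2 * INR l * t)) L - cbin N 0) -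
  2 * (cbin N L * cos (2 * INR (S L) * t) - cbin N (S L) * cos (2 * INR L * t)).
Proof.
  induction L as [|L IH].
  - rewrite !sum_O. cbn [cbin]. replace (2 * INR 0 * t) with 0 by (simpl; ring).
    replace (2 * INR 1 * t) with (2 * t) by (simpl; ring). rewrite cos_0. ring.
  - rewrite !sum_Sn. change plus with Rplus.
    assert (E := cos_add_sub (2 * t) (2 * INR (S L) * t)).
    replace (2 * t + 2 * INR (S L) * t) with (2 * INR (S (S L)) * t) in E
      by (rewrite !S_INR; ring).
    replace (2 * t - 2 * INR (S L) * t) with (- (2 * INR L * t)) in E
      by (rewrite !S_INR; ring).
    rewrite cos_neg in E. change (cbin (S N) (S L)) with
      (cbin N L + 2 * cbin N (S L) + cbin N (S (S L))).
    set (c := cos (2 * INR (S L) * t)) in *. set (c2 := cos (2 * INR (S (S L)) * t)) in *.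
    set (c0 := cos (2 * INR L * t)) in *. set (c1 := cos (2 * t)) in *.
    set (A := sum_n (fun l => cbin (S N) l * cos (2 * INR l * t)) L) in *.
    set (B := sum_n (fun l => cbin N l * cos (2 * INR l * t)) L) in *.
    replace (2 * (A + (cbin N L + 2 * cbin N (S L) + cbin N (S (S L))) * c) - cbin (S N) 0)
      with (2 * A - cbin (S N) 0 + 2 * (cbin N L + 2 * cbin N (S L) + cbin N (S (S L))) * c)
      by ring.
    rewrite IH. replace c2 with (2 * c1 * c - c0) by lra. ring.
Qed.

Lemma cos_pow_expansion (N L : nat) (t : R) : (N <= L)%nat ->
  (2 * cos t) ^ (2 * N) =
  2 * sum_n (fun l => cbin N l * cos (2 * INR l * t)) L - cbin N 0.
Proof.
  intros HL. induction N as [|N IH].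
  - rewrite (sum_n_ext_loc _ (fun l => match l with O => 1 | _ => 0 end)).
    + clear HL. replace (sum_n _ L) with 1; [simpl; ring|].
      induction L as [|L IH]; [now rewrite sum_O|].
      rewrite sum_Sn, <- IH. change plus with Rplus. at_R. ring.
    + intros [|n] _; simpl; [|ring]. rewrite Rmult_0_r, Rmult_0_l, cos_0. ring.
  - rewrite sum_cbin_cos_S, <- IH, !(cbin_eq_0 N) by lia.
    replace (2 * S N)%nat with (S (S (2 * N))) by lia.
    rewrite cos_2a_cos. simpl. ring.
Qed.

Lemma sin_sum_cos (x : R) (h : nat) :
  2 * sin x * sum_n (fun j => cos ((2 * INR j + 1) * x)) h = sin (2 * INR (S h) * x).
Proof.
  assert (E : forall a b, 2 * sin a * cos b = sin (b + a) - sin (b - a)).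
  { intros a b. rewrite sin_plus, sin_minus. ring. }
  induction h as [|h IH].
  - rewrite sum_O, E. simpl. replace ((2 * 0 + 1) * x - x) with 0 by ring.
    rewrite sin_0, Rminus_0_r. f_equal. ring.
  - rewrite sum_Sn. change plus with Rplus. rewrite Rmult_plus_distr_l, IH, E.
    replace ((2 * INR (S h) + 1) * x - x) with (2 * INR (S h) * x) by ring.
    replace ((2 * INR (S h) + 1) * x + x) with (2 * INR (S (S h)) * x)
      by (rewrite !S_INR; ring).
    ring.
Qed.

Lemma sin_nat_PI (k : nat) : sin (INR k * PI) = 0.
Proof. apply sin_eq_0_1. exists (Z.of_nat k). now rewrite INR_IZR_INZ. Qed.

Lemma cos_nat_PI (k : nat) : cos (INR k * PI) = (-1) ^ k.
Proof.
  induction k as [|k IH]; [simpl; rewrite Rmult_0_l; apply cos_0|].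
  rewrite S_INR, Rmult_plus_distr_r, Rmult_1_l, neg_cos, IH. simpl. ring.
Qed.

(** Discrete orthogonality. With x = l PI / (2(h+1)) the sum times 2 sin x is sin(l PI) = 0, so it
    vanishes unless sin x = 0, that is unless 2(h+1) divides l; for l = 2(h+1) k every summand is
    cos((2j+1) k PI) = (-1)^k. The period 2(h+1) is passed to [spread] as its predecessor. *)
Lemma sum_cos_midpoints (h l : nat) :
  sum_n (fun j => cos (2 * INR l * ((2 * INR j + 1) * PI / (4 * INR (S h))))) h =
  spread (2 * h + 1) (fun k => INR (S h) * (-1) ^ k) l.
Proof.
  pose proof PI_RGT_0 as HPI. assert (Hh : 0 < INR (S h)) by (apply lt_0_INR; lia).
  unfold spread. replace (S (2 * h + 1)) with (2 * S h)%nat by lia.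
  set (x := INR l * PI / (2 * INR (S h))).
  rewrite (sum_n_ext _ (fun j => cos ((2 * INR j + 1) * x))).
  2:{ intros n. f_equal. unfold x. field. lra. }
  destruct (Nat.eqb_spec (l mod (2 * S h)) 0) as [E|E].
  - apply Nat.Div0.mod_divides in E. destruct E as [k ->].
    rewrite (Nat.mul_comm (2 * S h) k), Nat.div_mul by lia.
    rewrite (sum_n_ext _ (fun _ => (-1) ^ k)).
    + rewrite sum_n_const. reflexivity.
    + intros j. unfold x.
      replace ((2 * INR j + 1) * _) with (INR ((2 * j + 1) * k) * PI).
      * rewrite cos_nat_PI, pow_mult. f_equal.
        rewrite pow_add, pow_mult. replace ((-1) ^ 2) with 1 by ring.
        rewrite pow1. ring.
      * rewrite !mult_INR, plus_INR, mult_INR.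
        change (INR 2) with 2. change (INR 1) with 1. field. lra.
  - assert (Hs : sin x <> 0).
    { intros H. apply sin_eq_0_0 in H. destruct H as [k Hk]. apply E.
      unfold x in Hk.
      assert (Hl : INR l = IZR k * (2 * INR (S h))).
      { apply Rmult_eq_reg_r with (PI / (2 * INR (S h))).
        - replace (IZR k * _ * _) with (IZR k * PI) by (field; lra).
          rewrite <- Hk. field. lra.
        - apply Rgt_not_eq, Rdiv_lt_0_compat; lra. }
      replace (2 * INR (S h)) with (INR (2 * S h)) in Hl
        by (rewrite mult_INR; reflexivity).
      rewrite !INR_IZR_INZ, <- mult_IZR in Hl. apply eq_IZR in Hl.
      apply Nat.Lcm0.mod_divide. exists (Z.to_nat k). nia. }
    pose proof (sin_sum_cos x h) as H.
    replace (2 * INR (S h) * x) with (INR l * PI) in H by (unfold x; field; lra).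
    rewrite sin_nat_PI in H.
    apply Rmult_integral in H. destruct H as [H|H]; [|exact H]. exfalso. lra.
Qed.

(* Both sides are the average of [(2 cos t)^(2N)] over the [S h] midpoints of [0, PI/2]. *)
Lemma polya_identity (N h : nat) :
  sum_n (fun j => (2 * cos ((2 * INR j + 1) * PI / (4 * INR (S h)))) ^ (2 * N)) h =
  INR (S h) * (2 * sum_n (fun k => (-1) ^ k * cbin N (k * (2 * S h))) N - cbin N 0).
Proof.
  (* A cutoff of at least N, so that the cosine expansion is complete, and a multiple of the period,
     so that exactly the indices k <= N survive. *)
  set (L := (N * (2 * S h))%nat).
  set (t := fun j => (2 * INR j + 1) * PI / (4 * INR (S h))).
  rewrite (sum_n_ext _ (fun j => plus (scal 2
    (sum_n (fun l => cbin N l * cos (2 * INR l * t j)) L)) (- cbin N 0))).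
  2:{ intros j. fold (t j). rewrite (cos_pow_expansion N L) by nia. reflexivity. }
  rewrite (sum_n_plus (G := R_AbelianMonoid)), sum_n_const.
  rewrite (sum_n_scal_l (V := R_NormedModule)).
  rewrite (sum_n_switch (G := R_AbelianMonoid)).
  rewrite (sum_n_ext _ (spread (2 * h + 1)
    (fun k => scal (INR (S h)) ((-1) ^ k * cbin N (k * (2 * S h)))))).
  - rewrite sum_n_spread. replace (S (2 * h + 1)) with (2 * S h)%nat by lia.
    unfold L. rewrite Nat.div_mul, (sum_n_scal_l (V := R_NormedModule)) by lia.
    set (A := sum_n _ N).
    change (2 * (INR (S h) * A) + INR (S h) * - cbin N 0 = INR (S h) * (2 * A - cbin N 0)).
    ring.
  - intros l. transitivity (cbin N l * spread (2 * h + 1) (fun k => INR (S h) * (-1) ^ k) l).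
    + rewrite <- sum_cos_midpoints. apply (sum_n_scal_l (V := R_NormedModule)).
    + unfold spread. replace (S (2 * h + 1)) with (2 * S h)%nat by lia.
      destruct (Nat.eqb_spec (l mod (2 * S h)) 0) as [E|E]; [|at_R; ring].
      apply Nat.Div0.mod_divides in E. destruct E as [k ->].
      rewrite (Nat.mul_comm (2 * S h) k), Nat.div_mul by lia.
      change scal with Rmult. at_R. ring.
Qed.

(** * Wallis integrals and the central binomial coefficient *)

Definition wallis_int (n : nat) : R := RInt (fun t => cos t ^ n) 0 (PI / 2).

Lemma continuous_cos_pow (n : nat) (t : R) : continuous (fun t => cos t ^ n) t.
Proof.
  apply (ex_derive_continuous (V := R_NormedModule)). auto_derive. auto.
Qed.

Lemma ex_RInt_cos_pow (n : nat) (a b : R) : ex_RInt (fun t => cos t ^ n) a b.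
Proof. apply (ex_RInt_continuous (V := R_CompleteNormedModule)). intros; apply continuous_cos_pow. Qed.

Lemma wallis_int_step (n : nat) :
  (INR n + 2) * wallis_int (S (S n)) = (INR n + 1) * wallis_int n.
Proof.
  apply Rminus_diag_uniq. unfold wallis_int.
  (* The integrand is the derivative of sin t cos^(n+1) t after sin^2 is replaced by 1 - cos^2; the
     primitive vanishes at both ends. *)
  assert (H : is_RInt (fun t => (INR n + 2) * cos t ^ S (S n) - (INR n + 1) * cos t ^ n)
    0 (PI / 2) (minus (sin (PI / 2) * cos (PI / 2) ^ S n) (sin 0 * cos 0 ^ S n))).
  { apply (is_RInt_derive (V := R_CompleteNormedModule) (fun t => sin t * cos t ^ S n)).
    - intros t _. auto_derive; auto. change (match n with O => 1 | S _ => INR n + 1 end) with (INR (S n)).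
      rewrite S_INR. pose proof (sin2_cos2 t) as E. unfold Rsqr in E. simpl.
      replace (sin t * (1 * - sin t * ((INR n + 1) * cos t ^ n)))
        with (- (INR n + 1) * cos t ^ n * (sin t * sin t)) by ring.
      replace (sin t * sin t) with (1 - cos t * cos t) by lra. at_R. ring.
    - intros t _. apply (ex_derive_continuous (V := R_NormedModule)). auto_derive. auto. }
  pose proof (is_RInt_minus _ _ _ _ _ _
    (is_RInt_scal _ _ _ (INR n + 2) _ (RInt_correct _ _ _ (ex_RInt_cos_pow (S (S n)) 0 (PI / 2))))
    (is_RInt_scal _ _ _ (INR n + 1) _ (RInt_correct _ _ _ (ex_RInt_cos_pow n 0 (PI / 2))))) as H'.
  apply (is_RInt_unique (V := R_CompleteNormedModule)) in H.
  apply (is_RInt_unique (V := R_CompleteNormedModule)) in H'.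
  etransitivity; [symmetry; exact H'|]. etransitivity; [exact H|].
  rewrite cos_PI2, sin_0. change minus with Rminus. simpl. ring.
Qed.

Lemma wallis_int_decr (n : nat) : 0 <= wallis_int (S n) <= wallis_int n.
Proof.
  pose proof PI_RGT_0 as HPI. unfold wallis_int. split.
  - apply RInt_ge_0; [lra|apply ex_RInt_cos_pow|].
    intros t Ht. apply pow_le, cos_ge_0; lra.
  - apply RInt_le; try apply ex_RInt_cos_pow; [lra|].
    intros t Ht. simpl. rewrite <- (Rmult_1_l (cos t ^ n)) at 2.
    apply Rmult_le_compat_r; [apply pow_le, cos_ge_0; lra|apply COS_bound].
Qed.

Lemma wallis_int_mul (n : nat) :
  (INR n + 1) * (wallis_int n * wallis_int (S n)) = PI / 2.
Proof.
  induction n as [|n IH].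
  - unfold wallis_int. rewrite (RInt_ext (fun t => cos t ^ 0) (fun _ => 1)) by (intros; reflexivity).
    rewrite (RInt_ext (fun t => cos t ^ 1) cos) by (intros; apply pow_1).
    rewrite RInt_const.
    assert (H : is_RInt cos 0 (PI / 2) (minus (sin (PI / 2)) (sin 0))).
    { apply (is_RInt_derive (V := R_CompleteNormedModule)).
      - intros. apply is_derive_sin.
      - intros. apply continuous_cos. }
    apply (is_RInt_unique (V := R_CompleteNormedModule)) in H.
    rewrite H, sin_PI2, sin_0. change minus with Rminus. change scal with Rmult. simpl. ring.
  - rewrite S_INR. pose proof (wallis_int_step n) as H. rewrite <- IH.
    transitivity ((INR n + 2) * wallis_int (S (S n)) * wallis_int (S n)); [ring|].
    rewrite H. ring.
Qed.

Lemma wallis_int_cbin (N : nat) : wallis_int (2 * N) = cbin N 0 / 4 ^ N * (PI / 2).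
Proof.
  induction N as [|N IH].
  - unfold wallis_int. simpl. rewrite RInt_const. change scal with Rmult. at_R. field.
  - replace (2 * S N)%nat with (S (S (2 * N))) by lia.
    pose proof (wallis_int_step (2 * N)) as H. rewrite IH, mult_INR in H.
    pose proof (cbin_step N 0) as H1. pose proof (pos_INR N) as HN. simpl in H, H1.
    change (wallis_int (S (S (N + (N + 0))))) with (wallis_int (S (S (2 * N)))) in H.
    apply Rmult_eq_reg_l with ((1 + 1) * INR N + 2); [|lra].
    rewrite H. cbn [cbin]. simpl pow.
    replace (cbin N 1) with (INR N * cbin N 0 / (INR N + 1)) by (field_simplify_eq; lra).
    field. split; [lra|apply pow_nonzero; lra].
Qed.

(** With W the Wallis integrals, monotonicity puts the square of W(2N) between W(2N) W(2N+1) and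
    W(2N-1) W(2N), and both products are known exactly. *)
Lemma cbin_central_bounds (N : nat) : (1 <= N)%nat ->
  2 * INR N / (2 * INR N + 1) <= PI * INR N * (cbin N 0 / 4 ^ N) ^ 2 <= 1.
Proof.
  intros HN. pose proof PI_RGT_0 as HPI.
  assert (HN' : 0 < INR N) by (apply lt_0_INR; lia).
  pose proof (wallis_int_cbin N) as E. set (p := cbin N 0 / 4 ^ N) in *.
  pose proof (wallis_int_mul (2 * N)) as H1. pose proof (wallis_int_decr (2 * N)) as D1.
  destruct (2 * N)%nat as [|n] eqn:En; [lia|].
  pose proof (wallis_int_mul n) as H2. pose proof (wallis_int_decr n) as D2.
  assert (Hn : INR n + 1 = 2 * INR N) by (rewrite <- S_INR, <- En, mult_INR; reflexivity).
  rewrite S_INR, Hn in H1. rewrite Hn in H2. rewrite E in *.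
  split.
  - apply Rle_div_l; [lra|].
    apply Rmult_le_reg_l with PI; auto.
    assert ((2 * INR N + 1) * (p * (PI / 2) * (p * (PI / 2))) >= PI / 2).
    { apply Rle_ge, Rle_trans with (1 := Req_le _ _ (eq_sym H1)), Rmult_le_compat_l; [lra|].
      apply Rmult_le_compat_l; lra. }
    nra.
  - assert (2 * INR N * (p * (PI / 2) * (p * (PI / 2))) <= PI / 2).
    { apply Rle_trans with (2 := Req_le _ _ H2), Rmult_le_compat_l; [lra|].
      apply Rmult_le_compat_r; lra. }
    nra.
Qed.

(** * Gaussian bounds for binomial coefficients and for powers of the cosine *)

Lemma one_minus_ge_exp (v : R) : v < 1 -> exp (- (v / (1 - v))) <= 1 - v.
Proof.
  intros Hv. rewrite exp_Ropp.
  pose proof (exp_ineq1_le (v / (1 - v))) as H.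
  replace (1 + v / (1 - v)) with (/ (1 - v)) in H by (field; lra).
  apply Rle_trans with (/ / (1 - v)); [|rewrite Rinv_inv; lra].
  apply Rinv_le_contravar; auto. apply Rinv_0_lt_compat; lra.
Qed.

(** Each ratio (N-i)/(N+i+1) = 1 - (2i+1)/(N+i+1) is at most exp(-(2i+1)/(N+l)) for i < l, and the
    odd numbers 1, 3, ..., 2l-1 add up to l^2. The denominator N + l is held fixed during the
    induction on i. *)
Lemma cbin_upper (N l : nat) : (1 <= N)%nat ->
  cbin N l <= cbin N 0 * exp (- (INR l ^ 2 / (INR N + INR l))).
Proof.
  intros HN. assert (HN' : 0 < INR N) by (apply lt_0_INR; lia).
  pose proof (pos_INR l) as Hl.
  assert (H : forall i, (i <= l)%nat ->
    cbin N i <= cbin N 0 * exp (- (INR i ^ 2 / (INR N + INR l)))).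
  2: now apply H.
  induction i as [|i IH]; intros Hi.
  - simpl. replace (- (0 * (0 * 1) / (INR N + INR l))) with 0 by (field; lra).
    rewrite exp_0. lra.
  - pose proof (pos_INR i) as Hi0. apply le_INR in Hi. rewrite S_INR in Hi |- *.
    pose proof (cbin_step N i) as E. pose proof (cbin_ge_0 N i) as Hb.
    set (D := INR N + INR l) in *. set (D' := INR N + INR i + 1) in *.
    assert (HD : 0 < D' <= D) by (unfold D, D'; lra).
    assert (Hs : (INR N - INR i) / D' <= exp (- ((2 * INR i + 1) / D))).
    { apply Rle_trans with (exp (- ((2 * INR i + 1) / D'))).
      - replace ((INR N - INR i) / D') with (1 + - ((2 * INR i + 1) / D'))
          by (unfold D'; field; unfold D' in HD; lra).
        apply exp_ineq1_le.
      - apply exp_mono, Ropp_le_contravar, Rmult_le_compat_l; [lra|].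
        apply Rinv_le_contravar; lra. }
    replace (cbin N (S i)) with ((INR N - INR i) / D' * cbin N i)
      by (apply Rmult_eq_reg_l with D'; [rewrite E; field|]; lra).
    replace (- ((INR i + 1) ^ 2 / D)) with
      (- ((2 * INR i + 1) / D) + - (INR i ^ 2 / D)) by (field; lra).
    rewrite exp_plus.
    apply Rle_trans with (exp (- ((2 * INR i + 1) / D)) * cbin N i).
    + apply Rmult_le_compat_r; auto.
    + rewrite (Rmult_comm (exp _)), (Rmult_comm (exp (- ((2 * INR i + 1) / D)))), <- Rmult_assoc.
      apply Rmult_le_compat_r; [left; apply exp_pos|]. apply IH.
      apply INR_le. lra.
Qed.

(** The same product of ratios, estimated from below by 1 - v >= exp(-v/(1-v)): for v =
    (2i+1)/(N+i+1) the quotient v/(1-v) is (2i+1)/(N-i), which is at most (2i+1)/(N-l). *)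
Lemma cbin_lower (N l : nat) : (l < N)%nat ->
  cbin N 0 * exp (- (INR l ^ 2 / (INR N - INR l))) <= cbin N l.
Proof.
  intros HN. apply lt_INR in HN as HN'. pose proof (pos_INR l) as Hl.
  assert (H : forall i, (i <= l)%nat ->
    cbin N 0 * exp (- (INR i ^ 2 / (INR N - INR l))) <= cbin N i).
  2: now apply H.
  induction i as [|i IH]; intros Hi.
  - simpl. replace (- (0 * (0 * 1) / (INR N - INR l))) with 0 by (field; lra).
    rewrite exp_0. lra.
  - pose proof (pos_INR i) as Hi0. apply le_INR in Hi. rewrite S_INR in Hi |- *.
    pose proof (cbin_step N i) as E. pose proof (cbin_0_pos N) as Hb.
    set (D := INR N - INR l) in *. set (D' := INR N + INR i + 1) in *.
    assert (HD : 0 < D' /\ 0 < D) by (unfold D, D'; lra).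
    assert (Hs : exp (- ((2 * INR i + 1) / D)) <= (INR N - INR i) / D').
    { set (v := (2 * INR i + 1) / D').
      assert (Hv : 1 - v = (INR N - INR i) / D')
        by (unfold v, D'; field; unfold D' in HD; lra).
      assert (0 < (INR N - INR i) / D') by (apply Rdiv_lt_0_compat; lra).
      rewrite <- Hv. apply Rle_trans with (2 := one_minus_ge_exp v ltac:(lra)).
      apply exp_mono, Ropp_le_contravar. rewrite Hv. unfold v.
      replace ((2 * INR i + 1) / D' / ((INR N - INR i) / D'))
        with ((2 * INR i + 1) / (INR N - INR i)) by (field; lra).
      apply Rmult_le_compat_l; [lra|].
      apply Rinv_le_contravar; unfold D in *; lra. }
    replace (cbin N (S i)) with ((INR N - INR i) / D' * cbin N i)
      by (apply Rmult_eq_reg_l with D'; [rewrite E; field|]; lra).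
    replace (- ((INR i + 1) ^ 2 / D)) with
      (- ((2 * INR i + 1) / D) + - (INR i ^ 2 / D)) by (field; lra).
    rewrite exp_plus, <- Rmult_assoc, (Rmult_comm (cbin N 0)), Rmult_assoc.
    apply Rmult_le_compat; auto.
    + left; apply exp_pos.
    + apply Rmult_le_pos; [lra|left; apply exp_pos].
    + apply IH, INR_le. lra.
Qed.

Lemma exp_pow (x : R) (n : nat) : exp x ^ n = exp (INR n * x).
Proof.
  induction n as [|n IH]; [simpl; now rewrite Rmult_0_l, exp_0|].
  rewrite S_INR, Rmult_plus_distr_r, exp_plus, Rmult_1_l. simpl. rewrite IH. ring.
Qed.

Lemma cos_taylor_bounds (t : R) : 0 <= t <= PI / 2 ->
  1 - t ^ 2 / 2 <= cos t <= 1 - t ^ 2 / 2 + t ^ 4 / 24.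
Proof.
  intros Ht. destruct (cos_bound t 0) as [H1 H2]; try lra.
  unfold cos_approx in H1, H2. simpl sum_f_R0 in H1, H2. unfold cos_term in H1, H2.
  simpl in H1, H2. lra.
Qed.

Lemma cos_pow_upper (t : R) (n : nat) : 0 <= t <= PI / 2 ->
  cos t ^ (2 * n) <= exp (- (INR n * t ^ 2 * (1 - t ^ 2 / 12))).
Proof.
  intros Ht. destruct (cos_taylor_bounds t Ht) as [_ H].
  replace (- (INR n * t ^ 2 * (1 - t ^ 2 / 12))) with
    (INR (2 * n) * (- (t ^ 2 / 2) + t ^ 4 / 24)) by (rewrite mult_INR; simpl; field).
  rewrite <- exp_pow. apply pow_incr. split; [apply cos_ge_0; lra|].
  apply Rle_trans with (1 := H). apply Rle_trans with (2 := exp_ineq1_le _). lra.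
Qed.

Lemma cos_pow_lower (t : R) (n : nat) : 0 <= t <= PI / 2 -> t ^ 2 / 2 < 1 ->
  exp (- (INR n * t ^ 2 / (1 - t ^ 2 / 2))) <= cos t ^ (2 * n).
Proof.
  intros Ht H1. destruct (cos_taylor_bounds t Ht) as [H _].
  replace (- (INR n * t ^ 2 / (1 - t ^ 2 / 2))) with
    (INR (2 * n) * (- (t ^ 2 / 2 / (1 - t ^ 2 / 2)))) by (rewrite mult_INR; simpl INR; field; lra).
  rewrite <- exp_pow. apply pow_incr. split; [left; apply exp_pos|].
  apply Rle_trans with (2 := H). now apply one_minus_ge_exp.
Qed.

Lemma is_lim_seq_exp_opp (u : nat -> R) (l : R) :
  is_lim_seq u l -> is_lim_seq (fun i => exp (- u i)) (exp (- l)).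
Proof.
  intros H. apply (is_lim_seq_continuous exp (fun i => - u i) (- l)).
  - apply derivable_continuous_pt, derivable_pt_exp.
  - now apply (is_lim_seq_opp u l).
Qed.

Lemma is_lim_seq_gt (u : nat -> R) (l c : R) :
  is_lim_seq u l -> c < l -> eventually (fun i => c < u i).
Proof.
  intros H Hc. assert (He : 0 < l - c) by lra.
  destruct (proj2 (is_lim_seq_spec _ _) H (mkposreal _ He)) as [M HM].
  exists M. intros i Hi. specialize (HM i Hi). simpl in HM. apply Rabs_def2 in HM. lra.
Qed.

Lemma Series_finite (u : nat -> R) (N : nat) :
  (forall k, (N < k)%nat -> u k = 0) -> Series u = sum_n u N.
Proof.
  intros H. apply is_series_unique.
  apply (filterlim_ext_loc (fun _ => sum_n u N)); [|apply filterlim_const].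
  exists N. intros n Hn. induction Hn as [|n Hn IH]; auto.
  rewrite sum_Sn, <- IH, H by lia. apply (eq_sym (plus_zero_r (G := R_AbelianMonoid) _)).
Qed.

(** * The limit of Pólya's identity under Gaussian scaling *)

Section Sampling.

(** With N of the order of al times the square of the mesh number, the coefficient at distance
    2k(h+1) from the centre, divided by the central one, tends to exp(-4k^2/al), while the j-th
    sampled cosine power tends to exp(-al ((2j+1) PI/4)^2). The bound from below by al/2 provides
    majorants uniform in i. *)
Variables (al : R) (h N : nat -> nat).
Let mesh (i : nat) : R := INR (S (h i)).
Let rho (i : nat) : R := INR (N i) / mesh i ^ 2.

Hypothesis al_pos : 0 < al.
Hypothesis h_ge : forall i, (i <= h i)%nat.
Hypothesis N_bounds : forall i, al / 2 * mesh i ^ 2 <= INR (N i) <= al * mesh i ^ 2.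
Hypothesis rho_lim : is_lim_seq rho al.

Lemma mesh_pos (i : nat) : 0 < mesh i.
Proof. apply lt_0_INR. lia. Qed.

Lemma power_pos (i : nat) : (1 <= N i)%nat.
Proof.
  pose proof (N_bounds i) as HN. pose proof (mesh_pos i) as HH.
  apply INR_lt. simpl. assert (0 < mesh i ^ 2) by now apply pow_lt. nra.
Qed.

Lemma is_lim_seq_inv_mesh : is_lim_seq (fun i => / mesh i) 0.
Proof.
  apply is_lim_seq_le_le with (fun _ => 0) (fun i => / INR (S i)).
  - intros i. pose proof (mesh_pos i). split; [left; now apply Rinv_0_lt_compat|].
    apply Rinv_le_contravar; [apply lt_0_INR; lia|].
    apply le_INR. specialize (h_ge i). lia.
  - apply is_lim_seq_const.
  - apply (is_lim_seq_incr_1 (fun n => / INR n)).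
    apply (is_lim_seq_inv INR p_infty); [apply is_lim_seq_INR|discriminate].
Qed.

Let ratio (i k : nat) : R := cbin (N i) (k * (2 * S (h i))) / cbin (N i) 0.

Lemma INR_shift (i k : nat) : INR (k * (2 * S (h i))) = 2 * INR k * mesh i.
Proof. rewrite !mult_INR. change (INR 2) with 2. fold (mesh i). ring. Qed.

Lemma ratio_ge_0 (i k : nat) : 0 <= ratio i k.
Proof. apply Rdiv_le_0_compat; [apply cbin_ge_0|apply cbin_0_pos]. Qed.

Lemma ratio_upper (i k : nat) :
  ratio i k <= exp (- (4 * INR k ^ 2 / (rho i + 2 * INR k * / mesh i))).
Proof.
  pose proof (cbin_0_pos (N i)). pose proof (mesh_pos i).
  pose proof (lt_0_INR _ (power_pos i)). pose proof (pos_INR k).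
  apply Rle_div_l; auto. rewrite Rmult_comm.
  apply Rle_trans with (1 := cbin_upper _ _ (power_pos i)), Req_le.
  rewrite INR_shift. do 3 f_equal. unfold rho. field. repeat split; nra.
Qed.

Lemma ratio_lower (i k : nat) : 0 < rho i - 2 * INR k * / mesh i ->
  exp (- (4 * INR k ^ 2 / (rho i - 2 * INR k * / mesh i))) <= ratio i k.
Proof.
  intros Hr. pose proof (cbin_0_pos (N i)). pose proof (mesh_pos i) as HH.
  assert (HN : 0 < INR (N i) - 2 * INR k * mesh i).
  { replace (INR (N i) - _) with (mesh i ^ 2 * (rho i - 2 * INR k * / mesh i))
      by (unfold rho; field; lra).
    apply Rmult_lt_0_compat; auto. now apply pow_lt. }
  apply Rle_div_r; auto. rewrite Rmult_comm.
  apply Rle_trans with (2 := cbin_lower (N i) (k * (2 * S (h i)))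
    ltac:(apply INR_lt; rewrite INR_shift; lra)), Req_le.
  rewrite INR_shift. do 3 f_equal. unfold rho. field. repeat split; lra.
Qed.

(** Either the coefficient lies outside the binomial row and is 0, or 2k / mesh <= rho <= al; then
    the denominator in [ratio_upper] is at most 2 al, and k^2 >= k turns the Gaussian into a
    geometric bound. *)
Lemma ratio_dominated (i k : nat) : ratio i k <= exp (- (2 / al)) ^ k.
Proof.
  rewrite exp_pow. pose proof (cbin_0_pos (N i)) as Hb. pose proof (mesh_pos i) as HH.
  destruct (Nat.le_gt_cases (k * (2 * S (h i))) (N i)) as [L|L].
  - apply Rle_trans with (1 := ratio_upper i k), exp_mono.
    apply le_INR in L. rewrite INR_shift in L. pose proof (N_bounds i) as HN.
    pose proof (pos_INR k) as Hk.
    assert (Hrho : rho i <= al).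
    { unfold rho. apply Rle_div_l; [now apply pow_lt|lra]. }
    assert (Hrho' : 2 * INR k * / mesh i <= rho i).
    { apply (proj1 (Rle_div_r _ _ _ (pow_lt _ 2 HH))).
      replace (2 * INR k * / mesh i * mesh i ^ 2) with (2 * INR k * mesh i) by (field; lra). auto. }
    destruct k as [|k]; [simpl; right; unfold Rdiv; ring|].
    assert (Hk1 : 1 <= INR (S k)) by (rewrite S_INR; pose proof (pos_INR k); lra).
    assert (0 < / mesh i) by now apply Rinv_0_lt_compat.
    rewrite <- Ropp_mult_distr_r. apply Ropp_le_contravar.
    set (K := INR (S k)) in *. set (D := rho i + 2 * K * / mesh i) in *.
    assert (HD : 0 < D <= 2 * al) by (unfold D; nra).
    apply Rle_trans with (4 * K ^ 2 / (2 * al)).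
    + apply Rle_trans with (K ^ 2 * (2 / al)); [|right; field; lra].
      apply Rmult_le_compat_r; [apply Rlt_le, Rdiv_lt_0_compat; lra|]. nra.
    + apply Rmult_le_compat_l; [nra|]. apply Rinv_le_contravar; lra.
  - unfold ratio. rewrite cbin_eq_0 by auto. unfold Rdiv at 1. rewrite Rmult_0_l.
    left; apply exp_pos.
Qed.

Lemma is_lim_seq_ratio (k : nat) :
  is_lim_seq (fun i => ratio i k) (exp (- (4 * INR k ^ 2 / al))).
Proof.
  assert (HL : is_lim_seq (fun i => 2 * INR k * / mesh i) 0).
  { replace (Finite 0) with (Rbar_mult (2 * INR k) 0) by (simpl; f_equal; ring).
    apply is_lim_seq_scal_l, is_lim_seq_inv_mesh. }
  assert (Hm : is_lim_seq (fun i => rho i - 2 * INR k * / mesh i) al).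
  { replace al with (al - 0) by ring. now apply is_lim_seq_minus'. }
  assert (Hp : is_lim_seq (fun i => rho i + 2 * INR k * / mesh i) al).
  { replace al with (al + 0) by ring. now apply is_lim_seq_plus'. }
  apply is_lim_seq_le_le_loc with
    (fun i => exp (- (4 * INR k ^ 2 / (rho i - 2 * INR k * / mesh i))))
    (fun i => exp (- (4 * INR k ^ 2 / (rho i + 2 * INR k * / mesh i)))).
  - destruct (is_lim_seq_gt _ _ 0 Hm al_pos) as [M HM]. exists M. intros i Hi.
    split; [apply ratio_lower; auto|apply ratio_upper].
  - apply is_lim_seq_exp_opp, is_lim_seq_div'; auto using is_lim_seq_const. lra.
  - apply is_lim_seq_exp_opp, is_lim_seq_div'; auto using is_lim_seq_const. lra.
Qed.

Lemma is_lim_seq_ratio_Series :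
  is_lim_seq (fun i => Series (fun k => (-1) ^ k * ratio i k))
    (Series (fun k => (-1) ^ k * exp (- (4 * INR k ^ 2 / al)))).
Proof.
  apply tannery with (fun k => exp (- (2 / al)) ^ k).
  - intros i k. rewrite Rabs_mult, Rabs_pow_m1, Rmult_1_l, Rabs_pos_eq.
    + apply ratio_dominated.
    + apply ratio_ge_0.
  - apply ex_series_pow. split; [left; apply exp_pos|]. rewrite <- exp_0.
    apply exp_increasing. assert (0 < 2 / al) by (apply Rdiv_lt_0_compat; lra). lra.
  - intros k. apply (is_lim_seq_scal_l _ ((-1) ^ k) (exp _)), is_lim_seq_ratio.
Qed.

Let angle (i j : nat) : R := (2 * INR j + 1) * PI / (4 * mesh i).
Let freq (j : nat) : R := ((2 * INR j + 1) * PI / 4) ^ 2.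
(** Extension by 0 beyond [h i] turns finite sums of varying length into series over a common index
    set, as [tannery] expects. *)
Let sample (i j : nat) : R :=
  if Nat.leb j (h i) then cos (angle i j) ^ (2 * N i) else 0.

Lemma angle_bounds (i j : nat) : (j <= h i)%nat -> 0 <= angle i j <= PI / 2.
Proof.
  intros Hj. pose proof PI_RGT_0. pose proof (mesh_pos i). pose proof (pos_INR j).
  assert (INR j + 1 <= mesh i) by (rewrite <- S_INR; apply le_INR; lia).
  unfold angle. split; [apply Rdiv_le_0_compat; nra|]. apply Rle_div_l; nra.
Qed.

Lemma N_angle (i j : nat) : INR (N i) * angle i j ^ 2 = rho i * freq j.
Proof. pose proof (mesh_pos i). unfold rho, freq, angle. field. lra. Qed.

Lemma sample_ge_0 (i j : nat) : 0 <= sample i j.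
Proof.
  unfold sample. destruct (Nat.leb_spec j (h i)); [|lra].
  pose proof (angle_bounds i j ltac:(lia)). apply pow_le, cos_ge_0; lra.
Qed.

(** The constant collects three losses: rho >= al/2, the correction 1 - t^2/12 >= 1/2 on [0, PI/2],
    and [freq j] >= j (PI/4)^2. *)
Lemma sample_dominated (i j : nat) : sample i j <= exp (- (al / 4 * (PI / 4) ^ 2)) ^ j.
Proof.
  unfold sample. destruct (Nat.leb_spec j (h i)) as [L|L].
  2: apply pow_le; left; apply exp_pos.
  pose proof (angle_bounds i j L) as Ha.
  apply Rle_trans with (1 := cos_pow_upper _ (N i) Ha).
  rewrite N_angle, exp_pow. apply exp_mono.
  pose proof PI_4 as HP4. pose proof PI_RGT_0 as HPI. pose proof (pos_INR j) as Hj.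
  assert (al / 2 <= rho i).
  { apply (proj1 (Rle_div_r _ _ _ (pow_lt _ 2 (mesh_pos i)))), N_bounds. }
  assert (H1 : / 2 <= 1 - angle i j ^ 2 / 12) by nra.
  assert (H2 : INR j * (PI / 4) ^ 2 <= freq j).
  { unfold freq. replace ((2 * INR j + 1) * PI / 4) with ((2 * INR j + 1) * (PI / 4)) by field.
    rewrite Rpow_mult_distr. apply Rmult_le_compat_r; [apply pow2_ge_0|]. nra. }
  assert (H3 : 0 <= INR j * (PI / 4) ^ 2) by (apply Rmult_le_pos; [lra|apply pow2_ge_0]).
  assert (H4 : al / 2 * (INR j * (PI / 4) ^ 2) <= rho i * freq j)
    by (apply Rmult_le_compat; lra).
  assert (0 <= rho i * freq j) by (apply Rle_trans with (2 := H4); apply Rmult_le_pos; lra).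
  assert (rho i * freq j * / 2 <= rho i * freq j * (1 - angle i j ^ 2 / 12))
    by (apply Rmult_le_compat_l; auto).
  replace (INR j * - (al / 4 * (PI / 4) ^ 2)) with (- (al / 2 * (INR j * (PI / 4) ^ 2) * / 2))
    by field.
  lra.
Qed.

Lemma is_lim_seq_sample (j : nat) :
  is_lim_seq (fun i => sample i j) (exp (- (al * freq j))).
Proof.
  assert (HL : is_lim_seq (fun i => angle i j ^ 2) 0).
  { apply is_lim_seq_ext with (fun i => freq j * (/ mesh i * / mesh i)).
    - intros i. pose proof (mesh_pos i). unfold freq, angle. field. lra.
    - replace (Finite 0) with (Rbar_mult (freq j) (0 * 0)) by (simpl; f_equal; ring).
      apply is_lim_seq_scal_l, is_lim_seq_mult'; apply is_lim_seq_inv_mesh. }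
  assert (Hr : is_lim_seq (fun i => rho i * freq j) (al * freq j)).
  { apply is_lim_seq_mult'; auto using is_lim_seq_const. }
  assert (Hq : forall c, is_lim_seq (fun i => 1 - angle i j ^ 2 / c) 1).
  { intros c. replace (Finite 1) with (Finite (1 - 0 * / c)) by (f_equal; ring).
    apply is_lim_seq_minus', is_lim_seq_mult'; auto using is_lim_seq_const. }
  apply is_lim_seq_le_le_loc with
    (fun i => exp (- (rho i * freq j / (1 - angle i j ^ 2 / 2))))
    (fun i => exp (- (rho i * freq j * (1 - angle i j ^ 2 / 12)))).
  - destruct (is_lim_seq_gt _ _ 0 (Hq 2) Rlt_0_1) as [M HM].
    exists (M + j)%nat. intros i Hi.
    assert (L : (j <= h i)%nat) by (specialize (h_ge i); lia).
    pose proof (angle_bounds i j L) as Ha. specialize (HM i ltac:(lia)).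
    unfold sample. rewrite (proj2 (Nat.leb_le _ _) L), <- N_angle. split.
    + apply cos_pow_lower; auto. lra.
    + now apply cos_pow_upper.
  - apply is_lim_seq_exp_opp. replace (al * freq j) with (al * freq j / 1) by field.
    apply (is_lim_seq_div' _ _ _ _ Hr (Hq 2)). lra.
  - apply is_lim_seq_exp_opp. replace (al * freq j) with (al * freq j * 1) by ring.
    apply (is_lim_seq_mult' _ _ _ _ Hr (Hq 12)).
Qed.

Lemma is_lim_seq_sample_Series :
  is_lim_seq (fun i => Series (sample i)) (Series (fun j => exp (- (al * freq j)))).
Proof.
  pose proof PI_RGT_0 as HPI.
  apply tannery with (fun j => exp (- (al / 4 * (PI / 4) ^ 2)) ^ j).
  - intros i j. rewrite Rabs_pos_eq; [apply sample_dominated|apply sample_ge_0].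
  - apply ex_series_pow. split; [left; apply exp_pos|]. rewrite <- exp_0.
    apply exp_increasing. assert (0 < (PI / 4) ^ 2) by (apply pow_lt; lra). nra.
  - exact is_lim_seq_sample.
Qed.

Let wallis_factor (i : nat) : R := mesh i * (cbin (N i) 0 / 4 ^ N i).

Lemma sample_Series (i : nat) : Series (sample i) =
  wallis_factor i * (2 * Series (fun k => (-1) ^ k * ratio i k) - 1).
Proof.
  pose proof (cbin_0_pos (N i)) as Hb.
  assert (H4 : 4 ^ N i <> 0) by (apply pow_nonzero; lra).
  rewrite (Series_finite (sample i) (h i)).
  2:{ intros k Hk. unfold sample. destruct (Nat.leb_spec k (h i)); [lia|auto]. }
  rewrite (Series_finite _ (N i)).
  2:{ intros k Hk. unfold ratio. rewrite cbin_eq_0 by nia. unfold Rdiv. ring. }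
  pose proof (polya_identity (N i) (h i)) as HP.
  rewrite (sum_n_ext_loc _ (fun j => scal (4 ^ N i) (sample i j))) in HP.
  2:{ intros j Hj. unfold sample. rewrite (proj2 (Nat.leb_le _ _) Hj).
      rewrite Rpow_mult_distr, pow_mult. replace (2 ^ 2) with 4 by ring. reflexivity. }
  rewrite (sum_n_scal_l (V := R_NormedModule)) in HP.
  rewrite (sum_n_ext (fun k => (-1) ^ k * cbin (N i) (k * (2 * S (h i))))
    (fun k => scal (cbin (N i) 0) ((-1) ^ k * ratio i k))) in HP.
  2:{ intros k. unfold ratio. change scal with Rmult. at_R. field. lra. }
  rewrite (sum_n_scal_l (V := R_NormedModule)) in HP.
  fold (mesh i) in HP. unfold wallis_factor.
  set (X := sum_n (sample i) (h i)) in *.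
  set (Y := sum_n (fun k => (-1) ^ k * ratio i k) (N i)) in *.
  change (4 ^ N i * X = mesh i * (2 * (cbin (N i) 0 * Y) - cbin (N i) 0)) in HP.
  apply Rmult_eq_reg_l with (4 ^ N i); auto. at_R. rewrite HP. field. auto.
Qed.

(** The square of the factor is (PI N p^2) / (PI rho), with p the central coefficient divided by
    4^N. The numerator tends to 1 by the Wallis bounds and rho tends to al. *)
Lemma is_lim_seq_wallis_factor : is_lim_seq wallis_factor (sqrt (/ (PI * al))).
Proof.
  pose proof PI_RGT_0 as HPI.
  set (p := fun i => cbin (N i) 0 / 4 ^ N i).
  assert (Hp : forall i, 0 < p i).
  { intros i. apply Rdiv_lt_0_compat; [apply cbin_0_pos|apply pow_lt; lra]. }
  assert (HL : is_lim_seq (fun i => PI * INR (N i) * p i ^ 2) 1).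
  { apply is_lim_seq_le_le with (fun i => 1 - 2 / al * (/ mesh i * / mesh i)) (fun _ => 1).
    - intros i. destruct (cbin_central_bounds (N i) (power_pos i)) as [H1 H2].
      split; [|exact H2]. apply Rle_trans with (2 := H1).
      pose proof (mesh_pos i) as HH. pose proof (N_bounds i) as HN.
      pose proof (lt_0_INR _ (power_pos i)).
      replace (2 * INR (N i) / (2 * INR (N i) + 1)) with (1 - / (2 * INR (N i) + 1))
        by (field; lra).
      assert (/ (2 * INR (N i) + 1) <= / (al / 2 * mesh i ^ 2)).
      { apply Rinv_le_contravar; [|lra]. apply Rmult_lt_0_compat; [lra|now apply pow_lt]. }
      replace (2 / al * (/ mesh i * / mesh i)) with (/ (al / 2 * mesh i ^ 2)) by (field; lra). lra.
    - replace (Finite 1) with (Finite (1 - 2 / al * (0 * 0))) by (f_equal; ring).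
      apply is_lim_seq_minus', is_lim_seq_mult', is_lim_seq_mult';
        auto using is_lim_seq_const, is_lim_seq_inv_mesh.
    - apply is_lim_seq_const. }
  apply is_lim_seq_ext with (fun i => sqrt (PI * INR (N i) * p i ^ 2 / (PI * rho i))).
  { intros i. pose proof (mesh_pos i). pose proof (lt_0_INR _ (power_pos i)).
    replace (PI * INR (N i) * p i ^ 2 / (PI * rho i)) with (wallis_factor i ^ 2)
      by (unfold wallis_factor, rho; fold (p i); field; lra).
    apply sqrt_pow2. apply Rmult_le_pos; [lra|left; apply Hp]. }
  apply is_lim_seq_continuous.
  - apply continuity_pt_sqrt. left. apply Rinv_0_lt_compat. nra.
  - replace (/ (PI * al)) with (1 / (PI * al)) by (unfold Rdiv; ring).
    apply is_lim_seq_div'; [exact HL|apply (is_lim_seq_scal_l _ PI al), rho_lim|nra].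
Qed.

Lemma gauss_sum_duality : Series (fun j => exp (- (al * freq j))) =
  sqrt (/ (PI * al)) * (2 * Series (fun k => (-1) ^ k * exp (- (4 * INR k ^ 2 / al))) - 1).
Proof.
  apply Rbar_finite_eq. rewrite <- (is_lim_seq_unique _ _ is_lim_seq_sample_Series).
  apply is_lim_seq_unique.
  apply is_lim_seq_ext with (1 := fun i => eq_sym (sample_Series i)).
  apply is_lim_seq_mult'; [apply is_lim_seq_wallis_factor|].
  apply is_lim_seq_minus'; [|apply is_lim_seq_const].
  apply (is_lim_seq_scal_l _ 2 (Series _)), is_lim_seq_ratio_Series.
Qed.

End Sampling.

Lemma exists_sampling (al : R) : 0 < al -> exists h N : nat -> nat,
  (forall i, (i <= h i)%nat) /\
  (forall i, al / 2 * INR (S (h i)) ^ 2 <= INR (N i) <= al * INR (S (h i)) ^ 2) /\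
  is_lim_seq (fun i => INR (N i) / INR (S (h i)) ^ 2) al.
Proof.
  (* The exponent N is the floor of al mesh^2. Starting the mesh beyond 2 / al makes al mesh^2 at
     least 2, so that a rounding loss of at most 1 leaves at least half of it. *)
  intros Hal. destruct (nfloor_ex (2 / al)) as [h0 Hh0]; [apply Rdiv_le_0_compat; lra|].
  set (h := fun i => (i + h0)%nat).
  assert (Hp : forall i, 0 < INR (S (h i)) ^ 2) by (intros; apply pow_lt, lt_0_INR; lia).
  assert (Hf : forall i, 0 <= al * INR (S (h i)) ^ 2).
  { intros i. specialize (Hp i). nra. }
  set (N := fun i => proj1_sig (nfloor_ex _ (Hf i))).
  assert (HN : forall i, INR (N i) <= al * INR (S (h i)) ^ 2 < INR (N i) + 1).
  { intros i. exact (proj2_sig (nfloor_ex _ (Hf i))). }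
  assert (H2 : forall i, 2 <= al * INR (S (h i)) ^ 2).
  { intros i. apply Rle_trans with (al * (2 / al)); [right; field; lra|].
    apply Rmult_le_compat_l; [lra|].
    assert (2 / al <= INR (S (h i))).
    { apply Rle_trans with (INR (S h0)); [rewrite S_INR; lra|]. apply le_INR. unfold h; lia. }
    assert (1 <= INR (S (h i))) by (apply (le_INR 1); lia). nra. }
  exists h, N. split; [unfold h; lia|split].
  - intros i. specialize (HN i). specialize (H2 i). lra.
  - apply is_lim_seq_le_le with (fun i => al - / INR (S i)) (fun _ => al).
    + intros i. specialize (HN i). specialize (Hp i). split.
      * apply Rle_div_r; auto.
        assert (/ INR (S (h i)) <= / INR (S i)).
        { apply Rinv_le_contravar; [apply lt_0_INR; lia|apply le_INR; unfold h; lia]. }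
        assert (1 <= INR (S (h i))) by (apply (le_INR 1); lia).
        assert (1 <= / INR (S (h i)) * INR (S (h i)) ^ 2).
        { replace (_ * _) with (INR (S (h i))) by (field; lra). auto. }
        nra.
      * apply Rle_div_l; lra.
    + replace (Finite al) with (Finite (al - 0)) by (f_equal; ring).
      apply is_lim_seq_minus'; [apply is_lim_seq_const|].
      apply (is_lim_seq_incr_1 (fun n => / INR n)).
      apply (is_lim_seq_inv INR p_infty); [apply is_lim_seq_INR|discriminate].
    + apply is_lim_seq_const.
Qed.

Lemma theta4_modular (y : R) : 0 < y ->
  2 * Series (fun m => exp (- (PI * INR (2 * m + 1) ^ 2 / (4 * y)))) = sqrt y * theta4 y.
Proof.
  intros Hy. pose proof PI_RGT_0 as HPI.
  (* With this value 4 k^2 / al = PI k^2 y, the exponent in [theta4], and al ((2j+1) PI/4)^2 = PI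
     (2j+1)^2 / (4y). *)
  set (al := 4 / (PI * y)).
  assert (Hal : 0 < al) by (apply Rdiv_lt_0_compat; nra).
  destruct (exists_sampling al Hal) as [h [N [H1 [H2 H3]]]].
  pose proof (gauss_sum_duality al h N Hal H1 H2 H3) as HD.
  rewrite theta4_Series by assumption.
  rewrite (Series_ext _ (fun j => exp (- (al * ((2 * INR j + 1) * PI / 4) ^ 2)))).
  2:{ intros j. f_equal. unfold al. rewrite plus_INR, mult_INR. simpl INR. field. lra. }
  rewrite (Series_ext (fun j => _ * nome y ^ (j * j))
    (fun k => (-1) ^ k * exp (- (4 * INR k ^ 2 / al)))).
  2:{ intros k. f_equal. unfold nome. rewrite exp_pow, mult_INR. f_equal.
      unfold al. field. lra. }
  rewrite HD. replace (/ (PI * al)) with (y / 2 ^ 2) by (unfold al; field; lra).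
  rewrite sqrt_div_alt, sqrt_pow2 by lra. field.
Qed.
(** * Integrals over the positive half-line *)

Definition is_RInt_pos {V : NormedModule R_AbsRing} (f : R -> V) (l : V) : Prop :=
  is_RInt_gen f (at_right 0) (Rbar_locally p_infty) l.

Definition continuous_pos {V : UniformSpace} (f : R -> V) : Prop :=
  forall t, 0 < t -> continuous f t.

Lemma filter_pos_interval (c : R) : 0 < c ->
  filter_prod (at_right 0) (Rbar_locally p_infty)
    (fun ab => 0 < fst ab < c /\ c < snd ab).
Proof.
  intros Hc. apply Filter_prod with (fun a => 0 < a < c) (fun b => c < b).
  - exists (mkposreal c Hc). intros x Hx H0. split; auto.
    apply Rabs_def2 in Hx. unfold minus, plus, opp in Hx. simpl in Hx. lra.
  - now exists c.
  - simpl. auto.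
Qed.

Lemma ex_RInt_pos_interval {V : CompleteNormedModule R_AbsRing} (f : R -> V) (a b : R) :
  continuous_pos f -> 0 < a -> 0 < b -> ex_RInt f a b.
Proof.
  intros Hf Ha Hb. apply ex_RInt_continuous. intros t Ht. apply Hf.
  apply Rlt_le_trans with (2 := proj1 Ht). now apply Rmin_glb_lt.
Qed.

Lemma is_RInt_pos_ext {V : NormedModule R_AbsRing} (f g : R -> V) (l : V) :
  (forall t, 0 < t -> f t = g t) -> is_RInt_pos f l -> is_RInt_pos g l.
Proof.
  intros H. apply is_RInt_gen_ext.
  apply filter_imp with (2 := filter_pos_interval 1 Rlt_0_1).
  intros [a b] [Ha Hb] x Hx. simpl in *. apply H.
  rewrite Rmin_left in Hx by lra. lra.
Qed.

Lemma is_RInt_pos_scal {V : NormedModule R_AbsRing} (f : R -> V) (k : R) (l : V) :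
  is_RInt_pos f l -> is_RInt_pos (fun t => scal k (f t)) (scal k l).
Proof. apply is_RInt_gen_scal. Qed.

Lemma is_RInt_pos_plus {V : NormedModule R_AbsRing} (f g : R -> V) (lf lg : V) :
  is_RInt_pos f lf -> is_RInt_pos g lg ->
  is_RInt_pos (fun t => plus (f t) (g t)) (plus lf lg).
Proof. apply is_RInt_gen_plus. Qed.

Lemma is_RInt_pos_minus {V : NormedModule R_AbsRing} (f g : R -> V) (lf lg : V) :
  is_RInt_pos f lf -> is_RInt_pos g lg ->
  is_RInt_pos (fun t => minus (f t) (g t)) (minus lf lg).
Proof. apply is_RInt_gen_minus. Qed.

Lemma is_RInt_pos_le {V : CompleteNormedModule R_AbsRing}
  (f : R -> V) (g : R -> R) (lf : V) (lg : R) :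
  (forall t, 0 < t -> norm (f t) <= g t) ->
  is_RInt_pos f lf -> is_RInt_pos g lg -> norm lf <= lg.
Proof.
  intros H. apply (RInt_gen_norm f g).
  - apply filter_imp with (2 := filter_pos_interval 1 Rlt_0_1).
    intros [a b] [Ha Hb]. simpl in *. lra.
  - apply filter_imp with (2 := filter_pos_interval 1 Rlt_0_1).
    intros [a b] [Ha Hb] t Ht. simpl in *. apply H. lra.
Qed.

(** The Cauchy criterion compares endpoints in an unknown order; hence the absolute value on the
    right. *)
Lemma norm_RInt_dominated {V : CompleteNormedModule R_AbsRing}
  (f : R -> V) (g : R -> R) (a b : R) :
  continuous_pos f -> continuous_pos g -> (forall t, 0 < t -> norm (f t) <= g t) ->
  0 < a -> 0 < b -> norm (RInt f a b) <= Rabs (RInt g a b).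
Proof.
  intros Hf Hg H Ha Hb.
  assert (Hle : forall a b, 0 < a -> a <= b -> norm (RInt f a b) <= Rabs (RInt g a b)).
  { clear a b Ha Hb. intros a b Ha Hab. apply Rle_trans with (2 := Rle_abs _).
    apply (norm_RInt_le f g a b).
    - exact Hab.
    - intros x Hx. apply H. lra.
    - apply RInt_correct, ex_RInt_pos_interval; auto; lra.
    - apply (RInt_correct (V := R_CompleteNormedModule)), ex_RInt_pos_interval; auto; lra. }
  destruct (Rle_dec a b) as [L|L]; [now apply Hle|].
  apply Rle_trans with (norm (RInt f b a)).
  - right. rewrite <- (norm_opp (RInt f b a)). f_equal. symmetry.
    now apply opp_RInt_swap, ex_RInt_pos_interval.
  - apply Rle_trans with (Rabs (RInt g b a)); [apply Hle; lra|].
    right. rewrite <- (Rabs_Ropp (RInt g b a)). f_equal.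
    now apply (opp_RInt_swap (V := R_CompleteNormedModule)),
      (ex_RInt_pos_interval (V := R_CompleteNormedModule)).
Qed.

Lemma plus_conj {V : AbelianGroup} (x y z : V) : plus (plus x (plus y z)) (opp y) = plus x z.
Proof. now rewrite (plus_comm y z), <- !plus_assoc, plus_opp_r, plus_zero_r. Qed.

(** Cauchy's criterion: two integrals of [f] differ by two end pieces. Each end piece is bounded by
    a difference of two integrals of [g], both within [eps / 8] of [G], hence by [eps / 4]. *)
Lemma ex_RInt_pos_dominated {V : CompleteNormedModule R_AbsRing}
  (f : R -> V) (g : R -> R) (G : R) :
  continuous_pos f -> continuous_pos g -> (forall t, 0 < t -> norm (f t) <= g t) ->
  is_RInt_pos g G -> exists l, is_RInt_pos f l /\ norm l <= G.
Proof.
  intros Hf Hg H HG.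
  assert (Hex : exists l, filterlim (fun ab => RInt f (fst ab) (snd ab))
    (filter_prod (at_right 0) (Rbar_locally p_infty)) (locally l)).
  { apply filterlim_locally_cauchy. intros eps.
    assert (He : 0 < eps / 8) by (generalize (cond_pos eps); lra).
    destruct (HG _ (locally_ball G (mkposreal _ He))) as [Q S HQ HS HQS].
    exists (fun ab => (Q (fst ab) /\ 0 < fst ab < 1) /\ (S (snd ab) /\ 1 < snd ab)). split.
    { destruct (filter_pos_interval 1 Rlt_0_1) as [Q1 R1 HQ1 HR1 HQR1].
      apply Filter_prod with (fun a => Q a /\ Q1 a) (fun b => S b /\ R1 b).
      - now apply filter_and.
      - now apply filter_and.
      - simpl. intros a b [Ha Ha1] [Hb Hb1]. specialize (HQR1 a b Ha1 Hb1).
        simpl in HQR1. tauto. }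
    assert (HB : forall a b, Q a -> 0 < a < 1 -> S b -> 1 < b ->
      Rabs (RInt g a b - G) < eps / 8).
    { intros a b Ha Ha' Hb Hb'. destruct (HQS a b Ha Hb) as [I [HI HI']].
      simpl in HI. rewrite (is_RInt_unique (V := R_CompleteNormedModule) _ _ _ _ HI). exact HI'. }
    intros [a b] [a' b'] [[Ha Ha1] [Hb Hb1]] [[Ha' Ha1'] [Hb' Hb1']]. simpl in *.
    apply (norm_compat1 (V := V)).
    assert (E : minus (RInt f a' b') (RInt f a b) = plus (RInt f a' a) (RInt f b b')).
    { rewrite <- (RInt_Chasles f a' a b'), <- (RInt_Chasles f a b b')
        by (apply ex_RInt_pos_interval; auto; lra).
      exact (plus_conj _ _ _). }
    apply Rle_lt_trans with (1 := Req_le _ _ (f_equal norm E)).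
    apply Rle_lt_trans with (1 := norm_triangle (V := V) (RInt f a' a) (RInt f b b')).
    assert (C : forall x y z, 0 < x -> 0 < y -> 0 < z ->
      RInt g x y = RInt g x z - RInt g y z).
    { intros x y z Hx Hy Hz.
      pose proof (RInt_Chasles (V := R_CompleteNormedModule) g x y z
        (ex_RInt_pos_interval (V := R_CompleteNormedModule) g x y Hg Hx Hy)
        (ex_RInt_pos_interval (V := R_CompleteNormedModule) g y z Hg Hy Hz)) as E'.
      change (@eq R (RInt g x y + RInt g y z) (RInt g x z)) in E'. lra. }
    assert (C' : forall x y z, 0 < x -> 0 < y -> 0 < z ->
      RInt g y z = RInt g x z - RInt g x y).
    { intros x y z Hx Hy Hz. pose proof (C x y z Hx Hy Hz). lra. }
    pose proof (norm_RInt_dominated f g a' a Hf Hg H ltac:(lra) ltac:(lra)) as N1.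
    pose proof (norm_RInt_dominated f g b b' Hf Hg H ltac:(lra) ltac:(lra)) as N2.
    rewrite (C a' a b) in N1 by lra. rewrite (C' a b b') in N2 by lra.
    pose proof (HB a b Ha Ha1 Hb Hb1). pose proof (HB a' b Ha' Ha1' Hb Hb1).
    pose proof (HB a b' Ha Ha1 Hb' Hb1').
    assert (T : forall u v, Rabs (u - G) < eps / 8 -> Rabs (v - G) < eps / 8 ->
      Rabs (u - v) < eps / 4).
    { intros u v Hu Hv. apply Rabs_def2 in Hu, Hv. apply Rabs_def1; lra. }
    pose proof (T _ _ H1 H0) as T1. pose proof (T _ _ H2 H0) as T2. lra. }
  destruct Hex as [l Hl].
  assert (Hi : is_RInt_pos f l).
  { intros P HP. specialize (Hl P HP). unfold filtermap in Hl. unfold filtermapi.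
    generalize (filter_and _ _ Hl (filter_pos_interval 1 Rlt_0_1)).
    apply filter_imp. intros [a b] [H1 [H2 H3]]. simpl in *.
    exists (RInt f a b). split; auto. apply RInt_correct, ex_RInt_pos_interval; auto; lra. }
  exists l. split; auto. now apply is_RInt_pos_le with f g.
Qed.

Lemma norm_series_le {V : NormedModule R_AbsRing} (u : nat -> V) (c : nat -> R) (l : V) :
  (forall n, norm (u n) <= c n) -> ex_series c -> is_series u l -> norm l <= Series c.
Proof.
  intros H Hc Hl.
  apply (is_lim_seq_le (fun N => norm (sum_n u N)) (fun N => sum_n c N) (norm l) (Series c)).
  - intros N. apply Rle_trans with (1 := norm_sum_n_m _ _ _).
    now apply sum_n_m_le.
  - exact (filterlim_comp _ _ _ _ norm _ _ _ Hl (filterlim_norm l)).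
  - exact (Series_correct c Hc).
Qed.

Lemma plus_minus_cancel {V : AbelianGroup} (x y : V) : plus (minus x y) y = x.
Proof. unfold minus. now rewrite <- plus_assoc, plus_opp_l, plus_zero_r. Qed.

Lemma norm_series_tail_le {V : NormedModule R_AbsRing} (u : nat -> V) (c : nat -> R)
  (l : V) (N : nat) :
  (forall n, norm (u n) <= c n) -> ex_series c -> is_series u l ->
  norm (minus l (sum_n u N)) <= Series (fun k => c (S N + k)%nat).
Proof.
  intros H Hc Hl. apply norm_series_le with (fun k => u (S N + k)%nat).
  - intros n. apply H.
  - now apply ex_series_shift.
  - apply is_series_incr_n; [lia|].
    exact (eq_rect_r (is_series u) Hl (plus_minus_cancel l (sum_n u N))).
Qed.

Lemma continuous_pos_sum_n {V : NormedModule R_AbsRing} (f : nat -> R -> V) (N : nat) :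
  (forall n, continuous_pos (f n)) -> continuous_pos (fun t => sum_n (fun n => f n t) N).
Proof.
  intros Hf. induction N as [|N IH]; intros t Ht.
  - apply continuous_ext with (f 0%nat); [intros; now rewrite sum_O|now apply Hf].
  - apply continuous_ext with (fun t => plus (sum_n (fun n => f n t) N) (f (S N) t)).
    + intros x. now rewrite sum_Sn.
    + apply (continuous_plus (fun t => sum_n (fun n => f n t) N) (f (S N))).
      * now apply IH.
      * now apply Hf.
Qed.

Lemma is_RInt_pos_sum_n {V : NormedModule R_AbsRing} (f : nat -> R -> V) (l : nat -> V)
  (N : nat) : (forall n, is_RInt_pos (f n) (l n)) ->
  is_RInt_pos (fun t => sum_n (fun n => f n t) N) (sum_n l N).
Proof.
  intros Hf. induction N as [|N IH].
  - rewrite sum_O. apply is_RInt_pos_ext with (2 := Hf 0%nat).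
    intros; now rewrite sum_O.
  - rewrite sum_Sn. apply is_RInt_pos_ext with (fun t => plus (sum_n (fun n => f n t) N) (f (S N) t)).
    + intros; now rewrite sum_Sn.
    + apply is_RInt_gen_plus; [exact IH|apply Hf].
Qed.

Lemma is_lim_seq_small (u : nat -> R) (eps : R) :
  is_lim_seq u 0 -> 0 < eps -> exists N, Rabs (u N) < eps.
Proof.
  intros H He. destruct (proj2 (is_lim_seq_spec _ _) H (mkposreal eps He)) as [N HN].
  exists N. specialize (HN N (le_n N)). simpl in HN. now rewrite Rminus_0_r in HN.
Qed.

(** A majorant of the form c(n) g(t) makes the convergence uniform wherever [g] is bounded, and near
    t it is bounded by |g(t)| + 1. *)
Lemma continuous_pos_series {V : NormedModule R_AbsRing} (f : nat -> R -> V) (F : R -> V)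
  (c : nat -> R) (g : R -> R) :
  (forall n, continuous_pos (f n)) -> continuous_pos g ->
  (forall n t, 0 < t -> norm (f n t) <= c n * g t) -> ex_series c ->
  (forall t, 0 < t -> is_series (fun n => f n t) (F t)) -> continuous_pos F.
Proof.
  intros Hf Hg Hb Hc HF t Ht.
  assert (HT : forall N s, 0 < s -> norm (minus (F s) (sum_n (fun n => f n s) N)) <=
    Series (fun k => c (S N + k)%nat) * g s).
  { intros N s Hs. rewrite <- Series_scal_r.
    apply (norm_series_tail_le (fun n => f n s) (fun n => c n * g s)); auto.
    destruct Hc as [C HC]. exists (C * g s).
    apply is_series_ext with (fun n => g s * c n); [intros; apply Rmult_comm|].
    rewrite Rmult_comm. now apply (is_series_scal (V := R_NormedModule)). }
  apply filterlim_locally_ball_norm. intros eps.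
  assert (He : 0 < eps / 4) by (generalize (cond_pos eps); lra).
  set (B := Rabs (g t) + 1). assert (HB : 0 < B) by (unfold B; pose proof (Rabs_pos (g t)); lra).
  destruct (is_lim_seq_small _ (eps / 4 / B) (is_lim_seq_Series_tail c Hc)) as [N HN].
  { now apply Rdiv_lt_0_compat. }
  pose proof (continuous_pos_sum_n f N Hf t Ht) as HS.
  apply filterlim_locally_ball_norm with (eps := mkposreal _ He) in HS.
  assert (HgB : locally t (fun s => Rabs (g s) < B)).
  { generalize (proj1 (filterlim_locally _ _) (Hg t Ht) (mkposreal 1 Rlt_0_1)).
    apply filter_imp. intros s Hs. unfold B.
    change (Rabs (g s - g t) < 1) in Hs.
    pose proof (Rabs_triang (g s - g t) (g t)) as Tr.
    replace (g s - g t + g t) with (g s) in Tr by ring. lra. }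
  assert (Hpos : locally t (fun s => 0 < s)) by (apply locally_open with (1 := open_gt 0); auto).
  generalize (filter_and _ _ HS (filter_and _ _ HgB Hpos)).
  apply filter_imp. intros s [H1 [H2 H3]]. unfold ball_norm in *. simpl in H1.
  assert (Hr : forall x, 0 < x -> Rabs (g x) < B ->
    norm (minus (F x) (sum_n (fun n => f n x) N)) < eps / 4).
  { intros x Hx HxB. apply Rle_lt_trans with (1 := HT N x Hx).
    apply Rle_lt_trans with (1 := Rle_abs _). rewrite Rabs_mult.
    apply Rle_lt_trans with (Rabs (Series (fun k => c (S N + k)%nat)) * B).
    - apply Rmult_le_compat_l; [apply Rabs_pos|lra].
    - apply Rmult_lt_compat_r with (r := B) in HN; auto.
      replace (eps / 4 / B * B) with (eps / 4) in HN by (field; lra). exact HN. }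
  pose proof (Hr s H3 H2) as R1.
  assert (HtB : Rabs (g t) < B) by (unfold B; apply Rlt_plus_1).
  pose proof (Hr t Ht HtB) as R2.
  set (Ss := sum_n (fun n => f n s) N) in *. set (St := sum_n (fun n => f n t) N) in *.
  replace (minus (F s) (F t)) with
    (plus (minus (F s) Ss) (plus (minus Ss St) (opp (minus (F t) St)))).
  - eapply Rle_lt_trans; [apply norm_triangle|].
    eapply Rle_lt_trans; [apply Rplus_le_compat_l, norm_triangle|].
    rewrite norm_opp. apply Rlt_trans with (eps / 4 + (eps / 4 + eps / 4)).
    + repeat apply Rplus_lt_compat; assumption.
    + generalize (cond_pos eps). lra.
  - rewrite opp_minus. rewrite (minus_trans Ss (F s) (F t)). f_equal.
    now rewrite (minus_trans St Ss (F t)).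
Qed.

(** Termwise integration. Because the majorant separates, the integral of the remainder after N
    terms is at most the tail of [c] times [G]. *)
Lemma is_RInt_pos_series {V : CompleteNormedModule R_AbsRing} (f : nat -> R -> V) (F : R -> V)
  (l : nat -> V) (c : nat -> R) (g : R -> R) (G : R) :
  (forall n, continuous_pos (f n)) -> continuous_pos g ->
  (forall n t, 0 < t -> norm (f n t) <= c n * g t) -> ex_series c ->
  (forall t, 0 < t -> is_series (fun n => f n t) (F t)) ->
  is_RInt_pos g G -> (forall n, is_RInt_pos (f n) (l n)) ->
  exists L, is_RInt_pos F L /\ is_series l L.
Proof.
  intros Hf Hg Hb Hc HF HG Hl.
  pose proof (continuous_pos_series f F c g Hf Hg Hb Hc HF) as HFc.
  assert (Hcs : forall s, ex_series (fun n => c n * g s)).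
  { intros s. destruct Hc as [C HC]. exists (scal (g s) C).
    apply is_series_ext with (fun n => scal (g s) (c n)); [intros; apply Rmult_comm|].
    now apply (is_series_scal (V := R_NormedModule)). }
  assert (Hgs : forall k, continuous_pos (fun t => scal k (g t))).
  { intros k t Ht. apply (continuous_scal_r k g), Hg, Ht. }
  destruct (ex_RInt_pos_dominated F (fun t => scal (Series c) (g t)) (scal (Series c) G))
    as [L [HL _]]; auto.
  { intros t Ht. change scal with Rmult. rewrite <- Series_scal_r.
    apply norm_series_le with (fun n => f n t); auto. }
  { apply (is_RInt_pos_scal (V := R_NormedModule)), HG. }
  exists L. split; auto.
  apply filterlim_locally_ball_norm. intros eps.
  assert (Hlim : is_lim_seq (fun N => Series (fun k => c (S N + k)%nat) * G) 0).
  { replace (Finite 0) with (Rbar_mult 0 G) by (simpl; f_equal; ring).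
    now apply is_lim_seq_scal_r, is_lim_seq_Series_tail. }
  destruct (proj2 (is_lim_seq_spec _ _) Hlim eps) as [M HM].
  exists M. intros N HN. specialize (HM N HN). simpl in HM. rewrite Rminus_0_r in HM.
  unfold ball_norm. rewrite <- norm_opp, opp_minus.
  apply Rle_lt_trans with (2 := HM), Rle_trans with (2 := Rle_abs _).
  apply (is_RInt_pos_le (fun t => minus (F t) (sum_n (fun n => f n t) N))
    (fun t => scal (Series (fun k => c (S N + k)%nat)) (g t))).
  - intros t Ht. change scal with Rmult. rewrite <- Series_scal_r.
    apply (norm_series_tail_le (fun n => f n t) (fun n => c n * g t)); auto.
  - exact (is_RInt_pos_minus F _ L _ HL (is_RInt_pos_sum_n f l N Hl)).
  - apply (is_RInt_pos_scal (V := R_NormedModule)), HG.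
Qed.

(** * Complex powers and complex-valued integrals *)

Definition Cexp (w : C) : C := (exp (fst w) * cos (snd w), exp (fst w) * sin (snd w)).

Lemma Cexp_plus (v w : C) : Cexp (v + w) = (Cexp v * Cexp w)%C.
Proof.
  unfold Cexp, Cplus, Cmult; simpl. rewrite exp_plus, cos_plus, sin_plus.
  f_equal; ring.
Qed.

Lemma Cexp_0 : Cexp 0 = 1.
Proof. unfold Cexp; simpl. rewrite exp_0, cos_0, sin_0. unfold RtoC. f_equal; ring. Qed.

Lemma Cexp_RtoC (x : R) : Cexp x = exp x.
Proof. unfold Cexp, RtoC; simpl. rewrite cos_0, sin_0. f_equal; ring. Qed.

Lemma Cmod_Cexp (w : C) : Cmod (Cexp w) = exp (fst w).
Proof.
  unfold Cmod, Cexp; simpl. pose proof (sin2_cos2 (snd w)) as H. unfold Rsqr in H.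
  replace (exp (fst w) * cos (snd w) * (exp (fst w) * cos (snd w) * 1) +
    exp (fst w) * sin (snd w) * (exp (fst w) * sin (snd w) * 1))
    with (exp (fst w) ^ 2 * (sin (snd w) * sin (snd w) + cos (snd w) * cos (snd w))) by ring.
  rewrite H, Rmult_1_r. apply sqrt_pow2. left; apply exp_pos.
Qed.

Lemma Rcpow_Cexp (x : R) (s : C) : Rcpow x s = Cexp (s * ln x).
Proof. unfold Rcpow, Cexp, Cmult, RtoC, Re, Im; simpl. do 2 f_equal; f_equal; ring. Qed.

Lemma Cmod_Rcpow (x : R) (s : C) : Cmod (Rcpow x s) = exp (Re s * ln x).
Proof. rewrite Rcpow_Cexp, Cmod_Cexp. f_equal. unfold Re; simpl. ring. Qed.

Lemma Rcpow_plus (x : R) (s t : C) : Rcpow x (s + t) = (Rcpow x s * Rcpow x t)%C.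
Proof. rewrite !Rcpow_Cexp, <- Cexp_plus. f_equal. ring. Qed.

Lemma Rcpow_mult (x y : R) (s : C) : 0 < x -> 0 < y ->
  Rcpow (x * y) s = (Rcpow x s * Rcpow y s)%C.
Proof.
  intros Hx Hy. rewrite !Rcpow_Cexp, <- Cexp_plus, ln_mult, RtoC_plus by assumption.
  f_equal. ring.
Qed.

Lemma Rcpow_0 (x : R) : Rcpow x 0 = 1.
Proof. rewrite Rcpow_Cexp, <- Cexp_0. f_equal. ring. Qed.

Lemma Rcpow_1 (x : R) : 0 < x -> Rcpow x 1 = x.
Proof.
  intros Hx. rewrite Rcpow_Cexp, Cmult_1_l, Cexp_RtoC, exp_ln; auto.
Qed.

Lemma Rcpow_opp (x : R) (s : C) : (Rcpow x s * Rcpow x (- s))%C = 1.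
Proof. rewrite <- Rcpow_plus, <- (Rcpow_0 x). f_equal. ring. Qed.

Lemma Rcpow_inv (x : R) (s : C) : 0 < x -> Rcpow (/ x) s = Rcpow x (- s).
Proof.
  intros Hx. rewrite !Rcpow_Cexp, ln_Rinv, RtoC_opp by assumption. f_equal. ring.
Qed.

Lemma Rcpow_sqrt (x : R) (s : C) : 0 < x -> Rcpow (sqrt x) s = Rcpow x (s / 2).
Proof.
  intros Hx. rewrite <- (sqrt_sqrt x) at 2 by lra.
  pose proof (sqrt_lt_R0 x Hx).
  rewrite Rcpow_mult, <- Rcpow_plus by assumption. f_equal. field.
Qed.

Lemma continuous_C_pair {T : UniformSpace} (f : T -> C) (t : T) :
  continuous (fun x => fst (f x)) t -> continuous (fun x => snd (f x)) t ->
  continuous (U := C_R_NormedModule) f t.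
Proof.
  intros H1 H2. apply filterlim_locally. intros eps.
  generalize (filter_and _ _ (proj1 (filterlim_locally _ _) H1 eps)
    (proj1 (filterlim_locally _ _) H2 eps)).
  apply filter_imp. intros x Hx. exact Hx.
Qed.

Lemma continuous_fst_C {T : UniformSpace} (f : T -> C) (t : T) :
  continuous (U := C_R_NormedModule) f t -> continuous (fun x => fst (f x)) t.
Proof.
  intros H. apply filterlim_locally. intros eps.
  generalize (proj1 (filterlim_locally _ _) H eps).
  apply filter_imp. intros x Hx. exact (proj1 Hx).
Qed.

Lemma continuous_snd_C {T : UniformSpace} (f : T -> C) (t : T) :
  continuous (U := C_R_NormedModule) f t -> continuous (fun x => snd (f x)) t.
Proof.
  intros H. apply filterlim_locally. intros eps.
  generalize (proj1 (filterlim_locally _ _) H eps).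
  apply filter_imp. intros x Hx. exact (proj2 Hx).
Qed.

Lemma continuous_Rcpow (s : C) : continuous_pos (V := C_R_NormedModule) (fun t => Rcpow t s).
Proof.
  intros t Ht. apply continuous_C_pair; unfold Rcpow; simpl;
    apply (ex_derive_continuous (V := R_NormedModule)); auto_derive; auto.
Qed.

Lemma continuous_Cmult {T : UniformSpace} (f g : T -> C) (t : T) :
  continuous (U := C_R_NormedModule) f t -> continuous (U := C_R_NormedModule) g t ->
  continuous (U := C_R_NormedModule) (fun x => f x * g x)%C t.
Proof.
  intros Hf Hg.
  pose proof (continuous_fst_C f t Hf). pose proof (continuous_snd_C f t Hf).
  pose proof (continuous_fst_C g t Hg). pose proof (continuous_snd_C g t Hg).
  apply continuous_C_pair; simpl.
  - apply (continuous_minus (V := R_NormedModule));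
      apply (continuous_mult (K := R_AbsRing)); auto.
  - apply (continuous_plus (V := R_NormedModule));
      apply (continuous_mult (K := R_AbsRing)); auto.
Qed.

Lemma continuous_RtoC {T : UniformSpace} (f : T -> R) (t : T) :
  continuous f t -> continuous (U := C_R_NormedModule) (fun x => RtoC (f x)) t.
Proof.
  intros Hf. apply continuous_C_pair; simpl; auto. apply continuous_const.
Qed.

Lemma filterlim_Cmult (c l : C) : filterlim (fun z : C_R_NormedModule => c * z)%C
  (locally (l : C_R_NormedModule)) (locally ((c * l)%C : C_R_NormedModule)).
Proof.
  apply (continuous_Cmult (T := C_R_NormedModule) (fun _ => c) (fun z => z)).
  - apply (continuous_const (U := C_R_NormedModule)).
  - apply (continuous_id (U := C_R_NormedModule)).
Qed.

Lemma sum_n_Cmult (c : C) (u : nat -> C) (N : nat) :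
  sum_n (G := C_R_NormedModule) (fun n => c * u n)%C N =
  (c * sum_n (G := C_R_NormedModule) u N)%C.
Proof.
  induction N as [|N IH]; [now rewrite !sum_O|].
  rewrite !sum_Sn, IH. symmetry. apply Cmult_plus_distr_l.
Qed.

Lemma is_series_Cmult (c : C) (u : nat -> C) (l : C) :
  is_series (V := C_R_NormedModule) u l ->
  is_series (V := C_R_NormedModule) (fun n => c * u n)%C (c * l)%C.
Proof.
  intros H. unfold is_series.
  apply filterlim_ext with (fun N => c * sum_n (G := C_R_NormedModule) u N)%C.
  - intros N. symmetry. apply sum_n_Cmult.
  - exact (filterlim_comp _ _ _ _ _ _ _ _ H (filterlim_Cmult c l)).
Qed.

Lemma is_RInt_Cmult (f : R -> C) (a b : R) (c l : C) :
  is_RInt (V := C_R_NormedModule) f a b l ->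
  is_RInt (V := C_R_NormedModule) (fun t => c * f t)%C a b (c * l)%C.
Proof.
  intros H.
  pose proof (is_RInt_fct_extend_fst (U := R_NormedModule) (V := R_NormedModule) f a b l H) as H1.
  pose proof (is_RInt_fct_extend_snd (U := R_NormedModule) (V := R_NormedModule) f a b l H) as H2.
  apply (is_RInt_fct_extend_pair (U := R_NormedModule) (V := R_NormedModule)); simpl.
  - exact (is_RInt_minus _ _ _ _ _ _ (is_RInt_scal _ _ _ (fst c) _ H1)
      (is_RInt_scal _ _ _ (snd c) _ H2)).
  - exact (is_RInt_plus _ _ _ _ _ _ (is_RInt_scal _ _ _ (fst c) _ H2)
      (is_RInt_scal _ _ _ (snd c) _ H1)).
Qed.

Lemma is_RInt_pos_Cmult (f : R -> C) (c l : C) :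
  is_RInt_pos (V := C_R_NormedModule) f l ->
  is_RInt_pos (V := C_R_NormedModule) (fun t => c * f t)%C (c * l)%C.
Proof.
  intros H P HP. specialize (H _ (filterlim_Cmult c l P HP)).
  unfold filtermapi in *. revert H. apply filter_imp.
  intros [a b] [y [H1 H2]]. exists (c * y)%C. split; auto. now apply is_RInt_Cmult.
Qed.

Lemma is_RInt_pos_pair (f : R -> C) (l : C) :
  is_RInt_pos (fun t => fst (f t)) (fst l) -> is_RInt_pos (fun t => snd (f t)) (snd l) ->
  is_RInt_pos (V := C_R_NormedModule) f l.
Proof.
  intros H1 H2 P [eps HP].
  pose proof (H1 _ (locally_ball (fst l) eps)) as K1.
  pose proof (H2 _ (locally_ball (snd l) eps)) as K2. unfold filtermapi in *.
  generalize (filter_and _ _ K1 K2). apply filter_imp.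
  intros [a b] [[y [Hy Hy']] [z [Hz Hz']]]. exists (y, z). split.
  - now apply (is_RInt_fct_extend_pair (U := R_NormedModule) (V := R_NormedModule)).
  - apply HP. split; auto.
Qed.

Lemma is_RInt_pos_fst (f : R -> C) (l : C) :
  is_RInt_pos (V := C_R_NormedModule) f l -> is_RInt_pos (fun t => fst (f t)) (fst l).
Proof.
  intros H P [eps HP].
  generalize (H _ (locally_ball (l : C_R_NormedModule) eps)).
  unfold filtermapi. apply filter_imp.
  intros [a b] [y [Hy Hy']]. exists (fst y). split.
  - now apply (is_RInt_fct_extend_fst (U := R_NormedModule) (V := R_NormedModule)).
  - apply HP, Hy'.
Qed.

Lemma is_RInt_pos_dilate {V : NormedModule R_AbsRing} (f : R -> V) (k : R) (l : V) :
  0 < k -> is_RInt_pos f l -> is_RInt_pos (fun t => scal k (f (k * t))) l.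
Proof.
  intros Hk H P HP. destruct (H P HP) as [Q S HQ [M HM] HQS].
  apply Filter_prod with (fun a => Q (k * a)) (fun b => S (k * b)).
  - destruct HQ as [eps HQ].
    assert (He : 0 < eps / k) by (apply Rdiv_lt_0_compat; [apply cond_pos|auto]).
    exists (mkposreal _ He). intros x Hx H0. apply HQ; [|nra].
    change (Rabs (k * x - 0) < eps). change (Rabs (x - 0) < eps / k) in Hx.
    rewrite Rminus_0_r in Hx |- *. rewrite Rabs_mult, (Rabs_pos_eq k) by lra.
    apply Rmult_lt_compat_l with (r := k) in Hx; auto.
    replace (k * (eps / k)) with (pos eps) in Hx by (field; lra). exact Hx.
  - exists (M / k). intros x Hx. apply HM. apply Rlt_div_l in Hx; auto. lra.
  - intros a b Ha Hb. destruct (HQS _ _ Ha Hb) as [y [Hy Hy']].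
    exists y. split; auto. simpl in *.
    apply is_RInt_ext with (fun t => scal k (f (k * t + 0))).
    + intros x _. now rewrite Rplus_0_r.
    + apply is_RInt_comp_lin. now rewrite !Rplus_0_r.
Qed.

Lemma is_RInt_pos_derive (f f' : R -> R) (la lb : R) :
  (forall t, 0 < t -> is_derive f t (f' t)) -> continuous_pos f' ->
  filterlim f (at_right 0) (locally la) -> filterlim f (Rbar_locally p_infty) (locally lb) ->
  is_RInt_pos f' (lb - la).
Proof.
  intros Hd Hc Ha Hb.
  apply is_RInt_pos_ext with (Derive f).
  { intros t Ht. now apply is_derive_unique, Hd. }
  apply is_RInt_gen_Derive; auto.
  - apply filter_imp with (2 := filter_pos_interval 1 Rlt_0_1).
    intros [a b] [H1 H2] x Hx. simpl in *. rewrite Rmin_left in Hx by lra.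
    exists (f' x). apply Hd. lra.
  - apply filter_imp with (2 := filter_pos_interval 1 Rlt_0_1).
    intros [a b] [H1 H2] x Hx. simpl in *. rewrite Rmin_left in Hx by lra.
    assert (Hx0 : 0 < x) by lra.
    apply continuous_ext_loc with (2 := Hc x Hx0).
    apply filter_imp with (2 := locally_open _ _ (open_gt 0) (fun _ H => H) x Hx0).
    intros t Ht. symmetry. now apply is_derive_unique, Hd.
Qed.

(** The integrand is the derivative of t^w phi(t), which vanishes at both ends. Keeping the two
    summands under one integral presupposes the convergence of neither, so the lemma can itself be
    used to establish convergence. *)
Lemma is_RInt_pos_by_parts (w : C) (phi phi' : R -> R) :
  (forall t, 0 < t -> is_derive phi t (phi' t)) -> continuous_pos phi' ->
  filterlim (fun t => exp (Re w * ln t) * phi t) (at_right 0) (locally 0) ->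
  filterlim (fun t => exp (Re w * ln t) * phi t) (Rbar_locally p_infty) (locally 0) ->
  is_RInt_pos (V := C_R_NormedModule)
    (fun t => w * (Rcpow t (w - 1) * phi t) + Rcpow t w * phi' t)%C (RtoC 0).
Proof.
  intros Hd Hc H0 Hoo.
  assert (Hphi : continuous_pos phi).
  { intros t Ht. apply (ex_derive_continuous (V := R_NormedModule)). eexists. now apply Hd. }
  assert (Hcont : continuous_pos (V := C_R_NormedModule)
    (fun t => w * (Rcpow t (w - 1) * phi t) + Rcpow t w * phi' t)%C).
  { intros t Ht. apply (continuous_plus (V := C_R_NormedModule)).
    - apply continuous_Cmult; [apply continuous_const|].
      apply continuous_Cmult; [now apply continuous_Rcpow|apply continuous_RtoC; auto].
    - apply continuous_Cmult; [now apply continuous_Rcpow|apply continuous_RtoC; auto]. }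
  (* Only the modulus of t^w phi(t) is assumed to vanish at the ends; the bounded oscillating
     factors of the real and imaginary parts preserve this limit. *)
  assert (Hsq : forall (F : (R -> Prop) -> Prop) (osc : R -> R), Filter F ->
    (forall x, Rabs (osc x) <= 1) ->
    filterlim (fun t => exp (Re w * ln t) * phi t) F (locally 0) ->
    filterlim (fun t => exp (Re w * ln t) * osc (Im w * ln t) * phi t) F (locally 0)).
  { intros F osc FF Hosc HF. apply filterlim_locally. intros eps.
    generalize (proj1 (filterlim_locally _ _) HF eps). apply filter_imp.
    intros x Hx. change (Rabs (exp (Re w * ln x) * phi x - 0) < eps) in Hx.
    change (Rabs (exp (Re w * ln x) * osc (Im w * ln x) * phi x - 0) < eps).
    rewrite Rminus_0_r in *. apply Rle_lt_trans with (2 := Hx).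
    rewrite !Rabs_mult. apply Rmult_le_compat_r; [apply Rabs_pos|].
    rewrite <- (Rmult_1_r (Rabs (exp (Re w * ln x)))) at 2.
    apply Rmult_le_compat_l; [apply Rabs_pos|apply Hosc]. }
  assert (Hcos : forall x, Rabs (cos x) <= 1) by (intros; apply Rabs_le, COS_bound).
  assert (Hsin : forall x, Rabs (sin x) <= 1) by (intros; apply Rabs_le, SIN_bound).
  assert (He : forall t, 0 < t -> exp (Re (w - 1) * ln t) = exp (Re w * ln t) / t).
  { intros t Ht. unfold Re; simpl. replace ((fst w + - (1)) * ln t) with (fst w * ln t - ln t) by ring.
    unfold Rminus. rewrite exp_plus, exp_Ropp, exp_ln; auto. }
  apply is_RInt_pos_pair.
  - refine (eq_rect (0 - 0) (is_RInt_pos _) _ 0 (Rminus_0_r 0)).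
    apply (is_RInt_pos_derive (fun t => exp (Re w * ln t) * cos (Im w * ln t) * phi t)); auto.
    + intros t Ht. auto_derive; [repeat split; auto; eexists; now apply Hd|].
      change (Derive (fun x => phi x) t) with (Derive phi t).
      rewrite (is_derive_unique _ _ _ (Hd t Ht)).
      unfold Rcpow. simpl. rewrite He by auto. unfold Re, Im. simpl.
      replace (snd w + - 0) with (snd w) by ring. field. lra.
    + intros t Ht. now apply (continuous_fst_C _ t (Hcont t Ht)).
    + apply (Hsq _ cos); auto. apply within_filter, locally_filter.
    + apply (Hsq _ cos); auto. apply Rbar_locally_filter.
  - refine (eq_rect (0 - 0) (is_RInt_pos _) _ 0 (Rminus_0_r 0)).
    apply (is_RInt_pos_derive (fun t => exp (Re w * ln t) * sin (Im w * ln t) * phi t)); auto.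
    + intros t Ht. auto_derive; [repeat split; auto; eexists; now apply Hd|].
      change (Derive (fun x => phi x) t) with (Derive phi t).
      rewrite (is_derive_unique _ _ _ (Hd t Ht)).
      unfold Rcpow. simpl. rewrite He by auto. unfold Re, Im. simpl.
      replace (snd w + - 0) with (snd w) by ring. field. lra.
    + intros t Ht. now apply (continuous_snd_C _ t (Hcont t Ht)).
    + apply (Hsq _ sin); auto. apply within_filter, locally_filter.
    + apply (Hsq _ sin); auto. apply Rbar_locally_filter.
Qed.

(** * Decay estimates, Euler's integral and p-series *)

Lemma ln_le_linear (e t : R) : 0 < e -> 0 < t -> ln t <= e * t - ln e.
Proof.
  intros He Ht. assert (H : 0 < e * t) by nra.
  pose proof (exp_ineq1_le (ln (e * t))) as H1. rewrite exp_ln, ln_mult in H1 by auto. lra.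
Qed.

Lemma exp_ln_decay (a c : R) : 0 <= a -> 0 < c -> exists M, 0 < M /\
  forall t, 0 < t -> exp (a * ln t) * exp (- (c * t)) <= M * exp (- (c / 2 * t)).
Proof.
  (* The slope e is such that a ln t <= a e t - a ln e costs at most half of the decay rate; the a +
     1 keeps the quotient defined at a = 0. *)
  intros Ha Hc. set (e := c / (2 * (a + 1))).
  assert (He : 0 < e) by (apply Rdiv_lt_0_compat; lra).
  assert (Hae : a * e <= c / 2).
  { replace (a * e) with (c / 2 * (a / (a + 1))) by (unfold e; field; lra).
    rewrite <- (Rmult_1_r (c / 2)) at 2. apply Rmult_le_compat_l; [lra|].
    apply Rle_div_l; lra. }
  exists (exp (- (a * ln e))). split; [apply exp_pos|]. intros t Ht.
  rewrite <- !exp_plus. apply exp_mono. pose proof (ln_le_linear e t He Ht). nra.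
Qed.

Lemma filterlim_pow_mul_bounded_0 (a M : R) (phi : R -> R) : 0 < a ->
  (forall t, 0 < t -> Rabs (phi t) <= M) ->
  filterlim (fun t => exp (a * ln t) * phi t) (at_right 0) (locally 0).
Proof.
  intros Ha HM. apply filterlim_locally. intros eps.
  assert (HM' : 0 < Rabs M + 1) by (pose proof (Rabs_pos M); lra).
  set (r := eps / (Rabs M + 1)).
  assert (Hr : 0 < r) by (apply Rdiv_lt_0_compat; [apply cond_pos|auto]).
  exists (mkposreal _ (exp_pos (ln r / a))). intros t Ht H0.
  change (Rabs (t - 0) < exp (ln r / a)) in Ht.
  rewrite Rminus_0_r, Rabs_pos_eq in Ht by lra.
  change (Rabs (exp (a * ln t) * phi t - 0) < eps). rewrite Rminus_0_r, Rabs_mult.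
  rewrite Rabs_pos_eq by (left; apply exp_pos).
  assert (Hl : exp (a * ln t) < r).
  { rewrite <- (exp_ln r) by auto. apply exp_increasing.
    apply ln_increasing in Ht; auto. rewrite ln_exp in Ht.
    apply Rmult_lt_compat_l with (r := a) in Ht; auto.
    replace (a * (ln r / a)) with (ln r) in Ht by (field; lra). auto. }
  apply Rle_lt_trans with (exp (a * ln t) * (Rabs M + 1)).
  - apply Rmult_le_compat_l; [left; apply exp_pos|].
    apply Rle_trans with (1 := HM t H0). pose proof (Rle_abs M). lra.
  - replace (pos eps) with (r * (Rabs M + 1)) by (unfold r; field; lra).
    now apply Rmult_lt_compat_r.
Qed.

Lemma filterlim_exp_decay_oo (c M : R) (phi : R -> R) : 0 < c ->
  (forall t, 1 < t -> Rabs (phi t) <= M * exp (- (c * t))) ->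
  filterlim phi (Rbar_locally p_infty) (locally 0).
Proof.
  intros Hc HM. apply filterlim_locally. intros eps.
  assert (HM' : 0 < Rabs M + 1) by (pose proof (Rabs_pos M); lra).
  exists (Rmax 1 ((Rabs M + 1) / eps / c)). intros t Ht.
  assert (Ht1 : 1 < t) by exact (Rle_lt_trans _ _ _ (Rmax_l _ _) Ht).
  assert (Ht2 : (Rabs M + 1) / eps / c < t) by exact (Rle_lt_trans _ _ _ (Rmax_r _ _) Ht).
  pose proof (cond_pos eps) as He.
  change (Rabs (phi t - 0) < eps). rewrite Rminus_0_r.
  apply Rle_lt_trans with (1 := HM t Ht1).
  apply Rle_lt_trans with ((Rabs M + 1) * exp (- (c * t))).
  - apply Rmult_le_compat_r; [left; apply exp_pos|]. pose proof (Rle_abs M). lra.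
  - rewrite exp_Ropp. apply Rlt_div_l; [apply exp_pos|].
    assert (Hct : (Rabs M + 1) / eps < c * t).
    { apply Rmult_lt_reg_r with (/ c); [now apply Rinv_0_lt_compat|].
      replace (c * t * / c) with t by (field; lra). unfold Rdiv in *. lra. }
    apply (proj1 (Rlt_div_l _ _ _ He)) in Hct. pose proof (exp_ineq1_le (c * t)).
    apply Rlt_le_trans with (1 := Hct). rewrite Rmult_comm.
    apply Rmult_le_compat_l; lra.
Qed.

Lemma filterlim_pow_mul_decay_oo (a c M : R) (phi : R -> R) : 0 <= a -> 0 < c ->
  (forall t, 1 < t -> Rabs (phi t) <= M * exp (- (c * t))) ->
  filterlim (fun t => exp (a * ln t) * phi t) (Rbar_locally p_infty) (locally 0).
Proof.
  intros Ha Hc HM. destruct (exp_ln_decay a c Ha Hc) as [K [HK0 HK]].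
  apply filterlim_exp_decay_oo with (c / 2) (K * Rabs M); [lra|].
  intros t Ht. rewrite Rabs_mult, Rabs_pos_eq by (left; apply exp_pos).
  apply Rle_trans with (exp (a * ln t) * exp (- (c * t)) * Rabs M).
  - rewrite Rmult_assoc. apply Rmult_le_compat_l; [left; apply exp_pos|].
    apply Rle_trans with (1 := HM t Ht). rewrite Rmult_comm.
    apply Rmult_le_compat_l; [left; apply exp_pos|apply Rle_abs].
  - replace (K * Rabs M * exp (- (c / 2 * t))) with (K * exp (- (c / 2 * t)) * Rabs M) by ring.
    apply Rmult_le_compat_r; [apply Rabs_pos|]. apply HK. lra.
Qed.

Lemma continuous_pos_exp_lin (c : R) : continuous_pos (fun t => exp (- (c * t))).
Proof. intros t Ht. apply (ex_derive_continuous (V := R_NormedModule)). auto_derive. auto. Qed.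

Lemma ex_RInt_pos_exp (c : R) : 0 < c -> exists l, is_RInt_pos (fun t => exp (- (c * t))) l.
Proof.
  intros Hc. eexists.
  apply (is_RInt_pos_derive (fun t => - exp (- (c * t)) / c) _ (- exp (- (c * 0)) / c) 0).
  - intros t Ht. auto_derive; auto. field. lra.
  - apply continuous_pos_exp_lin.
  - apply filterlim_filter_le_1 with (2 := ex_derive_continuous (V := R_NormedModule)
      (fun t => - exp (- (c * t)) / c) 0 ltac:(auto_derive; auto)).
    apply filter_le_within.
  - apply filterlim_exp_decay_oo with c (/ c); auto. intros t Ht.
    unfold Rdiv. rewrite Rabs_mult, Rabs_Ropp, !Rabs_pos_eq.
    + right; ring.
    + left; now apply Rinv_0_lt_compat.
    + left; apply exp_pos.
Qed.

Lemma norm_C_R (z : C) : norm (z : C_R_NormedModule) = Cmod z.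
Proof. symmetry. apply Cmod_norm. Qed.

Lemma continuous_pos_Rcpow_mul (s : C) (phi : R -> R) : continuous_pos phi ->
  continuous_pos (V := C_R_NormedModule) (fun t => Rcpow t s * phi t)%C.
Proof.
  intros H t Ht. apply continuous_Cmult; [now apply continuous_Rcpow|].
  now apply continuous_RtoC, H.
Qed.

Lemma norm_Rcpow_mul (t : R) (s : C) (x : R) :
  norm ((Rcpow t s * x)%C : C_R_NormedModule) = exp (Re s * ln t) * Rabs x.
Proof. now rewrite norm_C_R, Cmod_mult, Cmod_Rcpow, Cmod_R. Qed.

(** For Re s < 1 the integrand is unbounded at 0 and has no exponential majorant. Integration by
    parts expresses it through t^s exp(-ct), which has one, and division by s is allowed since Re s
    > 0. *)
Lemma ex_RInt_pos_Gamma (s : C) (c : R) : 0 < Re s -> 0 < c ->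
  exists l, is_RInt_pos (V := C_R_NormedModule) (fun t => Rcpow t (s - 1) * exp (- (c * t)))%C l.
Proof.
  intros Hs Hc.
  pose proof (is_RInt_pos_by_parts s (fun t => exp (- (c * t))) (fun t => - c * exp (- (c * t)))) as HB.
  assert (HB' := HB ltac:(intros t Ht; auto_derive; auto; ring)
    ltac:(intros t Ht; apply (ex_derive_continuous (V := R_NormedModule)); auto_derive; auto)
    ltac:(apply filterlim_pow_mul_bounded_0 with 1; auto; intros t Ht;
          rewrite Rabs_pos_eq by (left; apply exp_pos); rewrite <- exp_0; apply exp_mono; nra)
    ltac:(apply filterlim_pow_mul_decay_oo with c 1; [lra|auto|]; intros t Ht;
          rewrite Rabs_pos_eq by (left; apply exp_pos); lra)).
  clear HB.
  destruct (exp_ln_decay (Re s) c ltac:(lra) Hc) as [M [HM0 HM]].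
  destruct (ex_RInt_pos_exp (c / 2) ltac:(lra)) as [G HG].
  destruct (ex_RInt_pos_dominated (V := C_R_CompleteNormedModule)
    (fun t => Rcpow t s * exp (- (c * t)))%C (fun t => scal M (exp (- (c / 2 * t)))) (scal M G))
    as [l [Hl _]].
  - apply (continuous_pos_Rcpow_mul s (fun t => exp (- (c * t)))), continuous_pos_exp_lin.
  - intros t Ht. apply (continuous_scal_r (V := R_NormedModule) M), continuous_pos_exp_lin, Ht.
  - intros t Ht. eapply Rle_trans; [right; apply norm_Rcpow_mul|].
    rewrite Rabs_pos_eq by (left; apply exp_pos). now apply HM.
  - now apply (is_RInt_pos_scal (V := R_NormedModule)).
  - assert (Hs0 : s <> 0) by (intros ->; simpl in Hs; lra).
    exists (/ s * (0 + c * l))%C.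
    apply is_RInt_pos_ext with (fun t => / s * ((s * (Rcpow t (s - 1) * exp (- (c * t))) +
      Rcpow t s * (- c * exp (- (c * t)))%R) + c * (Rcpow t s * exp (- (c * t)))))%C.
    + intros t Ht. rewrite RtoC_mult, RtoC_opp. at_C. field. exact Hs0.
    + apply is_RInt_pos_Cmult.
      apply (is_RInt_pos_plus (V := C_R_NormedModule)); [exact HB'|].
      now apply is_RInt_pos_Cmult.
Qed.

Lemma is_RInt_pos_CInt (f : R -> C) (l : C) :
  is_RInt_pos (V := C_R_NormedModule) f l -> CInt_0_infty f = l.
Proof. apply (is_RInt_gen_unique (V := C_R_CompleteNormedModule)). Qed.

Lemma is_RInt_pos_CGamma (s : C) (c : R) : 0 < Re s -> 0 < c ->
  is_RInt_pos (V := C_R_NormedModule) (fun t => Rcpow t (s - 1) * exp (- (c * t)))%C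
    (Rcpow c (- s) * CGamma s)%C.
Proof.
  intros Hs Hc. destruct (ex_RInt_pos_Gamma s 1 Hs Rlt_0_1) as [l Hl].
  assert (E : CGamma s = l).
  { apply is_RInt_pos_CInt. apply is_RInt_pos_ext with (2 := Hl).
    intros t Ht. do 3 f_equal. ring. }
  rewrite E.
  apply is_RInt_pos_ext with (fun t => Rcpow c (- s) *
    scal c (Rcpow (c * t) (s - 1) * exp (- (1 * (c * t))) : C_R_NormedModule))%C.
  - intros t Ht. change (scal c ?z) with (scal (c : R) (z : C)).
    transitivity (Rcpow c (- s) * (c * (Rcpow (c * t) (s - 1) * exp (- (1 * (c * t))))))%C.
    { f_equal. unfold scal; simpl. unfold prod_scal, scal, Cmult, RtoC; simpl.
      unfold mult; simpl. f_equal; ring. }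
    rewrite Rcpow_mult by auto. rewrite <- (Rcpow_1 c) by auto.
    rewrite Rmult_1_l.
    transitivity (Rcpow c (- s + (1 + (s - 1))) * (Rcpow t (s - 1) * exp (- (c * t))))%C.
    + rewrite !Rcpow_plus. at_C. ring.
    + replace (- s + (1 + (s - 1)))%C with (RtoC 0) by ring. rewrite Rcpow_0. at_C. ring.
  - apply is_RInt_pos_Cmult, (is_RInt_pos_dilate (V := C_R_NormedModule)
      (fun t => Rcpow t (s - 1) * exp (- (1 * t)))%C); auto.
Qed.

Lemma ex_RInt_pos_pow_exp (a c : R) : 0 < a -> 0 < c ->
  exists l, is_RInt_pos (fun t => exp ((a - 1) * ln t) * exp (- (c * t))) l.
Proof.
  intros Ha Hc. destruct (ex_RInt_pos_Gamma a c Ha Hc) as [l Hl].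
  exists (fst l). apply is_RInt_pos_fst in Hl. apply is_RInt_pos_ext with (2 := Hl).
  intros t Ht. simpl. replace (0 + - 0) with 0 by ring.
  rewrite Rmult_0_l, cos_0. unfold Rminus. ring.
Qed.

Lemma continuous_pos_pow_exp (a c : R) :
  continuous_pos (fun t => exp (a * ln t) * exp (- (c * t))).
Proof. intros t Ht. apply (ex_derive_continuous (V := R_NormedModule)). auto_derive. auto. Qed.

(** The integral test in telescoping form: for f(x) = x^(1-q) the mean value theorem gives f(n) -
    f(n+1) >= (q-1) (n+1)^(-q). The estimate concerns the term with index n+1, hence the initial
    shift by one. *)
Lemma ex_series_p (q : R) : 1 < q -> ex_series (fun n => exp (- (q * ln (INR (S n))))).
Proof.
  intros Hq. apply (ex_series_incr_1 (fun n => exp (- (q * ln (INR (S n)))))).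
  set (f := fun x => exp (- ((q - 1) * ln x))).
  assert (Ht : ex_series (fun n => / (q - 1) * (f (INR (S n)) - f (INR (S (S n)))))).
  { apply (ex_series_scal (V := R_NormedModule) (/ (q - 1))).
    exists (f 1 - 0).
    apply (filterlim_ext (fun n => f 1 - f (INR (S (S n))))).
    - intros n. induction n as [|n IH].
      + rewrite sum_O. reflexivity.
      + rewrite sum_Sn, <- IH. change plus with Rplus. at_R. ring.
    - change (is_lim_seq (fun n => f 1 - f (INR (S (S n)))) (f 1 - 0)).
      apply is_lim_seq_minus'; [apply is_lim_seq_const|].
      apply is_lim_seq_le_le with (fun _ => 0) (fun n => / (q - 1) * / ln (INR (S (S n)))).
      + intros n. assert (0 < ln (INR (S (S n)))).
        { rewrite <- ln_1. apply ln_increasing; [lra|]. apply (lt_INR 1). lia. }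
        unfold f. split; [left; apply exp_pos|]. rewrite exp_Ropp, <- Rinv_mult.
        apply Rinv_le_contravar; [nra|].
        apply Rle_trans with (2 := exp_ineq1_le _). lra.
      + apply is_lim_seq_const.
      + replace (Finite 0) with (Rbar_mult (/ (q - 1)) 0) by (simpl; f_equal; ring).
        apply is_lim_seq_scal_l, (is_lim_seq_inv _ p_infty); [|discriminate].
        apply (filterlim_comp _ _ _ (fun n => INR (S (S n))) ln _ (Rbar_locally p_infty)).
        * apply (is_lim_seq_incr_1 (fun n => INR (S n))), (is_lim_seq_incr_1 INR), is_lim_seq_INR.
        * exact is_lim_ln_p. }
  apply ex_series_Rbound with (2 := Ht). intros n.
  rewrite Rabs_pos_eq by (left; apply exp_pos).
  set (x := INR (S n)). assert (Hx : 0 < x) by (apply lt_0_INR; lia).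
  rewrite (S_INR (S n)). fold x.
  destruct (MVT_gen f x (x + 1) (fun t => - (q - 1) * exp (- (q * ln t)))) as [t [Ht1 Ht2]].
  - intros t H. rewrite Rmin_left in H by lra. unfold f. auto_derive; [lra|].
    replace (- (q * ln t)) with (- ((q - 1) * ln t) + - ln t) by ring.
    rewrite exp_plus, (exp_Ropp (ln t)), exp_ln by lra. field. lra.
  - intros t H. rewrite Rmin_left in H by lra. unfold f.
    apply continuity_pt_filterlim, (ex_derive_continuous (V := R_NormedModule)
      (fun t => exp (- ((q - 1) * ln t)))).
    auto_derive. lra.
  - rewrite Rmin_left, Rmax_right in Ht1 by lra.
    replace (f x - f (x + 1)) with ((q - 1) * exp (- (q * ln t))) by lra.
    rewrite <- Rmult_assoc, Rinv_l, Rmult_1_l by lra. apply exp_mono.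
    assert (ln t <= ln (x + 1)) by (apply ln_le; lra). nra.
Qed.
(** * Zeta as a Mellin transform of [theta4] *)

Lemma fst_sum_n (u : nat -> C) (N : nat) :
  fst (sum_n (G := C_R_NormedModule) u N) = sum_n (fun n => fst (u n)) N.
Proof. induction N as [|N IH]; [now rewrite !sum_O|]. rewrite !sum_Sn, <- IH. reflexivity. Qed.

Lemma snd_sum_n (u : nat -> C) (N : nat) :
  snd (sum_n (G := C_R_NormedModule) u N) = sum_n (fun n => snd (u n)) N.
Proof. induction N as [|N IH]; [now rewrite !sum_O|]. rewrite !sum_Sn, <- IH. reflexivity. Qed.

Lemma is_series_C_iff (u : nat -> C) (l : C) :
  is_series (V := C_R_NormedModule) u l <->
  is_series (fun n => fst (u n)) (fst l) /\ is_series (fun n => snd (u n)) (snd l).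
Proof.
  unfold is_series, filterlim, filter_le, filtermap. split.
  - intros H. split; intros P [eps HP].
    + generalize (H _ (locally_ball (l : C_R_NormedModule) eps)).
      apply filter_imp. intros N HN. apply HP. rewrite <- fst_sum_n. exact (proj1 HN).
    + generalize (H _ (locally_ball (l : C_R_NormedModule) eps)).
      apply filter_imp. intros N HN. apply HP. rewrite <- snd_sum_n. exact (proj2 HN).
  - intros [H1 H2] P [eps HP].
    generalize (filter_and _ _ (H1 _ (locally_ball (fst l) eps)) (H2 _ (locally_ball (snd l) eps))).
    apply filter_imp. intros N [K1 K2]. apply HP. split.
    + rewrite fst_sum_n. exact K1.
    + rewrite snd_sum_n. exact K2.
Qed.

Lemma is_series_Czeta (s : C) : 1 < Re s ->
  is_series (V := C_R_NormedModule) (fun k => Rcpow (INR (S k)) (- s)) (Czeta s).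
Proof.
  intros Hs.
  assert (Hb : forall k, Cmod (Rcpow (INR (S k)) (- s)) <= exp (- (Re s * ln (INR (S k))))).
  { intros k. right. rewrite Cmod_Rcpow. f_equal. unfold Re; simpl fst. ring. }
  apply is_series_C_iff. split; simpl; apply Series_correct;
    apply ex_series_Rbound with (2 := ex_series_p (Re s) Hs); intros k;
    apply Rle_trans with (2 := Hb k), Rle_trans with (2 := Rmax_Cmod _).
  - apply Rmax_l.
  - apply Rmax_r.
Qed.

Lemma is_series_odd_indices (w : nat -> R) (l : R) :
  is_series w l -> is_series (fun k => if Nat.odd k then w (Nat.div2 k) else 0) l.
Proof.
  intros H. apply is_series_decr_1.
  replace (plus l (opp _)) with l by (change (l = l + - 0); ring).
  apply is_series_ext with (2 := is_series_spread 1 w l H).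
  intros n. unfold spread. rewrite Nat.odd_succ.
  pose proof (Nat.div2_odd n) as E. rewrite <- Nat.negb_odd.
  destruct (Nat.odd n); simpl Nat.b2n in E; simpl negb; cbv iota.
  - destruct (Nat.eqb_spec (n mod 2) 0) as [E'|]; auto.
    apply Nat.Div0.mod_divides in E'. destruct E' as [c Hc]. lia.
  - assert (En : n = (Nat.div2 n * 2)%nat) by lia.
    rewrite En at 1. rewrite Nat.Div0.mod_mul. simpl Nat.eqb. cbv iota.
    rewrite En at 1. rewrite Nat.div_mul by lia. f_equal.
    rewrite En at 2. rewrite Nat.mul_comm. now rewrite Nat.div2_succ_double.
Qed.

(** The alternating series is zeta minus twice its part over even integers, which is 2^(-s) zeta.
    Since index k stands for the integer k+1, the even integers sit at odd indices. *)
Lemma is_series_eta (s : C) : 1 < Re s ->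
  is_series (V := C_R_NormedModule) (fun k => ((-1) ^ k)%R * Rcpow (INR (S k)) (- s))%C
    ((1 - Rcpow 2 (1 - s)) * Czeta s)%C.
Proof.
  intros Hs. pose proof (is_series_Czeta s Hs) as HZ.
  set (u := fun k => Rcpow (INR (S k)) (- s)) in *.
  pose proof (is_series_Cmult (Rcpow 2 (- s)) u _ HZ) as HW.
  assert (HE : is_series (V := C_R_NormedModule)
    (fun k => if Nat.odd k then u k else RtoC 0) (Rcpow 2 (- s) * Czeta s)%C).
  { assert (Eu : forall k, Nat.odd k = true -> u k = (Rcpow 2 (- s) * u (Nat.div2 k))%C).
    { intros k Hk. unfold u.
      assert (H2 : 0 < 2) by lra. pose proof (lt_0_INR _ (Nat.lt_0_succ (Nat.div2 k))) as HI.
      rewrite <- Rcpow_mult by assumption.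
      f_equal. change 2 with (INR 2). rewrite <- mult_INR. f_equal.
      pose proof (Nat.div2_odd k) as E. rewrite Hk in E. unfold Nat.b2n in E. lia. }
    apply is_series_C_iff in HW. destruct HW as [H1 H2].
    apply is_series_C_iff. split.
    - apply is_series_ext with (2 := is_series_odd_indices _ _ H1).
      intros k. destruct (Nat.odd k) eqn:E; auto. now rewrite (Eu k E).
    - apply is_series_ext with (2 := is_series_odd_indices _ _ H2).
      intros k. destruct (Nat.odd k) eqn:E; auto. now rewrite (Eu k E). }
  pose proof (is_series_plus (V := C_R_NormedModule) _ _ _ _ HZ
    (is_series_Cmult (RtoC (-2)) _ _ HE)) as H.
  replace ((1 - Rcpow 2 (1 - s)) * Czeta s)%C with
    (Czeta s + RtoC (-2) * (Rcpow 2 (- s) * Czeta s))%C.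
  2:{ unfold Cminus at 2. rewrite Rcpow_plus, Rcpow_1 by lra.
      replace (RtoC (-2)) with (- RtoC 2)%C by (rewrite <- RtoC_opp; f_equal; ring). ring. }
  apply is_series_ext with (2 := H). intros k.
  change (u k + RtoC (-2) * (if Nat.odd k then u k else RtoC 0) = ((-1) ^ k)%R * u k)%C.
  assert (Ek : (-1) ^ k = if Nat.odd k then -1 else 1).
  { pose proof (Nat.div2_odd k) as E. rewrite E at 1.
    rewrite pow_add, pow_mult. replace ((-1) ^ 2) with 1 by ring. rewrite pow1.
    destruct (Nat.odd k); simpl; ring. }
  rewrite Ek. destruct (Nat.odd k); [|ring].
  replace (RtoC (-2)) with (RtoC (-1) - 1)%C by (rewrite <- RtoC_minus; f_equal; ring). ring.
Qed.

Lemma is_series_theta4 (y : R) : 0 < y ->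
  is_series (fun k => (-1) ^ k * exp (- (PI * INR (S k) ^ 2 * y))) ((1 - theta4 y) / 2).
Proof.
  intros Hy. pose proof (nome_unit_interval y Hy) as Hq.
  assert (Hx : 0 <= nome y < 1) by lra.
  pose proof (ex_series_theta _ Hx) as He.
  pose proof (Series_correct _ He) as HS.
  assert (HS' : is_series (fun k => (-1) ^ S k * nome y ^ (S k * S k)) ((theta4 y + 1) / 2 - 1)).
  { apply (is_series_incr_1 (fun k => (-1) ^ k * nome y ^ (k * k))).
    replace (plus _ _) with (Series (fun k => (-1) ^ k * nome y ^ (k * k))).
    - now apply Series_correct.
    - rewrite theta4_Series by assumption. change plus with Rplus. simpl. at_R. field. }
  replace ((1 - theta4 y) / 2) with (scal (-1) ((theta4 y + 1) / 2 - 1))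
    by (change scal with Rmult; at_R; field).
  apply is_series_ext with (fun k => scal (-1) ((-1) ^ S k * nome y ^ (S k * S k))).
  - intros k. change scal with Rmult. unfold nome. rewrite exp_pow, mult_INR.
    replace (INR (S k) * INR (S k) * (- PI * y)) with (- (PI * INR (S k) ^ 2 * y)) by ring.
    simpl pow. at_R. ring.
  - now apply (is_series_scal (V := R_NormedModule)).
Qed.

Definition asum_series (y : R) : R := Series (fun k => INR (asum (S k)) * nome y ^ S k).

Lemma continuous_pos_asum_series : continuous_pos asum_series.
Proof.
  intros y Hy. pose proof (nome_unit_interval y Hy) as Hq.
  apply continuous_ext_loc with
    (fun y => nome y / 2 * PSeries (PS_derive asum_ps) (nome y)).
  - apply filter_imp with (2 := locally_open _ _ (open_gt 0) (fun _ H => H) y Hy).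
    intros t Ht. symmetry. now apply is_series_unique, is_series_asum.
  - assert (Hn : continuous nome y).
    { apply (ex_derive_continuous (V := R_NormedModule)). unfold nome. auto_derive. auto. }
    apply (continuous_mult (K := R_AbsRing) (fun y => nome y / 2)).
    + apply (continuous_mult (K := R_AbsRing) nome (fun _ => / 2)); auto.
      apply continuous_const.
    + apply (continuous_comp nome); auto.
      apply continuity_pt_filterlim, PSeries_continuity.
      rewrite CV_radius_derive. apply CV_radius_asum_ps. lra.
Qed.

Lemma theta4_le_1 (y : R) : 0 < y -> theta4 y <= 1.
Proof.
  intros Hy. pose proof (nome_unit_interval y Hy) as Hq.
  rewrite theta4_exp, <- exp_0 by assumption. apply exp_mono.
  assert (0 <= PSeries asum_ps (nome y)); [|lra].
  assert (He : ex_series (fun n => asum_ps n * nome y ^ n)).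
  { apply ex_series_Rabs, CV_disk_inside, CV_radius_asum_ps. lra. }
  assert (H0 : Series (fun _ => 0) = 0).
  { apply is_series_unique. apply (filterlim_ext (fun _ => 0)); [|apply filterlim_const].
    intros n. rewrite sum_n_const. at_R. ring. }
  rewrite <- H0. apply Series_le; auto. intros n. split; [lra|].
  apply Rmult_le_pos; [|apply pow_le; lra]. unfold asum_ps.
  destruct n as [|n]; [simpl; unfold Rdiv; right; ring|].
  apply Rdiv_le_0_compat; [pose proof (pos_INR (asum (S n))); lra|apply lt_0_INR; lia].
Qed.

Lemma theta4_decay : exists K, forall y, 1 < y ->
  Rabs ((1 - theta4 y) / 2) <= K * exp (- (PI * y)).
Proof.
  pose proof PI_RGT_0 as HPI.
  assert (Hr : 0 <= exp (- PI) < 1).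
  { split; [left; apply exp_pos|]. rewrite <- exp_0. apply exp_increasing. lra. }
  exists (Series (fun k => exp (- PI) ^ k)). intros y Hy.
  rewrite Rmult_comm, <- Series_scal_l.
  apply (norm_series_le (V := R_NormedModule)
    (fun k => (-1) ^ k * exp (- (PI * INR (S k) ^ 2 * y)))).
  - intros k. change norm with Rabs. rewrite Rabs_mult, Rabs_pow_m1, Rmult_1_l.
    rewrite Rabs_pos_eq, exp_pow, <- exp_plus by (left; apply exp_pos).
    apply exp_mono. rewrite S_INR. pose proof (pos_INR k).
    assert (y + INR k <= (INR k + 1) ^ 2 * y) by nra. nra.
  - apply (ex_series_scal (V := R_NormedModule)), ex_series_pow, Hr.
  - apply is_series_theta4. lra.
Qed.

(** Integrating the n-th Gaussian termwise gives a Gamma factor times (PI n^2)^(-s/2), and the signs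
    turn the sum into the alternating zeta series. *)
Lemma is_RInt_pos_mellin_theta4 (s : C) : 1 < Re s ->
  is_RInt_pos (V := C_R_NormedModule)
    (fun y => Rcpow y (s / 2 - 1) * ((1 - theta4 y) / 2)%R)%C
    (Rcpow PI (- (s / 2)) * CGamma (s / 2) * ((1 - Rcpow 2 (1 - s)) * Czeta s))%C.
Proof.
  intros Hs. pose proof PI_RGT_0 as HPI.
  assert (Hw : Re (s / 2) = Re s / 2).
  { unfold Re, Cdiv, Cmult, Cinv, RtoC; simpl. field. }
  set (w := (s / 2)%C) in *.
  (* Chosen so that 2p > 1, which makes the series of n^(-2p) converge, and Re s / 2 - p > 0, which
     keeps the majorant integrable at 0. Both conditions amount to Re s > 1. *)
  set (p := (1 + Re s) / 4).
  set (c := fun k => PI * INR (S k) ^ 2).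
  assert (HI : forall k, 1 <= INR (S k)) by (intros k; apply (le_INR 1); lia).
  assert (Hc : forall k, 0 < c k) by (intros k; apply Rmult_lt_0_compat; [|apply pow_lt, lt_0_INR; lia]; lra).
  destruct (exp_ln_decay p (PI / 2) ltac:(unfold p; lra) ltac:(lra)) as [M [HM0 HM]].
  destruct (ex_RInt_pos_pow_exp (Re s / 2 - p) (PI / 2) ltac:(unfold p; lra) ltac:(lra)) as [G HG].
  destruct (is_RInt_pos_series (V := C_R_CompleteNormedModule)
    (fun k y => Rcpow y (w - 1) * ((-1) ^ k * exp (- (c k * y)))%R)%C
    (fun y => Rcpow y (w - 1) * ((1 - theta4 y) / 2)%R)%C
    (fun k => (Rcpow PI (- w) * CGamma w) * (((-1) ^ k)%R * Rcpow (INR (S k)) (- s)))%C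
    (fun k => M * exp (- (2 * p * ln (INR (S k)))))
    (fun y => exp ((Re s / 2 - p - 1) * ln y) * exp (- (PI / 2 * y))) G) as [L [HL HS]].
  - intros k. apply (continuous_pos_Rcpow_mul (w - 1) (fun y => (-1) ^ k * exp (- (c k * y)))).
    intros t Ht. apply (continuous_scal_r (V := R_NormedModule) ((-1) ^ k)).
    now apply continuous_pos_exp_lin.
  - apply continuous_pos_pow_exp.
  - intros k t Ht. eapply Rle_trans; [right; apply norm_Rcpow_mul|].
    rewrite Rabs_mult, Rabs_pow_m1, Rmult_1_l, Rabs_pos_eq by (left; apply exp_pos).
    set (n := INR (S k)). specialize (HI k). fold n in HI.
    set (x := n ^ 2 * t).
    assert (Hn2 : 1 <= n ^ 2) by nra. assert (Hx : t <= x) by (unfold x; nra).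
    assert (Hlx : ln x = 2 * ln n + ln t).
    { unfold x. rewrite ln_mult by (try apply pow_lt; lra).
      f_equal. simpl. rewrite Rmult_1_r, ln_mult by lra. ring. }
    specialize (HM x ltac:(lra)).
    assert (HM' : exp (- (PI / 2 * x)) <= M * exp (- (p * ln x))).
    { rewrite (exp_Ropp (p * ln x)). apply (proj1 (Rle_div_r _ _ _ (exp_pos _))).
      rewrite Rmult_comm. apply Rle_trans with (1 := HM).
      rewrite <- (Rmult_1_r M) at 2. apply Rmult_le_compat_l; [lra|].
      rewrite <- exp_0. apply exp_mono. nra. }
    assert (Hw1 : Re (w - 1) = Re s / 2 - 1) by (rewrite <- Hw; unfold Re; simpl; ring).
    (* The Gaussian is split into two halves: one is traded for the power (n^2 t)^(-p), which
       supplies summability, the other keeps the decay in t. *)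
    rewrite Hw1. replace (- (c k * t)) with (- (PI / 2 * x) + - (PI / 2 * x))
      by (unfold c, x, n; field). rewrite exp_plus.
    apply Rle_trans with (exp ((Re s / 2 - 1) * ln t) *
      (M * exp (- (p * ln x)) * exp (- (PI / 2 * t)))).
    + apply Rmult_le_compat_l; [left; apply exp_pos|].
      apply Rmult_le_compat; auto; try (left; apply exp_pos).
      apply exp_mono. nra.
    + right. rewrite Hlx.
      replace (- (p * (2 * ln n + ln t))) with (- (2 * p * ln n) + - (p * ln t)) by ring.
      replace ((Re s / 2 - p - 1) * ln t) with ((Re s / 2 - 1) * ln t + - (p * ln t)) by ring.
      rewrite !exp_plus. ring.
  - apply (ex_series_scal (V := R_NormedModule) M), ex_series_p. unfold p. lra.
  - intros t Ht. apply (is_series_Cmult (Rcpow t (w - 1))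
      (fun k => RtoC ((-1) ^ k * exp (- (c k * t)))) (RtoC ((1 - theta4 t) / 2))).
    apply is_series_C_iff. split; simpl.
    + now apply is_series_theta4.
    + apply (filterlim_ext (fun _ => 0)); [|apply filterlim_const].
      intros n. rewrite sum_n_const. at_R. ring.
  - exact HG.
  - intros k. apply is_RInt_pos_ext with (fun t => ((-1) ^ k)%R *
      (Rcpow t (w - 1) * exp (- (c k * t))))%C.
    + intros t Ht. rewrite RtoC_mult. at_C. ring.
    + replace (Rcpow PI (- w) * CGamma w * (((-1) ^ k)%R * Rcpow (INR (S k)) (- s)))%C
        with (((-1) ^ k)%R * (Rcpow (c k) (- w) * CGamma w))%C.
      * apply is_RInt_pos_Cmult, is_RInt_pos_CGamma; auto. rewrite Hw. lra.
      * unfold c. assert (Hk : 0 < INR (S k)) by (apply lt_0_INR; lia).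
        simpl pow. rewrite Rmult_1_r.
        rewrite (Rcpow_mult PI), (Rcpow_mult (INR (S k))) by (auto; now apply Rmult_lt_0_compat).
        rewrite <- (Rcpow_plus (INR (S k))).
        replace (- w + - w)%C with (- s)%C; [ring|]. unfold w. field.
  - replace (_ * _)%C with L; [exact HL|].
    apply (filterlim_locally_unique (V := C_R_NormedModule) _ _ _ HS).
    apply is_series_Cmult, is_series_eta, Hs.
Qed.

(** Integration by parts: (1 - theta4)/2 has derivative - PI A theta4. The boundary term vanishes at
    0 because 0 < theta4 <= 1 and Re s > 0, and at infinity because 1 - theta4 decays
    exponentially. *)
Lemma is_RInt_pos_mellin_theta4_derive (s : C) : 1 < Re s ->
  is_RInt_pos (V := C_R_NormedModule)
    (fun y => Rcpow y (s / 2) * (PI * asum_series y * theta4 y)%R)%C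
    (s / 2 * (Rcpow PI (- (s / 2)) * CGamma (s / 2) * ((1 - Rcpow 2 (1 - s)) * Czeta s)))%C.
Proof.
  intros Hs. pose proof (is_RInt_pos_mellin_theta4 s Hs) as HM.
  assert (Hw : Re (s / 2) = Re s / 2).
  { unfold Re, Cdiv, Cmult, Cinv, RtoC; simpl. field. }
  set (w := (s / 2)%C) in *. set (I := (_ * _ * (_ * Czeta s))%C) in *.
  assert (HB : is_RInt_pos (V := C_R_NormedModule)
    (fun t => w * (Rcpow t (w - 1) * ((1 - theta4 t) / 2)%R) +
      Rcpow t w * (- (PI * asum_series t * theta4 t))%R)%C (RtoC 0)).
  { apply (is_RInt_pos_by_parts w (fun t => (1 - theta4 t) / 2)
      (fun t => - (PI * asum_series t * theta4 t))).
    - intros t Ht. pose proof (is_derive_theta4 t Ht) as HD.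
      auto_derive; [eexists; exact HD|].
      change (Derive (fun x => theta4 x) t) with (Derive theta4 t).
      rewrite (is_derive_unique _ _ _ HD). unfold asum_series. field.
    - intros t Ht. apply (continuous_opp (V := R_NormedModule)).
      apply (continuous_mult (K := R_AbsRing) (fun t => PI * asum_series t)).
      + apply (continuous_scal_r (V := R_NormedModule) PI).
        now apply continuous_pos_asum_series.
      + apply (ex_derive_continuous (V := R_NormedModule)).
        eexists. now apply is_derive_theta4.
    - apply filterlim_pow_mul_bounded_0 with (/ 2); [lra|]. intros t Ht.
      pose proof (theta4_pos t Ht). pose proof (theta4_le_1 t Ht).
      apply Rabs_le. lra.
    - destruct theta4_decay as [K HK].
      apply filterlim_pow_mul_decay_oo with PI K; auto; [lra|apply PI_RGT_0]. }
  pose proof (is_RInt_pos_minus (V := C_R_NormedModule) _ _ _ _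
    (is_RInt_pos_Cmult _ w _ HM) HB) as H.
  replace (w * I)%C with (minus (w * I : C_R_NormedModule) (RtoC 0))%C.
  2:{ change (w * I - 0 = w * I)%C. ring. }
  apply is_RInt_pos_ext with (2 := H). intros t Ht.
  set (X := Rcpow t (w - 1)). set (Y := Rcpow t w).
  change (w * (X * ((1 - theta4 t) / 2)%R) - (w * (X * ((1 - theta4 t) / 2)%R) +
    Y * (- (PI * asum_series t * theta4 t))%R) = Y * (PI * asum_series t * theta4 t)%R)%C.
  rewrite RtoC_opp. ring.
Qed.
(** * The double series of Bessel kernels *)

Definition odd_theta (y : R) : R :=
  Series (fun m => exp (- (PI * INR (2 * m + 1) ^ 2 / (4 * y)))).

Definition bessel_kernel (k m : nat) (y : R) : R :=
  exp (- (PI * INR (S k) * y)) * exp (- (PI * INR (2 * m + 1) ^ 2 / (4 * y))).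

(** The square root of the largest kernel, [bessel_kernel 0 0]. Giving up half of the exponent in y
    leaves the other half for summation over k and m. *)
Definition two_sided_decay (y : R) : R := exp (- (PI / 2 * (y + / (4 * y)))).

Definition kernel_weight (k : nat) : R := exp (- (PI / 2 * (sqrt (INR (S k)) - 1))).

(** The exponent is split into halves. One is bounded below by its value at n = K = 1, which gives
    the decay in y; the other by K sqrt n >= (sqrt n - 1) + (K - 1)/2, which separates the two
    summation indices. For K = 2m + 1 the last term is m. *)
Lemma kernel_exponent_bound (n K y : R) : 1 <= n -> 1 <= K -> 0 < y ->
  PI / 2 * (y + / (4 * y)) + PI / 2 * (sqrt n - 1) + (K - 1) / 2 * (PI / 2)
    <= PI * n * y + PI * K ^ 2 / (4 * y).
Proof.
  intros Hn HK Hy. pose proof PI_RGT_0 as HPI.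
  set (X := n * y + K ^ 2 / (4 * y)).
  assert (Hr : 1 <= sqrt n) by (rewrite <- sqrt_1; now apply sqrt_le_1_alt).
  pose proof (sqrt_sqrt n ltac:(lra)) as Hrr. set (r := sqrt n) in *.
  assert (Hy4 : 0 < / (4 * y)) by (apply Rinv_0_lt_compat; lra).
  (* AM-GM *)
  assert (H1 : K * r <= X).
  { unfold X. rewrite <- Hrr.
    replace (r * r * y + K ^ 2 / (4 * y)) with (K * r + (2 * r * y - K) ^ 2 * / (4 * y))
      by (field; lra).
    pose proof (Rmult_le_pos _ _ (pow2_ge_0 (2 * r * y - K)) (Rlt_le _ _ Hy4)). lra. }
  assert (H2 : y + / (4 * y) <= X).
  { unfold X, Rdiv. set (v := / (4 * y)) in *.
    assert (1 <= K ^ 2) by nra. apply Rplus_le_compat; nra. }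
  replace (PI * n * y + PI * K ^ 2 / (4 * y)) with (PI / 2 * X + PI / 2 * X)
    by (unfold X; field; lra).
  assert (H3 : r - 1 + (K - 1) / 2 <= X) by nra.
  apply Rmult_le_compat_l with (r := PI / 2) in H2, H3; lra.
Qed.

Lemma bessel_kernel_le (k m : nat) (y : R) : 0 < y ->
  bessel_kernel k m y <= kernel_weight k * exp (- (PI / 2)) ^ m * two_sided_decay y.
Proof.
  intros Hy. unfold bessel_kernel, kernel_weight, two_sided_decay.
  rewrite exp_pow, <- !exp_plus. apply exp_mono.
  assert (Hn : 1 <= INR (S k)) by (apply (le_INR 1); lia).
  assert (HK : 1 <= INR (2 * m + 1)) by (apply (le_INR 1); lia).
  pose proof (kernel_exponent_bound _ _ _ Hn HK Hy) as H.
  replace ((INR (2 * m + 1) - 1) / 2) with (INR m) in H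
    by (rewrite plus_INR, mult_INR; simpl INR; field).
  lra.
Qed.

Lemma ex_series_geom_PI : ex_series (fun m => exp (- (PI / 2)) ^ m).
Proof.
  pose proof PI_RGT_0. apply ex_series_pow.
  split; [left; apply exp_pos|]. rewrite <- exp_0. apply exp_increasing. lra.
Qed.

Lemma is_series_odd_theta (y : R) : 0 < y ->
  is_series (fun m => exp (- (PI * INR (2 * m + 1) ^ 2 / (4 * y)))) (odd_theta y).
Proof.
  intros Hy. pose proof PI_RGT_0 as HPI. apply Series_correct.
  assert (Hr : 0 < PI / (4 * y)) by (apply Rdiv_lt_0_compat; lra).
  apply ex_series_Rbound with (fun m => exp (- (PI / (4 * y))) ^ m).
  - intros m. rewrite Rabs_pos_eq, exp_pow by (left; apply exp_pos). apply exp_mono.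
    rewrite plus_INR, mult_INR. simpl INR. pose proof (pos_INR m) as Hm.
    replace (- (PI * ((1 + 1) * INR m + 1) ^ 2 / (4 * y))) with
      (- ((2 * INR m + 1) ^ 2 * (PI / (4 * y)))) by (field; lra).
    assert (INR m <= (2 * INR m + 1) ^ 2) by nra. nra.
  - apply ex_series_pow. split; [left; apply exp_pos|].
    rewrite <- exp_0. apply exp_increasing. lra.
Qed.

Lemma is_series_bessel_kernel (k : nat) (y : R) : 0 < y ->
  is_series (fun m => bessel_kernel k m y) (exp (- (PI * INR (S k) * y)) * odd_theta y).
Proof.
  intros Hy. apply (is_series_scal (V := R_NormedModule) (exp (- (PI * INR (S k) * y)))).
  now apply is_series_odd_theta.
Qed.

Lemma bessel_kernel_ge_0 (k m : nat) (y : R) : 0 <= bessel_kernel k m y.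
Proof. apply Rmult_le_pos; left; apply exp_pos. Qed.

Definition geom_PI : R := Series (fun m => exp (- (PI / 2)) ^ m).

Lemma row_kernel_le (k : nat) (y : R) : 0 < y ->
  Rabs (exp (- (PI * INR (S k) * y)) * odd_theta y) <=
  kernel_weight k * geom_PI * two_sided_decay y.
Proof.
  intros Hy. unfold geom_PI. rewrite <- Series_scal_l, <- Series_scal_r.
  apply (norm_series_le (V := R_NormedModule) (fun m => bessel_kernel k m y)).
  - intros m. change norm with Rabs. rewrite Rabs_pos_eq by apply bessel_kernel_ge_0.
    now apply bessel_kernel_le.
  - destruct (ex_series_scal (V := R_NormedModule) (kernel_weight k) _ ex_series_geom_PI) as [l Hl].
    exists (scal (two_sided_decay y) l).
    apply is_series_ext with (2 := is_series_scal (V := R_NormedModule) (two_sided_decay y) _ _ Hl).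
    intros n. apply Rmult_comm.
  - now apply is_series_bessel_kernel.
Qed.

(** Since PI/2 > 1 and exp(r/8) >= r/8, the exponential is at most (8/r)^8 = 8^8 / n^4 for r = sqrt
    n. Against the bound n^2 for [asum] this leaves the convergent series of 1/n^2. *)
Lemma ex_series_kernel_weight : ex_series (fun k => INR (asum (S k)) * kernel_weight k).
Proof.
  pose proof PI_RGT_0 as HPI. pose proof PI2_1 as HPI2.
  apply ex_series_Rbound with
    (fun k => exp (PI / 2) * 8 ^ 8 * exp (- (2 * ln (INR (S k))))).
  2: apply (ex_series_scal (V := R_NormedModule)), ex_series_p; lra.
  intros k. set (n := INR (S k)). assert (Hn : 0 < n) by (apply lt_0_INR; lia).
  unfold kernel_weight. fold n.
  rewrite Rabs_pos_eq by (apply Rmult_le_pos; [apply pos_INR|left; apply exp_pos]).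
  assert (Ha : INR (asum (S k)) <= n * n).
  { unfold n. rewrite <- mult_INR. apply le_INR, asum_upto_le. }
  pose proof (sqrt_lt_R0 n Hn) as Hr. pose proof (sqrt_sqrt n ltac:(lra)) as Hrr.
  set (r := sqrt n) in *.
  replace (- (PI / 2 * (r - 1))) with (PI / 2 + - (PI / 2 * r)) by ring. rewrite exp_plus.
  assert (He : exp (- (PI / 2 * r)) <= 8 ^ 8 / (n * n * (n * n))).
  { rewrite exp_Ropp. replace (8 ^ 8 / (n * n * (n * n))) with (/ ((r / 8) ^ 8))
      by (rewrite <- Hrr; field; lra).
    apply Rinv_le_contravar; [apply pow_lt; lra|].
    replace (PI / 2 * r) with (INR 8 * (PI / 2 * r / 8)) by (simpl; field).
    rewrite <- exp_pow. apply pow_incr. split; [lra|].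
    apply Rle_trans with (2 := exp_ineq1_le _). nra. }
  assert (El : exp (- (2 * ln n)) = / (n * n)).
  { rewrite exp_Ropp. replace (2 * ln n) with (ln n + ln n) by ring.
    now rewrite exp_plus, exp_ln. }
  rewrite El. pose proof (exp_pos (PI / 2)) as Hep. pose proof (exp_pos (- (PI / 2 * r))).
  apply Rle_trans with (n * n * (exp (PI / 2) * (8 ^ 8 / (n * n * (n * n))))).
  - apply Rmult_le_compat; [apply pos_INR|nra|auto|].
    apply Rmult_le_compat_l; lra.
  - right. field. lra.
Qed.

Definition mellin_weight (y : R) : R := asum_series y * odd_theta y.

Lemma is_series_mellin_weight (y : R) : 0 < y ->
  is_series (fun k => INR (asum (S k)) * (exp (- (PI * INR (S k) * y)) * odd_theta y))
    (mellin_weight y).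
Proof.
  intros Hy.
  assert (H : is_series (fun k => INR (asum (S k)) * nome y ^ S k) (asum_series y)).
  { apply Series_correct. eexists. now apply is_series_asum. }
  unfold mellin_weight. rewrite Rmult_comm.
  apply is_series_ext with (2 := is_series_scal (V := R_NormedModule) (odd_theta y) _ _ H).
  intros k. change scal with Rmult. unfold nome. rewrite exp_pow.
  replace (INR (S k) * (- PI * y)) with (- (PI * INR (S k) * y)) by ring. at_R. ring.
Qed.

Lemma mellin_weight_le : exists D, 0 <= D /\ forall y, 0 < y ->
  Rabs (mellin_weight y) <= D * two_sided_decay y.
Proof.
  destruct (ex_series_scal (V := R_NormedModule) geom_PI _ ex_series_kernel_weight) as [D HD].
  exists D. assert (H : forall y, 0 < y -> Rabs (mellin_weight y) <= D * two_sided_decay y).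
  { intros y Hy. pose proof (is_series_scal (V := R_NormedModule) (two_sided_decay y) _ _ HD) as H.
    apply Rle_trans with (2 := Req_le _ _ (eq_trans (is_series_unique _ _ H) (Rmult_comm _ _))).
    apply (norm_series_le (V := R_NormedModule)
      (fun k => INR (asum (S k)) * (exp (- (PI * INR (S k) * y)) * odd_theta y))).
    - intros k. change norm with Rabs. change scal with Rmult.
      rewrite Rabs_mult, Rabs_pos_eq by apply pos_INR.
      apply Rle_trans with
        (INR (asum (S k)) * (kernel_weight k * geom_PI * two_sided_decay y)).
      + apply Rmult_le_compat_l; [apply pos_INR|now apply row_kernel_le].
      + right. ring.
    - now exists (scal (two_sided_decay y) D).
    - now apply is_series_mellin_weight. }
  split; auto. pose proof (Rle_trans _ _ _ (Rabs_pos _) (H 1 Rlt_0_1)) as H1.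
  pose proof (exp_pos (- (PI / 2 * (1 + / (4 * 1))))). unfold two_sided_decay in H1. nra.
Qed.

(** Continuity is inherited from [theta4] through the modular relation. *)
Lemma continuous_pos_odd_theta : continuous_pos odd_theta.
Proof.
  intros y Hy.
  apply continuous_ext_loc with (fun y => scal (/ 2) (sqrt y * theta4 y)).
  - apply filter_imp with (2 := locally_open _ _ (open_gt 0) (fun _ H => H) y Hy).
    intros t Ht. rewrite <- theta4_modular by exact Ht. fold (odd_theta t).
    change scal with Rmult. at_R. field.
  - apply (continuous_scal_r (V := R_NormedModule) (/ 2)).
    apply (continuous_mult (K := R_AbsRing) sqrt theta4).
    + apply continuous_sqrt.
    + apply (ex_derive_continuous (V := R_NormedModule)). eexists. now apply is_derive_theta4.
Qed.

Lemma continuous_pos_mellin_weight : continuous_pos mellin_weight.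
Proof.
  intros y Hy. apply (continuous_mult (K := R_AbsRing) asum_series odd_theta).
  - now apply continuous_pos_asum_series.
  - now apply continuous_pos_odd_theta.
Qed.

Lemma Rabs_ln_le (e u : R) : 0 < e -> 0 < u -> Rabs (ln u) <= e * (u + / u) - ln e.
Proof.
  intros He Hu. assert (Hi : 0 < / u) by now apply Rinv_0_lt_compat.
  pose proof (ln_le_linear e u He Hu). pose proof (ln_le_linear e (/ u) He Hi) as H'.
  rewrite ln_Rinv in H' by auto. assert (0 < e * u /\ 0 < e * / u) by (split; nra).
  apply Rabs_le. split; nra.
Qed.

(** This is why no half-plane restriction arises: decay at both ends absorbs every power of 2y. In u
    = 2y the decay is exp(-(PI/4)(u + 1/u)), and [e] is chosen so that the power costs at most
    (PI/8)(u + 1/u); what remains is below exp(-(PI/4) y). *)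
Lemma two_sided_decay_absorbs (tau : R) : 0 <= tau -> exists M, 0 <= M /\
  forall y, 0 < y ->
    exp (tau * Rabs (ln (2 * y))) * two_sided_decay y <= M * exp (- (PI / 4 * y)).
Proof.
  intros Ht. pose proof PI_RGT_0 as HPI.
  set (e := PI / (8 * (tau + 1))). assert (He : 0 < e) by (apply Rdiv_lt_0_compat; lra).
  assert (Hte : tau * e <= PI / 8).
  { replace (tau * e) with (PI / 8 * (tau / (tau + 1))) by (unfold e; field; lra).
    rewrite <- (Rmult_1_r (PI / 8)) at 2. apply Rmult_le_compat_l; [lra|].
    apply Rle_div_l; lra. }
  exists (exp (- (tau * ln e))). split; [left; apply exp_pos|]. intros y Hy.
  unfold two_sided_decay. rewrite <- !exp_plus. apply exp_mono.
  pose proof (Rabs_ln_le e (2 * y) He ltac:(lra)) as H.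
  assert (Hi : 0 < / (2 * y)) by (apply Rinv_0_lt_compat; lra).
  replace (y + / (4 * y)) with ((2 * y + / (2 * y)) / 2) by (field; lra).
  set (v := / (2 * y)) in *.
  apply Rmult_le_compat_l with (r := tau) in H; auto.
  assert (tau * e * (2 * y + v) <= PI / 8 * (2 * y + v)) by (apply Rmult_le_compat_r; lra).
  nra.
Qed.

Lemma Rcpow_norm_le (y : R) (w : C) : Cmod (Rcpow y w) <= exp (Rabs (Re w) * Rabs (ln y)).
Proof. rewrite Cmod_Rcpow, <- Rabs_mult. apply exp_mono, Rle_abs. Qed.

Lemma continuous_pos_Rcpow_dilate (w : C) (phi : R -> R) : continuous_pos phi ->
  continuous_pos (V := C_R_NormedModule) (fun y => Rcpow (2 * y) w * phi y)%C.
Proof.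
  intros H t Ht. apply continuous_Cmult; [|now apply continuous_RtoC, H].
  apply (continuous_comp (fun y => 2 * y) (fun t => Rcpow t w : C_R_NormedModule)).
  - apply (ex_derive_continuous (V := R_NormedModule)). auto_derive. auto.
  - apply continuous_Rcpow. lra.
Qed.

(** The constant [M] depends on [w] alone, so that one majorant in y serves all terms of a series
    and only [c] varies with the index. *)
Lemma Rcpow_mul_dominated (w : C) : exists M, 0 <= M /\
  forall (phi : R -> R) (c y : R), 0 < y -> Rabs (phi y) <= c * two_sided_decay y ->
    norm ((Rcpow (2 * y) w * phi y)%C : C_R_NormedModule) <= c * (M * exp (- (PI / 4 * y))).
Proof.
  destruct (two_sided_decay_absorbs (Rabs (Re w)) (Rabs_pos _)) as [M [HM0 HM]].
  exists M. split; auto. intros phi c y Hy Hphi.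
  rewrite norm_C_R, Cmod_mult, Cmod_R.
  assert (Hd : 0 < two_sided_decay y) by apply exp_pos.
  assert (Hc : 0 <= c) by (pose proof (Rabs_pos (phi y)); nra).
  apply Rle_trans with (exp (Rabs (Re w) * Rabs (ln (2 * y))) * (c * two_sided_decay y)).
  - apply Rmult_le_compat; auto using Cmod_ge_0, Rabs_pos, Rcpow_norm_le.
  - replace (_ * (c * _)) with
      (c * (exp (Rabs (Re w) * Rabs (ln (2 * y))) * two_sided_decay y)) by ring.
    apply Rmult_le_compat_l; auto.
Qed.

Lemma ex_RInt_pos_Rcpow_mul (w : C) (phi : R -> R) (c : R) : continuous_pos phi ->
  (forall y, 0 < y -> Rabs (phi y) <= c * two_sided_decay y) ->
  exists l, is_RInt_pos (V := C_R_NormedModule) (fun y => Rcpow (2 * y) w * phi y)%C l.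
Proof.
  intros Hc Hb. pose proof PI_RGT_0 as HPI. destruct (Rcpow_mul_dominated w) as [M [HM0 HM]].
  destruct (ex_RInt_pos_exp (PI / 4) ltac:(lra)) as [G HG].
  destruct (ex_RInt_pos_dominated (V := C_R_CompleteNormedModule)
    (fun y => Rcpow (2 * y) w * phi y)%C
    (fun y => scal (c * M) (exp (- (PI / 4 * y)))) (scal (c * M) G)) as [l [Hl _]].
  - now apply continuous_pos_Rcpow_dilate.
  - intros t Ht. apply (continuous_scal_r (V := R_NormedModule) (c * M)).
    now apply continuous_pos_exp_lin.
  - intros t Ht. change scal with Rmult. rewrite Rmult_assoc. now apply HM, Hb.
  - now apply (is_RInt_pos_scal (V := R_NormedModule)).
  - now exists l.
Qed.

Lemma is_RInt_pos_Rcpow_series (w : C) (phi : nat -> R -> R) (Phi : R -> R) (c : nat -> R)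
  (l : nat -> C) :
  (forall n, continuous_pos (phi n)) ->
  (forall n y, 0 < y -> Rabs (phi n y) <= c n * two_sided_decay y) -> ex_series c ->
  (forall y, 0 < y -> is_series (fun n => phi n y) (Phi y)) ->
  (forall n, is_RInt_pos (V := C_R_NormedModule) (fun y => Rcpow (2 * y) w * phi n y)%C (l n)) ->
  exists L, is_RInt_pos (V := C_R_NormedModule) (fun y => Rcpow (2 * y) w * Phi y)%C L /\
    is_series (V := C_R_NormedModule) l L.
Proof.
  intros Hcont Hb Hc HPhi Hl. pose proof PI_RGT_0 as HPI.
  destruct (Rcpow_mul_dominated w) as [M [HM0 HM]].
  destruct (ex_RInt_pos_exp (PI / 4) ltac:(lra)) as [G HG].
  apply (is_RInt_pos_series (V := C_R_CompleteNormedModule)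
    (fun n y => Rcpow (2 * y) w * phi n y)%C _ l c
    (fun y => scal M (exp (- (PI / 4 * y)))) (scal M G)); auto.
  - intros n. now apply continuous_pos_Rcpow_dilate.
  - intros t Ht. apply (continuous_scal_r (V := R_NormedModule) M).
    now apply continuous_pos_exp_lin.
  - intros y Hy. apply (is_series_Cmult (Rcpow (2 * y) w)
      (fun n => RtoC (phi n y)) (RtoC (Phi y))).
    apply is_series_C_iff. split; simpl; [now apply HPhi|].
    apply (filterlim_ext (fun _ => 0)); [|apply filterlim_const].
    intros n. rewrite sum_n_const. at_R. ring.
  - now apply (is_RInt_pos_scal (V := R_NormedModule)).
Qed.
(** * The Mellin transform of the Bessel kernels *)

Lemma is_RInt_pos_correct (f : R -> C) (l : C) :
  is_RInt_pos (V := C_R_NormedModule) f l ->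
  is_RInt_pos (V := C_R_NormedModule) f (CInt_0_infty f).
Proof. intros H. now rewrite (is_RInt_pos_CInt f l H). Qed.

Definition kernel_mellin (w : C) (k m : nat) : C :=
  CInt_0_infty (fun y => Rcpow (2 * y) w * bessel_kernel k m y)%C.

Definition row_mellin (w : C) (k : nat) : C :=
  CInt_0_infty (fun y => Rcpow (2 * y) w * (exp (- (PI * INR (S k) * y)) * odd_theta y)%R)%C.

Definition weight_mellin (w : C) : C :=
  CInt_0_infty (fun y => Rcpow (2 * y) w * mellin_weight y)%C.

Lemma continuous_pos_bessel_kernel (k m : nat) : continuous_pos (bessel_kernel k m).
Proof.
  intros y Hy. apply (ex_derive_continuous (V := R_NormedModule)). unfold bessel_kernel.
  auto_derive. lra.
Qed.

Lemma is_RInt_pos_kernel_mellin (w : C) (k m : nat) :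
  is_RInt_pos (V := C_R_NormedModule) (fun y => Rcpow (2 * y) w * bessel_kernel k m y)%C
    (kernel_mellin w k m).
Proof.
  destruct (ex_RInt_pos_Rcpow_mul w (bessel_kernel k m)
    (kernel_weight k * exp (- (PI / 2)) ^ m)) as [l Hl].
  - apply continuous_pos_bessel_kernel.
  - intros y Hy. rewrite Rabs_pos_eq by apply bessel_kernel_ge_0. now apply bessel_kernel_le.
  - exact (is_RInt_pos_correct _ l Hl).
Qed.

Lemma continuous_pos_row (k : nat) :
  continuous_pos (fun y => exp (- (PI * INR (S k) * y)) * odd_theta y).
Proof.
  intros y Hy. apply (continuous_mult (K := R_AbsRing) (fun y => exp (- (PI * INR (S k) * y)))).
  - now apply continuous_pos_exp_lin.
  - now apply continuous_pos_odd_theta.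
Qed.

Lemma is_series_kernel_mellin (w : C) (k : nat) :
  is_RInt_pos (V := C_R_NormedModule)
    (fun y => Rcpow (2 * y) w * (exp (- (PI * INR (S k) * y)) * odd_theta y)%R)%C
    (row_mellin w k) /\
  is_series (V := C_R_NormedModule) (kernel_mellin w k) (row_mellin w k).
Proof.
  destruct (is_RInt_pos_Rcpow_series w (bessel_kernel k)
    (fun y => exp (- (PI * INR (S k) * y)) * odd_theta y)
    (fun m => kernel_weight k * exp (- (PI / 2)) ^ m) (kernel_mellin w k)) as [L [HL HS]].
  - intros m. apply continuous_pos_bessel_kernel.
  - intros m y Hy. rewrite Rabs_pos_eq by apply bessel_kernel_ge_0. now apply bessel_kernel_le.
  - apply (ex_series_scal (V := R_NormedModule)), ex_series_geom_PI.
  - intros y Hy. now apply is_series_bessel_kernel.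
  - intros m. apply is_RInt_pos_kernel_mellin.
  - unfold row_mellin. rewrite (is_RInt_pos_CInt _ L HL). now split.
Qed.

Lemma is_series_row_mellin (w : C) :
  is_RInt_pos (V := C_R_NormedModule) (fun y => Rcpow (2 * y) w * mellin_weight y)%C
    (weight_mellin w) /\
  is_series (V := C_R_NormedModule) (fun k => INR (asum (S k)) * row_mellin w k)%C
    (weight_mellin w).
Proof.
  destruct (is_RInt_pos_Rcpow_series w
    (fun k y => INR (asum (S k)) * (exp (- (PI * INR (S k) * y)) * odd_theta y)) mellin_weight
    (fun k => scal geom_PI (INR (asum (S k)) * kernel_weight k))
    (fun k => INR (asum (S k)) * row_mellin w k)%C) as [L [HL HS]].
  - intros k y Hy. apply (continuous_scal_r (V := R_NormedModule) (INR (asum (S k)))).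
    now apply continuous_pos_row.
  - intros k y Hy. rewrite Rabs_mult, (Rabs_pos_eq (INR _)) by apply pos_INR.
    change scal with Rmult.
    replace (geom_PI * (INR (asum (S k)) * kernel_weight k) * two_sided_decay y) with
      (INR (asum (S k)) * (kernel_weight k * geom_PI * two_sided_decay y)) by ring.
    apply Rmult_le_compat_l; [apply pos_INR|now apply row_kernel_le].
  - apply (ex_series_scal (V := R_NormedModule)), ex_series_kernel_weight.
  - intros y Hy. now apply is_series_mellin_weight.
  - intros k. apply is_RInt_pos_ext with (fun y => INR (asum (S k)) *
      (Rcpow (2 * y) w * (exp (- (PI * INR (S k) * y)) * odd_theta y)%R))%C.
    + intros y Hy. rewrite !RtoC_mult. at_C. ring.
    + apply is_RInt_pos_Cmult, is_series_kernel_mellin.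
  - unfold weight_mellin. rewrite (is_RInt_pos_CInt _ L HL). now split.
Qed.

Lemma Rcpow_neq_0 (x : R) (s : C) : Rcpow x s <> 0.
Proof.
  intros E. pose proof (Rcpow_opp x s) as H. rewrite E, Cmult_0_l in H.
  injection H. lra.
Qed.

(* Substitute [u = (2 sqrt n / K) y], for [n = S k] and [K = 2 m + 1], in the integral
   defining the Bessel function. *)
Lemma besselK_kernel_mellin (nu : C) (k m : nat) :
  (Rcpow (INR (2 * m + 1)) nu * besselK nu (PI * sqrt (INR (S k)) * INR (2 * m + 1)))%C =
  (Rcpow (INR (S k)) (nu / 2) * kernel_mellin (nu - 1) k m)%C.
Proof.
  set (n := INR (S k)). set (K := INR (2 * m + 1)).
  assert (Hn : 0 < n) by (apply lt_0_INR; lia).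
  assert (HK : 0 < K) by (apply lt_0_INR; lia).
  pose proof (sqrt_lt_R0 n Hn) as Hr. pose proof (sqrt_sqrt n ltac:(lra)) as Hrr.
  rewrite <- Rcpow_sqrt by assumption. set (r := sqrt n) in *.
  set (q := K / r). assert (Hq : 0 < q) by now apply Rdiv_lt_0_compat.
  pose proof (is_RInt_pos_kernel_mellin (nu - 1) k m) as HJ.
  set (J := kernel_mellin (nu - 1) k m) in *.
  assert (Hc : (Rcpow q nu / 2 <> 0)%C).
  { intros E. apply (Rcpow_neq_0 q nu).
    replace (Rcpow q nu) with (2 * (Rcpow q nu / 2))%C by field. rewrite E. ring. }
  assert (HI : is_RInt_pos (V := C_R_NormedModule)
    (fun u => Rcpow u (nu - 1) * exp (- (PI * r * K / 2) * (u + / u)))%C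
    (/ (Rcpow q nu / 2) * J)%C).
  { apply (is_RInt_pos_dilate (V := C_R_NormedModule) _ (q / 2)) in HJ; [|lra].
    apply (is_RInt_pos_Cmult _ (/ (Rcpow q nu / 2))) in HJ.
    apply is_RInt_pos_ext with (2 := HJ). intros u Hu.
    assert (Ek : bessel_kernel k m (q / 2 * u) = exp (- (PI * r * K / 2) * (u + / u))).
    { unfold bessel_kernel. fold n K. rewrite <- exp_plus, <- Hrr. f_equal.
      unfold q. field. lra. }
    rewrite Ek. replace (2 * (q / 2 * u)) with (q * u) by field.
    rewrite Rcpow_mult by assumption.
    set (E := exp _). set (X := Rcpow u (nu - 1)).
    assert (Es : forall z : C, scal (q / 2) (z : C_R_NormedModule) = (RtoC (q / 2) * z)%C).
    { intros z. unfold scal; simpl. unfold prod_scal, scal, Cmult, RtoC; simpl.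
      unfold mult; simpl. f_equal; ring. }
    rewrite Es. rewrite RtoC_div by lra. rewrite <- (Rcpow_1 q) at 1 by assumption.
    transitivity (/ (Rcpow q nu / 2) * (Rcpow q (1 + (nu - 1)) / 2) * (X * E))%C.
    - rewrite Rcpow_plus. unfold Cdiv. at_C. ring.
    - replace (1 + (nu - 1))%C with nu by ring. rewrite Cinv_l by exact Hc. at_C. ring. }
  unfold besselK. apply is_RInt_pos_CInt in HI.
  replace (CInt_0_infty _) with (/ (Rcpow q nu / 2) * J)%C by (symmetry; exact HI).
  assert (Eq : Rcpow q nu = (Rcpow K nu * Rcpow r (- nu))%C).
  { unfold q, Rdiv. rewrite Rcpow_mult, Rcpow_inv; auto. now apply Rinv_0_lt_compat. }
  pose proof (Rcpow_opp r nu) as Hrn.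
  transitivity (Rcpow K nu * (/ (Rcpow q nu / 2) * J / 2) * (Rcpow r nu * Rcpow r (- nu)))%C.
  { rewrite Hrn. ring. }
  transitivity (Rcpow r nu * J * (/ (Rcpow q nu / 2) * (Rcpow q nu / 2)))%C.
  { rewrite Eq at 3. unfold Cdiv. ring. }
  rewrite Cinv_l by exact Hc. ring.
Qed.

(** By the modular relation B contributes sqrt y theta4 / 2, and the sqrt y raises the exponent from
    (s-1)/2 to s/2. The power of 2 left over multiplies 1 - 2^(1-s) into the symmetric bracket,
    since (s-1)/2 + (1-s) = (1-s)/2. *)
Lemma weight_mellin_zeta (s : C) : 1 < Re s ->
  weight_mellin ((s - 1) / 2) = zeta_side s.
Proof.
  intros Hs. pose proof PI_RGT_0 as HPI.
  pose proof (is_RInt_pos_mellin_theta4_derive s Hs) as H.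
  set (w := ((s - 1) / 2)%C).
  apply (is_RInt_pos_Cmult _ (Rcpow 2 w * RtoC (/ (2 * PI)))%C) in H.
  unfold weight_mellin.
  rewrite (is_RInt_pos_CInt _ (Rcpow 2 w * RtoC (/ (2 * PI)) * (s / 2 * (Rcpow PI (- (s / 2)) *
    CGamma (s / 2) * ((1 - Rcpow 2 (1 - s)) * Czeta s))))%C).
  - unfold zeta_side. fold w.
    replace ((1 - s) / 2)%C with (w + (1 - s))%C by (unfold w; field).
    rewrite Rcpow_plus.
    replace (RtoC (/ (2 * PI))) with (RtoC 2 / RtoC (4 * PI))%C.
    2:{ rewrite <- RtoC_div by lra. f_equal. field. lra. }
    unfold Cdiv. set (P := (/ RtoC (4 * PI))%C).
    transitivity (Rcpow 2 w * (P * (2 * / 2) * s * (Rcpow PI (- (s * / 2)) *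
      CGamma (s * / 2) * ((1 - Rcpow 2 (1 - s)) * Czeta s))))%C; [ring|].
    rewrite Cinv_r; [ring|]. intros E. injection E. lra.
  - apply is_RInt_pos_ext with (2 := H). intros y Hy.
    pose proof (sqrt_lt_R0 y Hy) as Hr.
    assert (E : mellin_weight y = / (2 * PI) * (sqrt y * (PI * asum_series y * theta4 y))).
    { unfold mellin_weight. pose proof (theta4_modular y Hy) as HM. fold (odd_theta y) in HM.
      replace (sqrt y * (PI * asum_series y * theta4 y)) with
        (PI * asum_series y * (sqrt y * theta4 y)) by ring.
      rewrite <- HM. field. lra. }
    rewrite E, Rcpow_mult, !(RtoC_mult _ (_ * _)) by lra.
    replace (Rcpow y (s / 2)) with (Rcpow y w * Rcpow (sqrt y) 1)%C.
    + rewrite Rcpow_1, !RtoC_mult by assumption. at_C. ring.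
    + rewrite Rcpow_sqrt, <- Rcpow_plus by assumption. f_equal. unfold w. field.
Qed.

(** * Taylor estimates and the holomorphy of the Mellin transform *)

Lemma Rabs_exp_minus_1 (x : R) : Rabs (exp x - 1) <= Rabs x * exp (Rabs x).
Proof.
  pose proof (exp_ineq1_le x) as H1. pose proof (exp_ineq1_le (- x)) as H2.
  rewrite exp_Ropp in H2. pose proof (exp_pos x) as H0.
  assert (H3 : (1 - x) * exp x <= 1).
  { apply Rmult_le_compat_r with (r := exp x) in H2; [|lra].
    rewrite Rinv_l in H2 by lra. lra. }
  pose proof (exp_ineq1_le (Rabs x)). pose proof (Rabs_pos x).
  unfold Rabs in *. destruct (Rcase_abs x), (Rcase_abs (exp x - 1)); nra.
Qed.

Lemma Rabs_exp_taylor (x : R) : Rabs (exp x - 1 - x) <= x ^ 2 * exp (Rabs x).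
Proof.
  pose proof (exp_ineq1_le x) as H1. rewrite Rabs_pos_eq by lra.
  pose proof (exp_ineq1_le (- x)) as H2. rewrite exp_Ropp in H2. pose proof (exp_pos x) as H0.
  assert (H3 : exp x - 1 - x <= x * (exp x - 1)).
  { apply Rmult_le_compat_r with (r := exp x) in H2; [|lra].
    rewrite Rinv_l in H2 by lra. lra. }
  apply Rle_trans with (1 := H3), Rle_trans with (1 := Rle_abs _).
  rewrite Rabs_mult. apply Rle_trans with (Rabs x * (Rabs x * exp (Rabs x))).
  - apply Rmult_le_compat_l; [apply Rabs_pos|apply Rabs_exp_minus_1].
  - right. rewrite <- (pow2_abs x). ring.
Qed.

Lemma Rabs_sin_le (y : R) : Rabs (sin y) <= Rabs y.
Proof.
  destruct (MVT_gen sin 0 y cos) as [c [_ Hc]].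
  - intros x _. apply is_derive_sin.
  - intros x _. apply derivable_continuous_pt, derivable_pt_sin.
  - rewrite sin_0, !Rminus_0_r in Hc. rewrite Hc, Rabs_mult.
    rewrite <- (Rmult_1_l (Rabs y)) at 2. apply Rmult_le_compat_r; [apply Rabs_pos|].
    apply Rabs_le, COS_bound.
Qed.

Lemma one_minus_cos (y : R) : 1 - cos y = 2 * sin (y / 2) ^ 2.
Proof.
  replace y with (2 * (y / 2)) at 1 by field. rewrite cos_2a_sin. simpl. ring.
Qed.

Lemma Rabs_one_minus_cos (y : R) : Rabs (1 - cos y) <= y ^ 2 / 2.
Proof.
  rewrite one_minus_cos, Rabs_mult, <- RPow_abs, (Rabs_pos_eq 2) by lra.
  apply Rle_trans with (2 * Rabs (y / 2) ^ 2).
  - apply Rmult_le_compat_l; [lra|]. apply pow_incr.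
    split; [apply Rabs_pos|apply Rabs_sin_le].
  - right. rewrite pow2_abs. field.
Qed.

Lemma Rabs_sin_minus (y : R) : Rabs (sin y - y) <= y ^ 2.
Proof.
  destruct (MVT_gen sin 0 y cos) as [c [Hc0 Hc]].
  - intros x _. apply is_derive_sin.
  - intros x _. apply derivable_continuous_pt, derivable_pt_sin.
  - rewrite sin_0, !Rminus_0_r in Hc.
    replace (sin y - y) with (- ((1 - cos c) * y)) by lra.
    rewrite Rabs_Ropp, Rabs_mult, <- (pow2_abs y).
    replace (Rabs y ^ 2) with (Rabs y * Rabs y) by ring.
    apply Rmult_le_compat_r; [apply Rabs_pos|].
    apply Rle_trans with (Rabs c).
    + rewrite one_minus_cos. pose proof (Rabs_sin_le (c / 2)) as H1.
      assert (H2 : Rabs (sin (c / 2)) <= 1) by apply Rabs_le, SIN_bound.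
      replace (sin (c / 2) ^ 2) with (Rabs (sin (c / 2)) * Rabs (sin (c / 2)))
        by (rewrite <- Rabs_mult, Rabs_pos_eq; [ring|apply Rle_0_sqr]).
      rewrite Rabs_pos_eq by (pose proof (Rabs_pos (sin (c / 2))); nra).
      replace (Rabs (c / 2)) with (Rabs c / 2) in H1
        by (unfold Rdiv; rewrite Rabs_mult, (Rabs_pos_eq (/ 2)) by lra; ring).
      pose proof (Rabs_pos (sin (c / 2))). nra.
    + revert Hc0. unfold Rmin, Rmax, Rabs.
      destruct (Rle_dec 0 y), (Rcase_abs c), (Rcase_abs y); lra.
Qed.

Lemma Cmod_le_sum (z : C) : Cmod z <= Rabs (fst z) + Rabs (snd z).
Proof.
  unfold Cmod. pose proof (Rabs_pos (fst z)) as H1. pose proof (Rabs_pos (snd z)) as H2.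
  rewrite <- (sqrt_pow2 (Rabs (fst z) + Rabs (snd z))) by lra.
  apply sqrt_le_1_alt. rewrite <- (pow2_abs (fst z)), <- (pow2_abs (snd z)). nra.
Qed.

(** The quadratic remainder that drives complex differentiability under the integral; the 4 adds a 2
    from the real part and a 2 from the imaginary part. *)
Lemma Cmod_Cexp_taylor (z : C) :
  Cmod (Cexp z - 1 - z) <= 4 * Cmod z ^ 2 * exp (Cmod z).
Proof.
  pose proof (Rmax_Cmod z) as HM. set (a := Cmod z) in *.
  destruct z as [x y]. simpl fst in HM. simpl snd in HM.
  assert (Hx : Rabs x <= a) by (apply Rle_trans with (2 := HM), Rmax_l).
  assert (Hy : Rabs y <= a) by (apply Rle_trans with (2 := HM), Rmax_r).
  pose proof (Rabs_pos x) as Hx0. pose proof (Rabs_pos y) as Hy0.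
  assert (Hx2 : x ^ 2 <= a ^ 2) by (rewrite <- pow2_abs; apply pow_incr; lra).
  assert (Hy2 : y ^ 2 <= a ^ 2) by (rewrite <- pow2_abs; apply pow_incr; lra).
  assert (Hxe : exp (Rabs x) <= exp a) by now apply exp_mono.
  pose proof (exp_ineq1_le a) as Ha. pose proof (pow2_ge_0 a) as Ha2.
  apply Rle_trans with (1 := Cmod_le_sum _).
  assert (H1 : Rabs (fst (Cexp (x, y) - 1 - (x, y))%C) <= 2 * (a ^ 2 * exp a)).
  { simpl. replace (exp x * cos y + - (1) + - x) with
      ((exp x - 1 - x) * cos y + - ((1 + x) * (1 - cos y))) by ring.
    apply Rle_trans with (1 := Rabs_triang _ _). rewrite Rabs_Ropp, !Rabs_mult.
    assert (E1 : Rabs (exp x - 1 - x) * Rabs (cos y) <= a ^ 2 * exp a * 1).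
    { apply Rmult_le_compat; try apply Rabs_pos; [|apply Rabs_le, COS_bound].
      apply Rle_trans with (1 := Rabs_exp_taylor x).
      apply Rmult_le_compat; auto using pow2_ge_0. left; apply exp_pos. }
    assert (E2 : Rabs (1 + x) * Rabs (1 - cos y) <= exp a * a ^ 2).
    { apply Rmult_le_compat; try apply Rabs_pos.
      - apply Rle_trans with (1 := Rabs_triang 1 x). rewrite Rabs_R1. lra.
      - apply Rle_trans with (1 := Rabs_one_minus_cos y). lra. }
    lra. }
  assert (H2 : Rabs (snd (Cexp (x, y) - 1 - (x, y))%C) <= 2 * (a ^ 2 * exp a)).
  { simpl. replace (exp x * sin y + - 0 + - y) with
      ((exp x - 1) * sin y + (sin y - y)) by ring.
    apply Rle_trans with (1 := Rabs_triang _ _). rewrite Rabs_mult.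
    assert (E1 : Rabs (exp x - 1) * Rabs (sin y) <= (a * exp a) * a).
    { apply Rmult_le_compat; try apply Rabs_pos.
      - apply Rle_trans with (1 := Rabs_exp_minus_1 x).
        apply Rmult_le_compat; auto. left; apply exp_pos.
      - apply Rle_trans with (1 := Rabs_sin_le y). exact Hy. }
    pose proof (Rabs_sin_minus y). nra. }
  nra.
Qed.

(** The derivative is taken with respect to s, where w = (s-1)/2; hence the factor 1/2 at the
    logarithm. *)
Definition weight_mellin_derive (w : C) : C :=
  CInt_0_infty (fun y => Rcpow (2 * y) w * (ln (2 * y) / 2 * mellin_weight y)%R)%C.

Lemma half_le_exp (x : R) : Rabs x / 2 <= exp (Rabs x / 2).
Proof. pose proof (exp_ineq1_le (Rabs x / 2)). lra. Qed.

Lemma is_RInt_pos_weight_mellin_derive (w : C) :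
  is_RInt_pos (V := C_R_NormedModule)
    (fun y => Rcpow (2 * y) w * (ln (2 * y) / 2 * mellin_weight y)%R)%C
    (weight_mellin_derive w).
Proof.
  pose proof PI_RGT_0 as HPI. destruct mellin_weight_le as [D [HD0 HD]].
  (* The extra 1 pays for the logarithm, since |ln(2y)|/2 <= exp |ln(2y)|. *)
  destruct (two_sided_decay_absorbs (Rabs (Re w) + 1)) as [M [HM0 HM]].
  { pose proof (Rabs_pos (Re w)); lra. }
  destruct (ex_RInt_pos_exp (PI / 4) ltac:(lra)) as [G HG].
  destruct (ex_RInt_pos_dominated (V := C_R_CompleteNormedModule)
    (fun y => Rcpow (2 * y) w * (ln (2 * y) / 2 * mellin_weight y)%R)%C
    (fun y => scal (D * M) (exp (- (PI / 4 * y)))) (scal (D * M) G)) as [l [Hl _]].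
  - apply (continuous_pos_Rcpow_dilate w (fun y => ln (2 * y) / 2 * mellin_weight y)).
    intros y Hy. apply (continuous_mult (K := R_AbsRing) (fun y => ln (2 * y) / 2)).
    + apply (ex_derive_continuous (V := R_NormedModule)). auto_derive. lra.
    + now apply continuous_pos_mellin_weight.
  - intros t Ht. apply (continuous_scal_r (V := R_NormedModule) (D * M)).
    now apply continuous_pos_exp_lin.
  - intros y Hy. rewrite norm_C_R, Cmod_mult, Cmod_R, Rabs_mult.
    change scal with Rmult. set (L := ln (2 * y)).
    specialize (HM y Hy). fold L in HM.
    apply Rle_trans with (exp (Rabs (Re w) * Rabs L) * (exp (Rabs L) * (D * two_sided_decay y))).
    + apply Rmult_le_compat; auto using Cmod_ge_0, Rcpow_norm_le.
      * apply Rmult_le_pos; apply Rabs_pos.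
      * apply Rmult_le_compat; auto using Rabs_pos.
        unfold Rdiv. rewrite Rabs_mult, (Rabs_pos_eq (/ 2)) by lra.
        pose proof (exp_ineq1_le (Rabs L)). pose proof (Rabs_pos L). lra.
    + replace (_ * (_ * _)) with (D * (exp (Rabs (Re w) * Rabs L) * exp (Rabs L) * two_sided_decay y))
        by ring.
      rewrite <- exp_plus, Rmult_assoc.
      apply Rmult_le_compat_l; auto.
      replace (Rabs (Re w) * Rabs L + Rabs L) with ((Rabs (Re w) + 1) * Rabs L) by ring. exact HM.
  - now apply (is_RInt_pos_scal (V := R_NormedModule)).
  - exact (is_RInt_pos_correct _ l Hl).
Qed.

(** Under the integral the difference is (2y)^w (exp z - 1 - z) times the weight, with z = h
    ln(2y)/2. For |h| <= 1 its modulus is at most 4 |h|^2 exp(2 |ln(2y)|) times that of (2y)^w and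
    the weight: one exponential bounds the square of ln(2y)/2 and the other bounds exp |z|. The
    decay absorbs both, which accounts for the 2 added to |Re w|. *)
Lemma weight_mellin_taylor (w : C) : exists K, 0 <= K /\ forall h : C, Cmod h <= 1 ->
  Cmod (weight_mellin (w + h / 2) - weight_mellin w - h * weight_mellin_derive w)
    <= K * Cmod h ^ 2.
Proof.
  pose proof PI_RGT_0 as HPI. destruct mellin_weight_le as [D [HD0 HD]].
  destruct (two_sided_decay_absorbs (Rabs (Re w) + 2)) as [M [HM0 HM]].
  { pose proof (Rabs_pos (Re w)); lra. }
  destruct (ex_RInt_pos_exp (PI / 4) ltac:(lra)) as [G HG].
  exists (Rabs (4 * D * M * G)). split; [apply Rabs_pos|]. intros h Hh.
  pose proof (is_RInt_pos_minus (V := C_R_NormedModule) _ _ _ _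
    (is_RInt_pos_minus (V := C_R_NormedModule) _ _ _ _
      (proj1 (is_series_row_mellin (w + h / 2))) (proj1 (is_series_row_mellin w)))
    (is_RInt_pos_Cmult _ h _ (is_RInt_pos_weight_mellin_derive w))) as HI.
  pose proof (is_RInt_pos_scal (V := R_NormedModule) _ (4 * Cmod h ^ 2 * D * M) _ HG) as HB.
  apply Rle_trans with (4 * Cmod h ^ 2 * D * M * G).
  2:{ apply Rle_trans with ((4 * D * M * G) * Cmod h ^ 2); [right; ring|].
      apply Rmult_le_compat_r; [apply pow2_ge_0|apply Rle_abs]. }
  apply Rle_trans with (1 := Req_le _ _ (Cmod_norm _)).
  apply (is_RInt_pos_le (V := C_R_CompleteNormedModule) _ _ _ _) with (2 := HI) (3 := HB).
  intros y Hy. rewrite norm_C_R. change scal with Rmult.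
  set (L := ln (2 * y)). set (z := (h * (L / 2)%R)%C).
  specialize (HM y Hy). fold L in HM.
  match goal with |- Cmod ?A <= _ =>
    replace A with (Rcpow (2 * y) w * ((Cexp z - 1 - z) * mellin_weight y))%C end.
  2:{ change ((Rcpow (2 * y) w * ((Cexp z - 1 - z) * mellin_weight y))%C =
        (Rcpow (2 * y) (w + h / 2) * mellin_weight y - Rcpow (2 * y) w * mellin_weight y -
          h * (Rcpow (2 * y) w * (L / 2 * mellin_weight y)%R))%C).
      rewrite Rcpow_plus, (Rcpow_Cexp _ (h / 2)). fold L.
      replace (h / 2 * L)%C with z.
      2:{ unfold z. rewrite RtoC_div by lra. unfold Cdiv. ring. }
      rewrite RtoC_mult. unfold z. ring. }
  assert (Hz : Cmod z = Cmod h * (Rabs L / 2)).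
  { unfold z. rewrite Cmod_mult, Cmod_R. f_equal. unfold Rdiv.
    now rewrite Rabs_mult, (Rabs_pos_eq (/ 2)) by lra. }
  pose proof (Rabs_pos L) as HL. pose proof (Cmod_ge_0 h) as Hh0.
  assert (Hz1 : Cmod z <= Rabs L / 2) by (rewrite Hz; nra).
  assert (Hz2 : Cmod z ^ 2 <= Cmod h ^ 2 * exp (Rabs L)).
  { rewrite Hz, Rpow_mult_distr. apply Rmult_le_compat_l; [apply pow2_ge_0|].
    replace (exp (Rabs L)) with (exp (Rabs L / 2) ^ 2)
      by (rewrite exp_pow; f_equal; simpl; field).
    apply pow_incr. split; [lra|apply half_le_exp]. }
  assert (HT : Cmod (Cexp z - 1 - z) <= 4 * Cmod h ^ 2 * exp (2 * Rabs L)).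
  { apply Rle_trans with (1 := Cmod_Cexp_taylor z).
    replace (2 * Rabs L) with (Rabs L + Rabs L) by ring. rewrite exp_plus.
    assert (exp (Cmod z) <= exp (Rabs L)) by (apply exp_mono; lra).
    pose proof (exp_pos (Cmod z)). pose proof (pow2_ge_0 (Cmod z)).
    replace (4 * Cmod h ^ 2 * (exp (Rabs L) * exp (Rabs L))) with
      (4 * (Cmod h ^ 2 * exp (Rabs L)) * exp (Rabs L)) by ring.
    apply Rmult_le_compat; lra. }
  rewrite !Cmod_mult, Cmod_R.
  apply Rle_trans with (exp (Rabs (Re w) * Rabs L) *
    (4 * Cmod h ^ 2 * exp (2 * Rabs L) * (D * two_sided_decay y))).
  - apply Rmult_le_compat; auto using Cmod_ge_0, Rcpow_norm_le.
    + apply Rmult_le_pos; [apply Cmod_ge_0|apply Rabs_pos].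
    + apply Rmult_le_compat; auto using Cmod_ge_0, Rabs_pos.
  - replace (_ * (_ * _)) with (4 * Cmod h ^ 2 * D *
      (exp (Rabs (Re w) * Rabs L) * exp (2 * Rabs L) * two_sided_decay y)) by ring.
    rewrite <- exp_plus.
    replace (Rabs (Re w) * Rabs L + 2 * Rabs L) with ((Rabs (Re w) + 2) * Rabs L) by ring.
    rewrite (Rmult_assoc (4 * Cmod h ^ 2 * D)). apply Rmult_le_compat_l; auto.
    repeat apply Rmult_le_pos; try apply pow2_ge_0; lra.
Qed.

Lemma entire_weight_mellin : entire (fun s => weight_mellin ((s - 1) / 2)).
Proof.
  intros s. set (w := ((s - 1) / 2)%C).
  destruct (weight_mellin_taylor w) as [K [HK0 HK]].
  exists (weight_mellin_derive w). split.
  - apply is_linear_scal_l.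
  - intros x Hx eps.
    apply (is_filter_lim_locally_unique (V := AbsRing_NormedModule C_AbsRing)) in Hx. subst x.
    apply (locally_le_locally_norm (V := AbsRing_NormedModule C_AbsRing) s).
    (* The bound 1 makes the quadratic estimate available, and eps/(K+1) makes K |h| at most eps
       even when K = 0. *)
    assert (He : 0 < Rmin 1 (eps / (K + 1))).
    { apply Rmin_glb_lt; [lra|]. apply Rdiv_lt_0_compat; [apply cond_pos|lra]. }
    exists (mkposreal _ He). intros z Hz.
    change (Cmod (z - s) < Rmin 1 (eps / (K + 1))) in Hz.
    set (h := (z - s)%C) in *.
    change (Cmod (weight_mellin ((z - 1) / 2) - weight_mellin w - h * weight_mellin_derive w)
      <= eps * Cmod h).
    replace ((z - 1) / 2)%C with (w + h / 2)%C by (unfold w, h; field).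
    pose proof (Rmin_l 1 (eps / (K + 1))). pose proof (Rmin_r 1 (eps / (K + 1))).
    apply Rle_trans with (1 := HK h ltac:(lra)).
    pose proof (Cmod_ge_0 h).
    replace (K * Cmod h ^ 2) with (K * Cmod h * Cmod h) by ring.
    apply Rmult_le_compat_r; auto.
    apply Rle_trans with (K * (eps / (K + 1))); [apply Rmult_le_compat_l; lra|].
    replace (K * (eps / (K + 1))) with (eps * (K / (K + 1))) by (field; lra).
    rewrite <- (Rmult_1_r eps) at 2. apply Rmult_le_compat_l; [left; apply cond_pos|].
    apply Rle_div_l; lra.
Qed.

Theorem theorem3p1 (a : nat -> Z) :
  (is_theta4_coef a <-> theta4_log_derivative_expansion a) /\
  (is_theta4_coef a ->
   exists F : C -> C,
     entire_continuation 1 zeta_side F /\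
     forall s : C,
       exists inner : nat -> C,
         (forall k : nat,
            @is_series R_AbsRing C_R_NormedModule
              (fun m : nat =>
                 (Rcpow (INR (2 * m + 1)) ((s + 1) / 2)
                  * besselK ((s + 1) / 2)
                      (PI * sqrt (INR (S k)) * INR (2 * m + 1)))%C)
              (inner k)) /\
         @is_series R_AbsRing C_R_NormedModule
           (fun k : nat =>
              (IZR (a (S k)) * Rcpow (INR (S k)) (- ((1 + s) / 4))
               * inner k)%C)
           (F s)).
Proof.
  split; [rewrite log_derivative_expansion_iff; apply is_theta4_coef_iff|].
  intros Ha. pose proof (proj1 (is_theta4_coef_iff a) Ha) as Hk.
  exists (fun s => weight_mellin ((s - 1) / 2)). split.
  { split; [apply entire_weight_mellin|apply weight_mellin_zeta]. }
  intros s. set (nu := ((s + 1) / 2)%C).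
  replace ((s - 1) / 2)%C with (nu - 1)%C by (unfold nu; field).
  (* The inner sum carries n^(nu/2) from the substitution in the Bessel integral; since (1+s)/4 =
     nu/2, the outer factor cancels it exactly. *)
  exists (fun k => Rcpow (INR (S k)) (nu / 2) * row_mellin (nu - 1) k)%C. split.
  - intros k. apply is_series_ext with
      (fun m => Rcpow (INR (S k)) (nu / 2) * kernel_mellin (nu - 1) k m)%C.
    + intros m. symmetry. apply besselK_kernel_mellin.
    + apply is_series_Cmult, is_series_kernel_mellin.
  - apply is_series_ext with (2 := proj2 (is_series_row_mellin (nu - 1))). intros k.
    rewrite Hk, <- INR_IZR_INZ.
    replace ((1 + s) / 4)%C with (nu / 2)%C by (unfold nu; field).
    pose proof (Rcpow_opp (INR (S k)) (nu / 2)) as H. at_C.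
    transitivity (INR (asum (S k)) * (Rcpow (INR (S k)) (nu / 2) *
      Rcpow (INR (S k)) (- (nu / 2))) * row_mellin (nu - 1) k)%C; [rewrite H|]; ring.
Qed.
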